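(* Let $S^3\subset\mathbb{R}^4\cong\mathbb{C}^2$ be the unit sphere with its round metric, let $S^2\subset\mathbb{R}^3\cong\mathbb{C}\times\mathbb{R}$ be the sphere of radius $1/2$ with its round metric and area form $\omega$, and let $\pi:S^3\to S^2$ be the Hopf map, $\pi(z,w)=\big(z\bar w,\tfrac12(|z|^2-|w|^2)\big)$. Then $\pi$ minimizes the functional $F(\varphi)=\frac12\int_{S^3}\|\varphi^*\omega\|^2$ in its homotopy class; that is, $F(\pi)\le F(\varphi)$ for every smooth map $\varphi:S^3\to S^2$ homotopic to $\pi$.
   Context: All maps are smooth. For a smooth map $\varphi:(M,g)\to(N,\omega)$ from a compact Riemannian manifold to a symplectic manifold, $F(\varphi)=\frac12\int_M\|\varphi^*\omega\|^2\,d\mathrm{vol}_g$, where $\|\cdot\|$ is the pointwise norm on $2$-forms induced by $g$ (for an orthonormal coframe $e^1,\dots,e^m$, the forms $e^i\wedge e^j$, $i<j$, are orthonormal). With the radii chosen, the Hopf map is a Riemannian submersion. *)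

(* Defs.v *)
From HB Require Import structures.
From mathcomp Require Import all_boot all_order all_algebra.
From mathcomp Require Import all_classical all_reals all_analysis.
From mathcomp Require Import ring.

Set Implicit Arguments.
Unset Strict Implicit.
Unset Printing Implicit Defensive.

Import Order.TTheory GRing.Theory Num.Theory.
Import numFieldNormedType.Exports.

Local Open Scope classical_set_scope.
Local Open Scope ring_scope.

Section Smoothness.
Context {R : realType} {V W : normedModType R}.

(* Meant for [U] open and [V], [W] finite-dimensional. *)
Fixpoint Ck (k : nat) (U : set V) (f : V -> W) : Prop :=
  match k with
  | 0 => forall x, U x -> {for x, continuous f}
  | k'.+1 => (forall x, U x -> differentiable f x) /\
             (forall v, Ck k' U ('D_v f))
  end.

(* A map defined on an arbitrary subset [A] is smooth when it extends, locally
   around each point of [A], to a smooth map on an open set of the ambient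
   space.  The values of [f] outside [A] are irrelevant. *)
Definition smooth_on (A : set V) (f : V -> W) : Prop :=
  forall x, A x -> exists (U : set V) (g : V -> W),
    [/\ open U, U x, forall k, Ck k U g & forall y, U y -> A y -> f y = g y].

End Smoothness.

Definition homotopic {R : realType} {X Y : topologicalType}
    (A : set X) (B : set Y) (f g : X -> Y) : Prop :=
  exists H : R * X -> Y,
    [/\ {within (`[0, 1] : set R) `*` A, continuous H},
        forall t x, 0 <= t <= 1 -> A x -> B (H (t, x)),
        forall x, A x -> H (0, x) = f x &
        forall x, A x -> H (1, x) = g x].

Section EuclideanSpheres.
Context {R : realType}.

Definition dot n (u v : 'rV[R]_n) : R := \sum_(i < n) u 0 i * v 0 i.

(* The library norm [`|u|] on matrices is the sup norm. *)
Definition enorm n (u : 'rV[R]_n) : R := Num.sqrt (dot u u).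

Definition sphere n (r : R) : set 'rV[R]_n := [set x | enorm x = r].

Definition row3 (a b c : R) : 'rV[R]_3 := \row_i [:: a; b; c]`_i.
Definition row4 (a b c d : R) : 'rV[R]_4 := \row_i [:: a; b; c; d]`_i.

(* [x] stands for (z, w) = (x0 + i x1, x2 + i x3), and C x R is identified with
   R^3 by (a + i b, c) |-> (a, b, c); the first two coordinates below are
   the real and imaginary parts of z times the conjugate of w. *)
Definition hopf (x : 'rV[R]_4) : 'rV[R]_3 :=
  row3 (x 0 0 * x 0 2 + x 0 1 * x 0 3)
       (x 0 1 * x 0 2 - x 0 0 * x 0 3)
       (2^-1 * ((x 0 0 ^+ 2 + x 0 1 ^+ 2) - (x 0 2 ^+ 2 + x 0 3 ^+ 2))).

(* Differential at [x], on the unit sphere, of a map [f] defined on the unit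
   sphere: [f] is extended by the retraction y |-> y / |y|, which restricts to
   the identity on the sphere and whose differential at [x] is the identity on
   tangent vectors.  In other words, for [v] tangent at [x], this is the velocity
   at t = 0 of the image by [f] of the curve (x + t v) / |x + t v|. *)
Definition dsphere m n (f : 'rV[R]_m.+1 -> 'rV[R]_n.+1) (x v : 'rV[R]_m.+1)
    : 'rV[R]_n.+1 :=
  'D_v (fun y => f ((enorm y)^-1 *: y)) x.

Definition mx_of_rows (a b c : 'rV[R]_3) : 'M[R]_3 :=
  \matrix_(i < 3) [:: a; b; c]`_i.

(* Area form of a sphere of R^3 centred at the origin, at the point [p], oriented
   by the outward unit normal p / |p|. *)
Definition area_form (p u v : 'rV[R]_3) : R :=
  \det (mx_of_rows ((enorm p)^-1 *: p) u v).

Definition pullback_area (f : 'rV[R]_4 -> 'rV[R]_3) (x u v : 'rV[R]_4) : R :=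
  area_form (f x) (dsphere f x u) (dsphere f x v).

(* A global frame of S^3: the left multiples of [x] by the unit quaternions
   i, j, k; see [S3_frame_tangent] and [S3_frame_orthonormal]. *)
Definition S3_frame (x : 'rV[R]_4) (i : 'I_3) : 'rV[R]_4 :=
  [:: row4 (- x 0 1) (x 0 0) (- x 0 3) (x 0 2);
      row4 (- x 0 2) (x 0 3) (x 0 0) (- x 0 1);
      row4 (- x 0 3) (- x 0 2) (x 0 1) (x 0 0)]`_i.

(* Squared norm of a 2-form on T_x S^3 for which the e^i /\ e^j, i < j, are
   orthonormal, (e^i) being the coframe dual to the orthonormal frame above. *)
Definition S3_norm2 (x : 'rV[R]_4) (alpha : 'rV[R]_4 -> 'rV[R]_4 -> R) : R :=
  \sum_(i < 3) \sum_(j < 3 | (i < j)%N)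
    alpha (S3_frame x i) (S3_frame x j) ^+ 2.

(* Coordinates (eta, a, b) |-> (cos eta e^(i a), sin eta e^(i b)); the box
   [S3_box] covers S^3, injectively up to a null set. *)
Definition S3_param (p : R * R * R) : 'rV[R]_4 :=
  let: (eta, a, b) := p in
  row4 (cos eta * cos a) (cos eta * sin a) (sin eta * cos b) (sin eta * sin b).

Definition S3_box : set (R * R * R) :=
  `[0, pi / 2] `*` `[0, 2 * pi] `*` `[0, 2 * pi].

Definition coord_dir (i : 'I_3) : R * R * R :=
  [:: (1, 0, 0); (0, 1, 0); (0, 0, 1)]`_i.

(* Riemannian volume density sqrt (det (g_ij)) in these coordinates. *)
Definition S3_density (p : R * R * R) : R :=
  Num.sqrt (\det (\matrix_(i < 3, j < 3)
    dot ('D_(coord_dir i) S3_param p) ('D_(coord_dir j) S3_param p))).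

(* Integral of a nonnegative function for the Riemannian volume of S^3. *)
Definition S3_integral (f : 'rV[R]_4 -> R) : \bar R :=
  (\int[lebesgue_measure \x lebesgue_measure \x lebesgue_measure]_(p in S3_box)
     (f (S3_param p) * S3_density p)%:E)%E.

Definition energyF (f : 'rV[R]_4 -> 'rV[R]_3) : \bar R :=
  ((2^-1)%:E * S3_integral (fun x => S3_norm2 x (pullback_area f x)))%E.

Lemma dot4E (u v : 'rV[R]_4) :
  dot u v = u 0 0 * v 0 0 + u 0 1 * v 0 1 + u 0 2 * v 0 2 + u 0 3 * v 0 3.
Proof.
rewrite /dot !big_ord_recl big_ord0 addr0 !addrA.
by congr (_ + _ * _ + _ * _ + _ * _); congr (_ _ _); apply/val_inj.
Qed.

Lemma hopf_sphere (x : 'rV[R]_4) : sphere 1 x -> sphere 2^-1 (hopf x).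
Proof.
rewrite /sphere /= /enorm => /(congr1 (fun r => r ^+ 2)).
rewrite sqr_sqrtr; last by apply: sumr_ge0 => k _; rewrite -expr2 sqr_ge0.
rewrite expr1n dot4E => x1.
have -> : dot (hopf x) (hopf x) = (2^-1) ^+ 2.
  transitivity ((2^-1 * (x 0 0 * x 0 0 + x 0 1 * x 0 1 + x 0 2 * x 0 2
                         + x 0 3 * x 0 3)) ^+ 2); last by rewrite x1 mulr1.
  by rewrite /dot !big_ord_recl big_ord0 !mxE /=; field.
by rewrite sqrtr_sqr ger0_norm.
Qed.

Lemma S3_frame_tangent (x : 'rV[R]_4) i : dot x (S3_frame x i) = 0.
Proof.
by rewrite dot4E; case: i => [[|[|[|//]]] Hi]; rewrite /S3_frame !mxE /=; ring.
Qed.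

Lemma S3_frame_orthonormal (x : 'rV[R]_4) i j : sphere 1 x ->
  dot (S3_frame x i) (S3_frame x j) = (i == j)%:R.
Proof.
rewrite /sphere /= /enorm => /(congr1 (fun r => r ^+ 2)).
rewrite sqr_sqrtr; last by apply: sumr_ge0 => k _; rewrite -expr2 sqr_ge0.
rewrite expr1n !dot4E => x1.
case: i j => [[|[|[|//]]] Hi] [[|[|[|//]]] Hj];
  rewrite /S3_frame !mxE -val_eqE /= ?mulr0n ?mulr1n -?x1; ring.
Qed.

End EuclideanSpheres.

(* Main.v *)
(* S^3 carries a left-invariant orthonormal frame X_0, X_1, X_2 with [X_0, X_1] =
   - 2 X_2 and cyclically.  The Bochner formula
     int |curl a|^2 - 2 int a . curl a + int (div a)^2 = int |X a|^2
   for the coefficients a of a 1-form gives int |curl a|^2 >= 2 int a . curl a: since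
   a spherical polynomial is a Laplacian plus a constant and these polynomials are
   dense, div a can be made arbitrarily small by subtracting a gradient from a, which
   does not change curl a.  For a map phi to the sphere of radius 1/2, let W be the
   pullback of the area form of the unit sphere by 2 phi.  If W = curl a, then
   h = int a . curl a is the Hopf invariant of phi up to normalization, and
   32 F(phi) = int |W|^2 >= 2 h.  Equality holds for the Hopf map, for which W = curl a
   with a a constant multiple of the form dual to X_0.  Finally a primitive with the
   same h exists for every map homotopic to the Hopf map: if f and g are unit and
   nowhere antipodal, the pullbacks by f and g differ by the curl of
   det(f, g, X (f + g)) / (1 + f . g), which leaves h unchanged, and a homotopy is cut
   into small steps between smooth maps close to its slices. *)
From HB Require Import structures.
Require Import Defs.
From mathcomp Require Import all_boot all_order all_algebra.
From mathcomp Require Import all_classical all_reals all_analysis.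
From mathcomp Require Import ring lra.
From mathcomp Require Import measurable_realfun.
Import Order.TTheory GRing.Theory Num.Theory.
Import numFieldNormedType.Exports.
Set Implicit Arguments.
Unset Strict Implicit.
Unset Printing Implicit Defensive.
Local Open Scope classical_set_scope.
Local Open Scope ring_scope.

(** * Calculus of C^k maps *)

(** The global frame turns forms on S^3 into triples of functions, so everything about forms becomes
    algebra in a commutative ring with three derivations X_i satisfying the bracket relations and an
    additive functional that vanishes on every X_i f. Self-adjointness of curl, the Bochner formula
    and the transgression are polynomial identities in that setting. Analysis enters through two
    facts about the sphere: the integral of X_i f is zero, obtained in the coordinates (eta, a, b),
    and Laplacians are dense among functions of integral zero, obtained from uniform polynomial
    approximation. The quotient det(f, g, X (f + g)) / (1 + f . g) is the area form integrated along
    the shortest great-circle arc from f to g, which is why antipodal values must be avoided. The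
    homotopy is only continuous, so no form can be pulled back by its slices; they only guide the
    choice of nearby smooth maps. In 32 F = int |W|^2 a factor 16 comes from doubling the map to
    reach the unit sphere, which multiplies areas by 4, and a factor 2 from the half in F. *)

Lemma near_eq_differentiable {R : realType} {V W : normedModType R}
    (f g : V -> W) (x : V) :
  (\forall y \near x, f y = g y) -> differentiable f x -> differentiable g x.
Proof.
move=> fg df.
have fgx : f x = g x by exact: nbhs_singleton fg.
(* [g - f] vanishes near [x], hence has differential 0 there, and [g] is the sum of [f] and
   [g - f]. *)
have dh : (g - f) \o shift x = cst ((g - f) x) + \0 +o_ 0 id.
  apply/eqaddoP => _/posnumP[e].
  have : \forall y \near 0, f (y + x) = g (y + x).
    by move: fg; rewrite (near_shift 0 x) /= subr0.
  apply: filterS => y /= fgy.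
  rewrite !fctE /= fgy fgx !subrr addr0 subr0 normr0.
  by rewrite mulr_ge0.
have : differentiable (g - f) x.
  apply/diff_locallyP; have E : 'd (g - f) x = \0 :> (V -> W).
    by apply: (@diff_unique _ _ _ (g - f) \0) => //; move=> ?; exact: cvg_cst.
  by rewrite E; split => //; move=> ?; exact: cvg_cst.
by move=> /(differentiableD df); rewrite addrC subrK.
Qed.

Lemma Ck_ext {R : realType} {V W : normedModType R} k (U : set V)
    (f g : V -> W) : open U ->
  (forall x, U x -> f x = g x) -> Ck k U f -> Ck k U g.
Proof.
move=> oU; elim: k f g => [|k IH] f g fg.
  move=> cf x Ux; have fgx : \forall y \near x, f y = g y.
    by apply: filterS (open_nbhs_nbhs (conj oU Ux)) => y /fg.
  have -> : {for x, continuous g} = (g y @[y --> x] --> f x) by rewrite (fg _ Ux).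
  by apply: cvg_trans (cf _ Ux); apply: near_eq_cvg.
move=> [df Df]; split.
  move=> x Ux; apply: near_eq_differentiable (df _ Ux).
  by apply: filterS (open_nbhs_nbhs (conj oU Ux)) => y /fg.
move=> v; apply: IH (Df v) => x Ux; apply: near_eq_derive.
by apply: filterS (open_nbhs_nbhs (conj oU Ux)) => y /fg.
Qed.

Lemma Ck_sub {R : realType} {V W : normedModType R} k (U U' : set V)
    (f : V -> W) : U' `<=` U -> Ck k U f -> Ck k U' f.
Proof.
move=> sU; elim: k f => [|k IH] f; first by move=> cf x /sU; exact: cf.
by move=> [df Df]; split=> [x /sU|v]; [exact: df|exact: IH _ (Df v)].
Qed.

(** Glues the local extensions supplied by [smooth_on]: every clause of [Ck] is a condition at
    single points. *)
Lemma Ck_local {R : realType} {V W : normedModType R} k (U : set V)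
    (f : V -> W) :
  (forall x, U x -> exists U', U' x /\ Ck k U' f) -> Ck k U f.
Proof.
elim: k f => [|k IH] f loc.
  by move=> x /loc[U' [U'x]]; apply.
split=> [x /loc[U' [U'x [+ _]]]|v]; first exact.
by apply: IH => x /loc[U' [U'x [_ Df]]]; exists U'; split => //; exact: Df.
Qed.

Lemma CkW {R : realType} {V W : normedModType R} k (U : set V) (f : V -> W) :
  Ck k.+1 U f -> Ck k U f.
Proof.
elim: k f => [|k IH] f [df Df].
  by move=> x Ux; apply: differentiable_continuous; exact: df.
by split=> // v; apply: IH.
Qed.

Lemma cvg_sumr {R : realType} {W : normedModType R} (T : Type)
    (F : set_system T) {FF : Filter F} (n : nat) (f : 'I_n -> T -> W)
    (l : 'I_n -> W) :
  (forall j, f j @ F --> l j) ->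
  \sum_(j < n) f j x @[x --> F] --> \sum_(j < n) l j.
Proof.
move=> fl; elim: n f l fl => [|n IH] f l fl.
  under eq_fun do rewrite big_ord0; rewrite big_ord0; exact: cvg_cst.
under eq_fun do rewrite big_ord_recl; rewrite big_ord_recl.
by apply: cvgD => //; apply: (IH (fun j => f (lift ord0 j))) => j; exact: fl.
Qed.

Lemma continuous_row {R : realType} (T : topologicalType) m (n : T -> 'rV[R]_m)
    (x : T) : (forall j, {for x, continuous (fun y => n y 0 j)}) ->
  {for x, continuous n}.
Proof.
move=> cn; have nE : n = fun y => \sum_(j < m) n y 0 j *: (delta_mx 0 j : 'rV[R]_m).
  by apply/funext => y; exact: row_sum_delta.
suff : {for x, continuous (fun y => \sum_(j < m) n y 0 j *: (delta_mx 0 j : 'rV[R]_m))}.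
  by rewrite -nE.
by apply: cvg_sumr => j; apply: cvgZr_tmp; exact: cn.
Qed.

Section CkReal.
Context {R : realType} {V : normedModType R}.
Implicit Types (U : set V) (f g : V -> R).

Lemma Ck_cst {W : normedModType R} k U (c : W) : Ck k U (fun=> c).
Proof.
elim: k c => [|k IH] c; first by move=> x _; exact: cvg_cst.
split=> [x _|v]; first exact: differentiable_cst.
rewrite (_ : 'D_v _ = fun=> 0); first exact: IH.
by apply/funext => x; exact: derive_cst.
Qed.

Lemma CkD k U f g : open U -> Ck k U f -> Ck k U g ->
  Ck k U (fun x => f x + g x).
Proof.
move=> oU; elim: k f g => [|k IH] f g.
  by move=> cf cg x Ux; apply: cvgD; [exact: cf|exact: cg].
move=> [df Df] [dg Dg]; split=> [x Ux|v].
  by apply: differentiableD; [exact: df|exact: dg].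
apply: Ck_ext (IH _ _ (Df v) (Dg v)) => // x Ux; symmetry.
by apply: deriveD; apply: diff_derivable; [exact: df|exact: dg].
Qed.

Lemma CkM k U f g : open U -> Ck k U f -> Ck k U g ->
  Ck k U (fun x => f x * g x).
Proof.
move=> oU; elim: k f g => [|k IH] f g.
  by move=> cf cg x Ux; apply: cvgM; [exact: cf|exact: cg].
move=> cf cg; have [df Df] := cf; have [dg Dg] := cg; split=> [x Ux|v].
  by apply: differentiableM; [exact: df|exact: dg].
have H : Ck k U (fun x => f x * 'D_v g x + g x * 'D_v f x).
  by apply: CkD => //; [exact: IH (CkW cf) (Dg v)|exact: IH (CkW cg) (Df v)].
apply: Ck_ext H => // x Ux; symmetry.
by apply: deriveM; apply: diff_derivable; [exact: df|exact: dg].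
Qed.

Lemma CkZ k U (c : R) f : open U -> Ck k U f -> Ck k U (fun x => c * f x).
Proof. by move=> oU; apply: CkM => //; exact: Ck_cst. Qed.

Lemma CkN k U f : open U -> Ck k U f -> Ck k U (fun x => - f x).
Proof.
by move=> oU /(CkZ (-1) oU); apply: Ck_ext => // x _; rewrite mulN1r.
Qed.

Lemma Ck_sum k U n (f : 'I_n -> V -> R) : open U ->
  (forall i, Ck k U (f i)) -> Ck k U (fun x => \sum_(i < n) f i x).
Proof.
move=> oU; elim: n f => [|n IH] f Cf.
  by apply: Ck_ext (Ck_cst k U (0 : R)) => // x _; rewrite big_ord0.
apply: Ck_ext (CkD oU (Cf ord0) (IH _ (fun i => Cf (lift ord0 i)))) => // x _.
by rewrite big_ord_recl.
Qed.

Lemma CkV k U f : open U -> (forall x, U x -> f x != 0) -> Ck k U f ->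
  Ck k U (fun x => (f x)^-1).
Proof.
move=> oU f0; elim: k => [|k IH].
  by move=> cf x Ux; apply: cvgV; [exact: f0|exact: cf].
move=> cf; have [df Df] := cf; split=> [x Ux|v].
  by apply: differentiableV; [exact: df|exact: f0].
have H : Ck k U (fun x => - (((f x)^-1 * (f x)^-1) * 'D_v f x)).
  apply: CkN => //; apply: CkM (Df v) => //.
  by apply: CkM => //; exact: IH (CkW cf).
apply: Ck_ext H => // x Ux; rewrite [RHS]deriveV//; last 2 first.
- exact: f0.
- by apply: diff_derivable; exact: df.
by rewrite scaleNr -invfM expr2.
Qed.

Lemma Ck_sqrt k U f : open U -> (forall x, U x -> 0 < f x) -> Ck k U f ->
  Ck k U (fun x => Num.sqrt (f x)).
Proof.
move=> oU f0; have s0 x : U x -> Num.sqrt (f x) != 0.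
  by move=> /f0; rewrite -sqrtr_gt0 => /lt0r_neq0.
have dsq x : U x -> is_derive (f x) 1 Num.sqrt (2 * Num.sqrt (f x))^-1.
  by move=> /f0 ?; exact: is_derive1_sqrt.
elim: k => [|k IH].
  move=> cf x Ux; apply: (@continuous_comp _ _ _ f Num.sqrt); first exact: cf.
  exact: sqrt_continuous.
move=> cf; have [df Df] := cf.
have dS x : U x -> differentiable (Num.sqrt : R -> R) (f x).
  by move=> Ux; apply/derivable1_diffP; case: (dsq _ Ux).
split=> [x Ux|v].
  by apply: (@differentiable_comp _ _ _ _ f Num.sqrt); [exact: df|exact: dS].
have H : Ck k U (fun x => 2^-1 * ((Num.sqrt (f x))^-1 * 'D_v f x)).
  apply: CkZ => //; apply: CkM (Df v) => //.
  by apply: CkV => //; exact: IH (CkW cf).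
apply: Ck_ext H => // x Ux; symmetry.
rewrite deriveE; last first.
  by apply: (@differentiable_comp _ _ _ _ f Num.sqrt); [exact: df|exact: dS].
have -> : 'd (fun y => Num.sqrt (f y)) x v = 'd (Num.sqrt : R -> R) (f x) ('d f x v).
  exact: (congr1 (fun h : V -> R => h v) (diff_comp (df _ Ux) (dS _ Ux))).
rewrite -(deriveE _ (df _ Ux)).
have [_ d1] := dsq _ Ux.
rewrite (diff1E (dS _ Ux)) derive1E d1 /=.
rewrite -[LHS]/('D_v f x * (2 * Num.sqrt (f x))^-1) invfM.
by rewrite mulrC mulrA.
Qed.

(** By the chain rule a derivative of [g \o n] is a finite sum of derivatives of the coordinates of
    [n] times partial derivatives of [g] composed with [n], to which the induction on [k]
    applies. *)
Lemma Ck_comp m k U (W : set 'rV[R]_m) (n : V -> 'rV[R]_m) (g : 'rV[R]_m -> R) :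
  open U -> (forall x, U x -> W (n x)) ->
  (forall j, Ck k U (fun x => n x 0 j)) -> Ck k W g -> Ck k U (g \o n).
Proof.
move=> oU UW.
have nE : n = fun x => \sum_(j < m) (n x 0 j) *: (delta_mx 0 j : 'rV[R]_m).
  by apply/funext => x; exact: row_sum_delta.
elim: k g => [|k IH] g.
  move=> cn cg x Ux; apply: continuous_comp; last exact/cg/UW.
  by apply: continuous_row => j; exact: cn.
move=> cn [dg Dg].
have dn x : U x -> differentiable n x.
  move=> Ux; rewrite nE.
  have -> : (fun x => \sum_(j < m) n x 0 j *: (delta_mx 0 j : 'rV[R]_m)) =
      \sum_(j < m) (fun x => n x 0 j *: (delta_mx 0 j : 'rV[R]_m)).
    by apply/funext => y; rewrite fct_sumE.
  by apply: differentiable_sum => j; apply: differentiableZl; case: (cn j) => + _; exact.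
split=> [x Ux|v].
  by apply: differentiable_comp; [exact: dn|exact/dg/UW].
have H : Ck k U (fun x => \sum_(j < m) 'D_v (fun x => n x 0 j) x * ('D_(delta_mx 0 j) g \o n) x).
  apply: Ck_sum => // j; apply: CkM => //; first by case: (cn j) => _ Dn; exact: Dn.
  by apply: IH (Dg _) => i; exact: CkW (cn i).
apply: Ck_ext H => // x Ux; symmetry.
rewrite deriveE; last by apply: differentiable_comp; [exact: dn|exact/dg/UW].
rewrite (diff_comp (dn _ Ux) (dg _ (UW _ Ux))) /= -(deriveE _ (dn _ Ux)).
rewrite derive_mx; last by apply: diff_derivable; exact: dn.
rewrite [X in 'd _ _ X]row_sum_delta linear_sum.
apply: eq_bigr => j _; rewrite mxE linearZ /= (deriveE _ (dg _ (UW _ Ux))).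
by [].
Qed.
End CkReal.

(** * Symmetry of second derivatives *)

Section Schwarz.
Context {R : realType} {V : normedModType R}.

Lemma is_derive_line (F : V -> R) (y v : V) (s : R) :
  differentiable F (y + s *: v) ->
  is_derive s 1 (fun t : R => F (y + t *: v)) ('D_v F (y + s *: v)).
Proof.
move=> dF.
have E : (fun h : R => h^-1 *: (F (y + (h *: (1 : R) + s) *: v) - F (y + s *: v))) =
    (fun h : R => h^-1 *: (F (h *: v + (y + s *: v)) - F (y + s *: v))).
  apply/funext => h; congr (_ *: (F _ - _)).
  by rewrite scalerDl addrCA /GRing.scale /= mulr1.
have := @diff_derivable _ _ _ F _ v dF; rewrite /derivable -E => dv.
by apply: DeriveDef; rewrite // /derive E.
Qed.

Lemma mean_value_line (F : V -> R) (y v : V) (h : R) : 0 < h ->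
  (forall s, 0 <= s <= h -> differentiable F (y + s *: v)) ->
  exists2 c, 0 < c < h & F (y + h *: v) - F y = 'D_v F (y + c *: v) * h.
Proof.
move=> h0 dF.
have [|||c] := @MVT R (fun t => F (y + t *: v)) (fun t => 'D_v F (y + t *: v)) 0 h.
- exact: h0.
- move=> s; rewrite in_itv /= => /andP[s0 sh].
  by apply: is_derive_line; apply: dF; rewrite !ltW.
- apply: derivable_within_continuous => s; rewrite in_itv /= => s0h.
  by have [] := is_derive_line (dF _ s0h).
by rewrite in_itv /= scale0r addr0 subr0 => c0h ->; exists c.
Qed.

(** The mean value theorem is used twice: along [u] for the difference of [f] between two parallel
    sides, then along [v] for ['D_u f]. *)
Let second_difference (U : set V) (f : V -> R) (x u v : V) (h : R) : 0 < h ->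
  (forall s t : R, 0 <= s <= h -> 0 <= t <= h -> U (x + s *: u + t *: v)) ->
  Ck 2 U f ->
  exists c c' : R, [/\ 0 < c < h, 0 < c' < h &
    f (x + h *: u + h *: v) - f (x + h *: u) - (f (x + h *: v) - f x) =
    'D_v ('D_u f) (x + c *: u + c' *: v) * h * h].
Proof.
move=> h0 inU [df Df].
have h0h : 0 <= h <= h by rewrite lexx ltW.
have z0h : 0 <= (0 : R) <= h by rewrite lexx ltW.
pose F z := f (z + h *: v) - f z.
have inU0 s : 0 <= s <= h -> U (x + s *: u).
  by move=> s0h; rewrite -[_ + _]addr0 -(scale0r v); exact: inU.
have [c c0h Ec] : exists2 c, 0 < c < h &
    F (x + h *: u) - F x = ('D_u f (x + c *: u + h *: v) - 'D_u f (x + c *: u)) * h.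
  pose G s := f (x + h *: v + s *: u) - f (x + s *: u).
  have dG s : 0 <= s <= h -> is_derive s 1 G
      ('D_u f (x + s *: u + h *: v) - 'D_u f (x + s *: u)).
    move=> s0h; rewrite [x + s *: u + _]addrAC.
    apply: is_deriveB; apply: is_derive_line; apply: df; last exact: inU0.
    by rewrite addrAC; exact: inU.
  have [|||c] := @MVT R G
      (fun s => 'D_u f (x + s *: u + h *: v) - 'D_u f (x + s *: u)) 0 h.
  - exact: h0.
  - by move=> s; rewrite in_itv /= => /andP[s0 sh]; apply: dG; rewrite !ltW.
  - apply: derivable_within_continuous => s; rewrite in_itv /= => s0h.
    by have [] := dG _ s0h.
  rewrite in_itv /= subr0 => c0h Gc; exists c => //; rewrite -Gc.
  by rewrite /G /F !scale0r !addr0 [x + h *: u + _]addrAC.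
have c0h' : 0 <= c <= h by case/andP: c0h => *; rewrite !ltW.
have [t t0h|c' c0h'' Ec'] := @mean_value_line ('D_u f) (x + c *: u) v h h0.
  by have [+ _] := Df u; apply; exact: inU.
exists c, c'; split => //; rewrite -Ec'.
exact: Ec.
Qed.

(** The second difference over the parallelogram with sides [h *: u] and [h *: v] is symmetric in
    [u] and [v]. The two mixed derivatives therefore take a common value, each at some point of the
    parallelogram, and continuity at [x] concludes as [h] shrinks. *)
Lemma derive_comm (U : set V) (f : V -> R) (x u v : V) : open U -> U x ->
  Ck 2 U f -> 'D_u ('D_v f) x = 'D_v ('D_u f) x.
Proof.
move=> oU Ux cf.
have cont w w' : {for x, continuous ('D_w ('D_w' f))} by case: cf => _ /(_ w')[_]; apply.
have [r /= r0 rU] : exists2 r : R, 0 < r & forall y, `|x - y| < r -> U y.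
  have /nbhs_ballP[r /= r0 rU] := open_nbhs_nbhs (conj oU Ux); exists r => // y xy.
  by apply: rU; rewrite -ball_normE.
apply/eqP; rewrite -subr_eq0 -normr_le0; apply/ler_addgt0Pr => e e0; rewrite add0r.
have e20 : 0 < e / 2 by rewrite divr_gt0.
have /cvgrPdist_lt/(_ _ e20) /nbhs_ballP [r1 /= r10 H1] := cont u v.
have /cvgrPdist_lt/(_ _ e20) /nbhs_ballP [r2 /= r20 H2] := cont v u.
pose m := Num.min r (Num.min r1 r2).
have m0 : 0 < m by rewrite !lt_min r0 r10.
(* The displacement is at most [h * (1 + |u| + |v|) = m / 2]; the summand 1 keeps the divisor
   positive when both directions vanish. *)
have [h h0 small] : exists2 h : R, 0 < h & forall s t : R,
    0 <= s <= h -> 0 <= t <= h -> `|x - (x + s *: u + t *: v)| < m.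
  have uv0 : 0 < 1 + `|u| + `|v| by rewrite -addrA ltr_wpDr// addr_ge0.
  exists (m / 2 / (1 + `|u| + `|v|)); first by rewrite !divr_gt0.
  move=> s t /andP[s0 sh] /andP[t0 th].
  rewrite -addrA opprD addrA subrr add0r normrN.
  apply: (@le_lt_trans _ _ (m / 2)); last by rewrite ltr_pdivrMr// ltr_pMr// ltr1n.
  apply: le_trans (ler_normD _ _) _; rewrite !normrZ (ger0_norm s0) (ger0_norm t0).
  move: sh th; set h := m / 2 / _ => sh th.
  apply: (@le_trans _ _ (h * (1 + `|u| + `|v|))); last by rewrite /h divfK ?gt_eqF.
  rewrite !mulrDr mulr1 -addrA ler_wpDl//; first exact: le_trans sh.
  by apply: lerD; apply: ler_wpM2r.
have inU s t : 0 <= s <= h -> 0 <= t <= h -> U (x + s *: u + t *: v).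
  by move=> s0 t0; apply: rU; apply: lt_le_trans (small _ _ s0 t0) _; rewrite ge_min lexx.
have [c [c' [c0 c0' E]]] := second_difference h0 inU cf.
have [|d [d' [d0 d0' E']]] := @second_difference U f x v u h h0 _ cf.
  by move=> s t s0 t0; rewrite addrAC; exact: inU.
have {E E'} : 'D_v ('D_u f) (x + c *: u + c' *: v) = 'D_u ('D_v f) (x + d' *: u + d *: v).
  have h1 := lt0r_neq0 h0; apply: (mulIf h1); apply: (mulIf h1).
  have e1 : x + d *: v + d' *: u = x + d' *: u + d *: v by exact: addrAC.
  have e2 : x + h *: u + h *: v = x + h *: v + h *: u by exact: addrAC.
  apply: (etrans _ (etrans E' (congr1 (fun z => 'D_u ('D_v f) z * h * h) e1))).
  apply: (etrans (esym E)); move: (congr1 f e2) => /= ->.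
  by move: (f _) (f _) (f _) (f _) => w1 w2 w3 w4; ring.
have in0h (a : R) : 0 < a < h -> 0 <= a <= h by case/andP => a0 ah; rewrite !ltW.
have near1 s t : 0 < s < h -> 0 < t < h ->
    `|'D_u ('D_v f) x - 'D_u ('D_v f) (x + s *: u + t *: v)| < e / 2.
  move=> s0 t0; apply: H1; rewrite -ball_normE /=.
  by apply: lt_le_trans (small _ _ (in0h _ s0) (in0h _ t0)) _; rewrite !ge_min lexx !orbT.
have near2 s t : 0 < s < h -> 0 < t < h ->
    `|'D_v ('D_u f) x - 'D_v ('D_u f) (x + s *: u + t *: v)| < e / 2.
  move=> s0 t0; apply: H2; rewrite -ball_normE /=.
  by apply: lt_le_trans (small _ _ (in0h _ s0) (in0h _ t0)) _; rewrite !ge_min lexx !orbT.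
have close (A B p : R) : `|A - p| < e / 2 -> `|B - p| < e / 2 -> `|A - B| <= e.
  move=> Ap Bp; apply/ltW/(le_lt_trans (ler_distD p _ _)).
  by rewrite (splitr e) ltrD // distrC.
by move=> E; apply: close (near1 _ _ d0' d0) _; rewrite -E; exact: near2.
Qed.
End Schwarz.

(** * Smooth functions on the 3-sphere *)

Section SphereFunctions.
Context {R : realType}.
Local Notation E4 := 'rV[R]_4.

Lemma dot_sym n (u v : 'rV[R]_n) : dot u v = dot v u.
Proof. by apply: eq_bigr => i _; rewrite mulrC. Qed.

Lemma dotZl n (a : R) (u v : 'rV[R]_n) : dot (a *: u) v = a * dot u v.
Proof. by rewrite /dot mulr_sumr; apply: eq_bigr => i _; rewrite mxE mulrA. Qed.

Lemma dotDl n (u v w : 'rV[R]_n) : dot (u + v) w = dot u w + dot v w.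
Proof. by rewrite /dot -big_split; apply: eq_bigr => i _; rewrite mxE mulrDl. Qed.

Lemma dot_ge0 n (u : 'rV[R]_n) : 0 <= dot u u.
Proof. by apply: sumr_ge0 => i _; rewrite -expr2 sqr_ge0. Qed.

Lemma dot_eq0 n (u : 'rV[R]_n) : (dot u u == 0) = (u == 0).
Proof.
rewrite psumr_eq0 => [|i _]; last by rewrite -expr2 sqr_ge0.
apply/allP/eqP => [u0|-> i _]; last by rewrite mxE mul0r eqxx.
apply/rowP => i; rewrite mxE; apply/eqP; rewrite -[_ == 0]orbb -mulf_eq0.
by apply: u0; rewrite mem_index_enum.
Qed.

Lemma enorm_eq0 n (u : 'rV[R]_n) : (enorm u == 0) = (u == 0).
Proof. by rewrite sqrtr_eq0 -dot_eq0 eq_le dot_ge0 andbT. Qed.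

Lemma enorm_gt0 n (u : 'rV[R]_n) : (0 < enorm u) = (u != 0).
Proof. by rewrite lt_def enorm_eq0 sqrtr_ge0 andbT. Qed.

Lemma enorm_sqr n (u : 'rV[R]_n) : enorm u ^+ 2 = dot u u.
Proof. by rewrite sqr_sqrtr// dot_ge0. Qed.

Lemma enormZ n (a : R) (u : 'rV[R]_n) : enorm (a *: u) = `|a| * enorm u.
Proof.
by rewrite /enorm dotZl dot_sym dotZl mulrA sqrtrM -?expr2 ?sqr_ge0// sqrtr_sqr.
Qed.

Lemma sphere1P n (u : 'rV[R]_n) : sphere 1 u <-> dot u u = 1.
Proof.
rewrite -enorm_sqr /sphere /=; split=> [->|/eqP]; first by rewrite expr1n.
by rewrite sqrp_eq1 ?sqrtr_ge0// => /eqP.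
Qed.

Lemma sphere_normalize n (u : 'rV[R]_n) : u != 0 -> sphere 1 ((enorm u)^-1 *: u).
Proof.
move=> u0; rewrite /sphere /= enormZ ger0_norm ?invr_ge0 ?sqrtr_ge0//.
by rewrite mulVf ?enorm_eq0.
Qed.

Lemma sphere_neq0 n (u : 'rV[R]_n) : sphere 1 u -> u != 0.
Proof. by rewrite /sphere /= -enorm_gt0 => ->. Qed.

Lemma sphere_normalized n (u : 'rV[R]_n) : sphere 1 u -> (enorm u)^-1 *: u = u.
Proof. by move=> ->; rewrite invr1 scale1r. Qed.

Definition punctured : set E4 := [set x | x != 0].

Lemma open_punctured : open punctured.
Proof.
have -> : punctured = ~` [set 0].
  by apply/seteqP; split => x /= /eqP.
by apply: closed_openC; apply: accessible_closed_set1; apply: hausdorff_accessible; exact: norm_hausdorff.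
Qed.

Lemma Ck_coord k (U : set E4) (j : 'I_4) : Ck k U (fun x => x 0 j).
Proof.
have D v : 'D_v (fun x : E4 => x 0 j) = fun=> v 0 j.
  apply/funext => x.
  by have := @derive_mx _ _ _ _ id x v (@derivable_id _ _ x v); rewrite derive_id => /rowP/(_ j); rewrite mxE.
case: k => [|k]; first by move=> x _; exact: coord_continuous.
by split=> [x _|v]; [exact: differentiable_coord|rewrite D; exact: Ck_cst].
Qed.

Lemma derive_coord (v x : E4) (j : 'I_4) : 'D_v (fun x : E4 => x 0 j) x = v 0 j.
Proof.
by have := @derive_mx _ _ _ _ id x v (@derivable_id _ _ x v); rewrite derive_id => /rowP/(_ j); rewrite mxE.
Qed.

Definition smooth_hom0 (f : E4 -> R) : Prop :=
  [/\ f 0 = 0, forall l y, 0 < l -> f (l *: y) = f y & forall k, Ck k punctured f].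

(* Smooth functions on the sphere, extended to the punctured space as
   0-homogeneous functions and by 0 at the origin, so that the algebraic
   identities below hold everywhere. *)
Record sfun := SFun { sfun_val :> E4 -> R; sfunP : smooth_hom0 sfun_val }.

HB.instance Definition _ := gen_eqMixin sfun.
HB.instance Definition _ := gen_choiceMixin sfun.

(** Homogeneity propagates equality from the sphere along rays, and the prescribed value at the
    origin does the rest. Ring axioms and identities can thus be checked on the sphere alone. *)
Lemma sfun_ext (f g : sfun) : (forall y, sphere 1 y -> f y = g y) -> f = g.
Proof.
move=> fg; have {}fg : sfun_val f = g.
  apply/funext => y; have [->|y0] := eqVneq y 0.
    by have [-> _ _] := sfunP f; have [-> _ _] := sfunP g.
  have l0 : 0 < (enorm y)^-1 by rewrite invr_gt0 enorm_gt0.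
  have [_ fl _] := sfunP f; have [_ gl _] := sfunP g.
  by rewrite -(fl _ _ l0) -(gl _ _ l0); apply: fg; exact: sphere_normalize.
by case: f g fg => f fP [g gP] /= fg; subst g; congr SFun; exact: Prop_irrelevance.
Qed.

Lemma sfun_cst_subproof (c : R) : smooth_hom0 (fun y => if y == 0 then 0 else c).
Proof.
split=> [|l y l0|k]; first by rewrite eqxx.
  by rewrite scaler_eq0 gt_eqF.
apply: Ck_ext (Ck_cst k _ c); first exact: open_punctured.
by move=> y /= /negPf ->.
Qed.

Definition sfun_cst c := SFun (sfun_cst_subproof c).

Lemma sfun_cstE c y : sphere 1 y -> sfun_cst c y = c.
Proof. by move=> /sphere_neq0 y0; rewrite /= (negPf y0). Qed.

Lemma sfun_add_subproof (f g : sfun) : smooth_hom0 (fun y => f y + g y).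
Proof.
have [f0 fl fk] := sfunP f; have [g0 gl gk] := sfunP g.
split=> [|l y l0|k]; first by rewrite f0 g0 addr0.
  by rewrite fl// gl.
by apply: CkD => //; exact: open_punctured.
Qed.

Definition sfun_add f g := SFun (sfun_add_subproof f g).

Lemma sfun_mul_subproof (f g : sfun) : smooth_hom0 (fun y => f y * g y).
Proof.
have [f0 fl fk] := sfunP f; have [g0 gl gk] := sfunP g.
split=> [|l y l0|k]; first by rewrite f0 mul0r.
  by rewrite fl// gl.
by apply: CkM => //; exact: open_punctured.
Qed.

Definition sfun_mul f g := SFun (sfun_mul_subproof f g).

Lemma sfun_opp_subproof (f : sfun) : smooth_hom0 (fun y => - f y).
Proof.
have [f0 fl fk] := sfunP f.
split=> [|l y l0|k]; first by rewrite f0 oppr0.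
  by rewrite fl.
by apply: CkN => //; exact: open_punctured.
Qed.

Definition sfun_opp f := SFun (sfun_opp_subproof f).

Fact sfun_addA : associative sfun_add.
Proof. by move=> f g h; apply: sfun_ext => y _ /=; rewrite addrA. Qed.
Fact sfun_addC : commutative sfun_add.
Proof. by move=> f g; apply: sfun_ext => y _ /=; rewrite addrC. Qed.
Fact sfun_add0 : left_id (sfun_cst 0) sfun_add.
Proof. by move=> f; apply: sfun_ext => y S /=; rewrite if_same add0r. Qed.
Fact sfun_addN : left_inverse (sfun_cst 0) sfun_opp sfun_add.
Proof. by move=> f; apply: sfun_ext => y S /=; rewrite if_same addNr. Qed.
HB.instance Definition _ :=
  GRing.isZmodule.Build sfun sfun_addA sfun_addC sfun_add0 sfun_addN.

Fact sfun_mulA : associative sfun_mul.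
Proof. by move=> f g h; apply: sfun_ext => y _ /=; rewrite mulrA. Qed.
Fact sfun_mulC : commutative sfun_mul.
Proof. by move=> f g; apply: sfun_ext => y _ /=; rewrite mulrC. Qed.
Fact sfun_mul1 : left_id (sfun_cst 1) sfun_mul.
Proof. by move=> f; apply: sfun_ext => y S; rewrite -[LHS]/(sfun_cst 1 y * f y) sfun_cstE// mul1r. Qed.
Fact sfun_mulD : left_distributive sfun_mul sfun_add.
Proof. by move=> f g h; apply: sfun_ext => y _ /=; rewrite mulrDl. Qed.
Fact sfun_1neq0 : sfun_cst 1 != sfun_cst 0.
Proof.
apply/eqP => /(congr1 (fun f : sfun => f (const_mx 1))) /=.
rewrite ifF ?if_same; first by move/eqP; rewrite oner_eq0.
by apply/eqP => /rowP /(_ 0) /eqP; rewrite !mxE oner_eq0.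
Qed.
HB.instance Definition _ :=
  GRing.Zmodule_isComNzRing.Build sfun sfun_mulA sfun_mulC sfun_mul1 sfun_mulD sfun_1neq0.

Lemma sfunD (f g : sfun) y : (f + g) y = f y + g y. Proof. by []. Qed.
Lemma sfunN (f : sfun) y : (- f) y = - f y. Proof. by []. Qed.
Lemma sfunM (f g : sfun) y : (f * g) y = f y * g y. Proof. by []. Qed.
Lemma sfun0 y : (0 : sfun) y = 0. Proof. by rewrite /= if_same. Qed.
Lemma sfun1 y : sphere 1 y -> (1 : sfun) y = 1. Proof. exact: sfun_cstE. Qed.

Lemma frame_lin (i : 'I_3) (a : R) (u v : E4) :
  S3_frame (a *: u + v) i = a *: S3_frame u i + S3_frame v i.
Proof.
apply/rowP => l; case: i => [[|[|[|//]]] ?];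
  case: l => [[|[|[|[|//]]]] ?]; rewrite /S3_frame /= !mxE /= ?mxE; ring.
Qed.

Lemma frameZ (i : 'I_3) (a : R) (u : E4) : S3_frame (a *: u) i = a *: S3_frame u i.
Proof.
have f0 : S3_frame 0 i = 0 :> E4.
  by have := frame_lin i (-1) 0 (0 : E4); rewrite !scaleN1r oppr0 addr0 addNr.
by rewrite -[a *: u]addr0 frame_lin f0 addr0.
Qed.

Lemma frame0 (i : 'I_3) : S3_frame 0 i = 0 :> E4.
Proof. by rewrite -(scale0r (0 : E4)) frameZ !scale0r. Qed.

Lemma frame_coord (i : 'I_3) (l : 'I_4) :
  exists (s : R) (m : 'I_4), forall y : E4, S3_frame y i 0 l = s * y 0 m.
Proof.
have H (s : R) (m : 'I_4) : (forall y : E4, S3_frame y i 0 l = s * y 0 m) ->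
  exists (s : R) (m : 'I_4), forall y : E4, S3_frame y i 0 l = s * y 0 m.
  by exists s, m.
case: i H => [[|[|[|//]]] ?]; case: l => [[|[|[|[|//]]]] ?] H;
  first [ apply: (H (-1) 0) => y; by rewrite /S3_frame mxE /= mulN1r
        | apply: (H (-1) 1) => y; by rewrite /S3_frame mxE /= mulN1r
        | apply: (H (-1) 2) => y; by rewrite /S3_frame mxE /= mulN1r
        | apply: (H (-1) 3) => y; by rewrite /S3_frame mxE /= mulN1r
        | apply: (H 1 0) => y; by rewrite /S3_frame mxE /= mul1r
        | apply: (H 1 1) => y; by rewrite /S3_frame mxE /= mul1r
        | apply: (H 1 2) => y; by rewrite /S3_frame mxE /= mul1r
        | apply: (H 1 3) => y; by rewrite /S3_frame mxE /= mul1r ].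
Qed.

Lemma Ck_frame k (U : set E4) (i : 'I_3) (l : 'I_4) : open U ->
  Ck k U (fun y => S3_frame y i 0 l).
Proof.
move=> oU; have [s [m E]] := frame_coord i l.
by apply: Ck_ext (CkZ s oU (Ck_coord k U m)) => // y _; rewrite E.
Qed.

Lemma derive_frame (i : 'I_3) (l : 'I_4) (v x : E4) :
  'D_v (fun y => S3_frame y i 0 l) x = S3_frame v i 0 l.
Proof.
have [s [m E]] := frame_coord i l.
have -> : (fun y => S3_frame y i 0 l) = (fun y : E4 => s * y 0 m).
  by apply/funext.
rewrite [LHS]deriveZ; last exact/diff_derivable/differentiable_coord.
by rewrite derive_coord E.
Qed.

Lemma derive_row_sum (f : E4 -> R) (v x : E4) : differentiable f x ->
  'D_v f x = \sum_(l < 4) v 0 l * 'D_(delta_mx 0 l) f x.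
Proof.
move=> df; rewrite deriveE// [in LHS](row_sum_delta v) linear_sum.
by apply: eq_bigr => l _; rewrite linearZ deriveE.
Qed.

Lemma derive_frame_row_sum (f : E4 -> R) (i : 'I_3) (U : set E4) (k : nat) :
  Ck k.+1 U f -> forall x, U x ->
  'D_(S3_frame x i) f x = \sum_(l < 4) S3_frame x i 0 l * 'D_(delta_mx 0 l) f x.
Proof. by move=> [df _] x Ux; apply: derive_row_sum; exact: df. Qed.

(** The frame fields are linear in [y], which compensates for the homogeneity of degree -1 of the
    derivatives of [f]. At the origin the field vanishes, so the value 0 is preserved. Smoothness
    holds because the derivative is a combination of coordinate derivatives with linear
    coefficients. *)
Lemma frame_derive_subproof (i : 'I_3) (f : sfun) :
  smooth_hom0 (fun y => 'D_(S3_frame y i) f y).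
Proof.
have [f0 fl fk] := sfunP f; split=> [|l y l0|k]; first by rewrite frame0 derive0.
- have E : (fun h : R => h^-1 *: (f (h *: S3_frame (l *: y) i + l *: y) - f (l *: y))) =
      (fun h : R => h^-1 *: (f (h *: S3_frame y i + y) - f y)).
    by apply/funext => h; rewrite frameZ scalerA mulrC -scalerA -scalerDr !fl.
  exact: (congr1 (fun g : R -> R => lim (g h @[h --> 0^'])) E).
have [_ Df] := fk k.+1.
have H : Ck k punctured (fun x => \sum_(l < 4) S3_frame x i 0 l * 'D_(delta_mx 0 l) f x).
  apply: Ck_sum; first exact: open_punctured.
  by move=> l; apply: CkM (Df _); [exact: open_punctured|apply: Ck_frame; exact: open_punctured].
apply: Ck_ext H; first exact: open_punctured.
by move=> x x0; symmetry; apply: derive_frame_row_sum (fk 1) _ x0.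
Qed.

Definition frame_derive i f := SFun (frame_derive_subproof i f).
Local Notation X := frame_derive.

Lemma sfun_differentiable (f : sfun) y : sphere 1 y -> differentiable f y.
Proof. by move=> /sphere_neq0 y0; have [_ _ /(_ 1)[+ _]] := sfunP f; apply. Qed.

Lemma sfun_derivable (f : sfun) y v : sphere 1 y -> derivable f y v.
Proof. by move=> /(sfun_differentiable f); exact: diff_derivable. Qed.

Lemma frame_deriveD i (f g : sfun) : X i (f + g) = X i f + X i g.
Proof.
apply: sfun_ext => y Sy; apply: (@deriveD _ _ _ (f : E4 -> R) (g : E4 -> R)); exact: sfun_derivable.
Qed.

Lemma frame_deriveM i (f g : sfun) : X i (f * g) = f * X i g + g * X i f.
Proof.
apply: sfun_ext => y Sy; apply: (@deriveM _ _ (f : E4 -> R) (g : E4 -> R)); exact: sfun_derivable.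
Qed.

Lemma frame_derive_near i (f : sfun) (g : E4 -> R) y : sphere 1 y ->
  (forall z, z != 0 -> f z = g z) -> X i f y = 'D_(S3_frame y i) g y.
Proof.
move=> /sphere_neq0 y0 fg; apply: near_eq_derive.
by apply: filterS (open_nbhs_nbhs (conj open_punctured y0)) => z /fg.
Qed.

Lemma frame_derive_cst i (c : R) : X i (sfun_cst c) = 0.
Proof.
apply: sfun_ext => y Sy; rewrite sfun0 (@frame_derive_near _ _ (cst c))//.
  exact: derive_cst.
by move=> z z0 /=; rewrite (negPf z0).
Qed.

(** Product rule for a direction that moves with the point: the first term differentiates the linear
    field [S3_frame _ j], which is its own derivative, and the second keeps the direction frozen at
    [y]. *)
Lemma frame_derive2 i j (f : sfun) y : sphere 1 y ->
  X i (X j f) y = 'D_(S3_frame (S3_frame y i) j) f y +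
                  'D_(S3_frame y i) ('D_(S3_frame y j) f) y.
Proof.
move=> Sy; have y0 := sphere_neq0 Sy.
have [_ _ fk] := sfunP f; set u := S3_frame y i.
have near0 (g h : E4 -> R) : (forall z, z != 0 -> g z = h z) -> 'D_u g y = 'D_u h y.
  move=> gh; apply: near_eq_derive.
  by apply: filterS (open_nbhs_nbhs (conj open_punctured y0)) => z /gh.
have dD w : differentiable ('D_w f) y by have [_ /(_ w) [+ _]] := fk 2; apply.
have dsum (a : 'I_4 -> E4 -> R) : (forall l, derivable (a l) y u) ->
    'D_u (fun z => \sum_(l < 4) a l z * 'D_(delta_mx 0 l) f z) y =
    \sum_(l < 4) (a l y * 'D_u ('D_(delta_mx 0 l) f) y + 'D_(delta_mx 0 l) f y * 'D_u (a l) y).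
  move=> da.
  have -> : (fun z => \sum_(l < 4) a l z * 'D_(delta_mx 0 l) f z) =
      \sum_(l < 4) (a l * 'D_(delta_mx 0 l) f).
    by apply/funext => z; rewrite fct_sumE.
  rewrite derive_sum; last by move=> l; apply: derivableM; [exact: da|exact: diff_derivable].
  by apply: eq_bigr => l _; rewrite deriveM//; exact: diff_derivable.
have dfr l : derivable (fun z => S3_frame z j 0 l) y u.
  apply: diff_derivable; have [+ _] := Ck_frame 1 j l open_punctured; exact.
have E1 : X i (X j f) y = \sum_(l < 4) (S3_frame y j 0 l * 'D_u ('D_(delta_mx 0 l) f) y +
    'D_(delta_mx 0 l) f y * S3_frame u j 0 l).
  apply: etrans (near0 _ _ (derive_frame_row_sum j (fk 1))) (etrans (dsum _ dfr) _).
  by apply: eq_bigr => l _; rewrite derive_frame.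
have E2 : 'D_u ('D_(S3_frame y j) f) y =
    \sum_(l < 4) S3_frame y j 0 l * 'D_u ('D_(delta_mx 0 l) f) y.
  have D1 z : z != 0 -> 'D_(S3_frame y j) f z =
      \sum_(l < 4) S3_frame y j 0 l * 'D_(delta_mx 0 l) f z.
    by move=> z0; apply: derive_row_sum; have [+ _] := fk 1; apply.
  apply: etrans (near0 _ _ D1) (etrans (dsum (fun l => cst (S3_frame y j 0 l)) _) _).
    by move=> l; exact: derivable_cst.
  by apply: eq_bigr => l _; rewrite derive_cst mulr0 addr0.
apply: (etrans E1); apply: esym.
apply: (etrans (congr2 +%R (derive_row_sum _ (sfun_differentiable f Sy)) E2)).
by rewrite -big_split /=; apply: eq_bigr => l _; rewrite addrC [X in _ + X]mulrC.
Qed.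

Lemma frame_bracket i j k (f : sfun) :
  (forall y : E4, S3_frame (S3_frame y i) j - S3_frame (S3_frame y j) i = - 2 *: S3_frame y k) ->
  X i (X j f) - X j (X i f) = - (X k f + X k f).
Proof.
move=> Aij; apply: sfun_ext => y Sy.
rewrite sfunD !sfunN sfunD (frame_derive2 i j f Sy) (frame_derive2 j i f Sy).
rewrite (derive_comm (S3_frame y i) (S3_frame y j) open_punctured (sphere_neq0 Sy)).
  rewrite opprD addrACA subrr addr0.
  have df := sfun_differentiable f Sy.
  rewrite !deriveE// -linearB Aij linearZ.
  have -> : X k f y = 'd f y (S3_frame y k) by exact: deriveE.
  by move: ('d f y _) => t; rewrite -[LHS]/(- 2 * t); ring.
by have [_ _ /(_ 2)] := sfunP f.
Qed.

Lemma frame_bracket01 (f : sfun) : X 0 (X 1 f) - X 1 (X 0 f) = - (X 2 f + X 2 f).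
Proof.
apply: frame_bracket => y; apply/rowP => l.
case: l => [[|[|[|[|//]]]] ?]; rewrite /S3_frame /= !mxE /= ?mxE; ring.
Qed.

Lemma frame_bracket12 (f : sfun) : X 1 (X 2 f) - X 2 (X 1 f) = - (X 0 f + X 0 f).
Proof.
apply: frame_bracket => y; apply/rowP => l.
case: l => [[|[|[|[|//]]]] ?]; rewrite /S3_frame /= !mxE /= ?mxE; ring.
Qed.

Lemma frame_bracket20 (f : sfun) : X 2 (X 0 f) - X 0 (X 2 f) = - (X 1 f + X 1 f).
Proof.
apply: frame_bracket => y; apply/rowP => l.
case: l => [[|[|[|[|//]]]] ?]; rewrite /S3_frame /= !mxE /= ?mxE; ring.
Qed.

Lemma Ck_row_coord n k (U : set E4) (g : E4 -> 'rV[R]_n) (j : 'I_n) : open U ->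
  Ck k U g -> Ck k U (fun x => g x 0 j).
Proof.
move=> oU; elim: k g => [|k IH] g.
  move=> cg x Ux; apply: (@continuous_comp _ _ _ g (fun N : 'rV[R]_n => N 0 j)).
    exact: cg.
  exact: coord_continuous.
move=> [dg Dg]; split=> [x Ux|v].
  apply: (@differentiable_comp _ _ _ _ g (fun N : 'rV[R]_n => N 0 j)).
    exact: dg.
  exact: differentiable_coord.
apply: Ck_ext (IH _ (Dg v)) => // x Ux.
by rewrite derive_mx ?mxE//; exact/diff_derivable/dg.
Qed.

Lemma Ck_dot k (U : set E4) : open U -> Ck k U (fun y => dot y y).
Proof. by move=> oU; apply: Ck_sum => // i; apply: CkM => //; exact: Ck_coord. Qed.

Lemma Ck_enorm k : Ck k punctured (@enorm R 4).
Proof.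
apply: Ck_sqrt (Ck_dot k open_punctured); first exact: open_punctured.
by move=> y; rewrite lt_def dot_ge0 dot_eq0 andbT.
Qed.

Lemma Ck_normalize k (j : 'I_4) :
  Ck k punctured (fun y : E4 => ((enorm y)^-1 *: y) 0 j).
Proof.
have oP := open_punctured.
apply: Ck_ext (CkM oP (CkV oP _ (Ck_enorm k)) (Ck_coord k _ j)) => //.
  by move=> y _; rewrite mxE.
by move=> y; rewrite enorm_eq0.
Qed.

Lemma normalizeZ n (l : R) (y : 'rV[R]_n) : 0 < l ->
  (enorm (l *: y))^-1 *: (l *: y) = (enorm y)^-1 *: y.
Proof.
move=> l0; rewrite enormZ (gtr0_norm l0) invfM scalerA mulrAC mulVf ?mul1r//.
by rewrite gt_eqF.
Qed.

(** Near [y] the lift is the retraction onto the sphere followed by a smooth local extension of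
    [phi] around the normalized point. *)
Lemma sfun_lift_subproof n (phi : E4 -> 'rV[R]_n) (j : 'I_n) :
  smooth_on (sphere 1) phi ->
  smooth_hom0 (fun y => if y == 0 then 0 else phi ((enorm y)^-1 *: y) 0 j).
Proof.
move=> sphi; split=> [|l y l0|k]; first by rewrite eqxx.
  by rewrite scaler_eq0 gt_eqF//= normalizeZ.
have oP := open_punctured.
apply: (@Ck_ext _ _ _ _ _ (fun y => phi ((enorm y)^-1 *: y) 0 j)) => //.
  by move=> y /= /negPf ->.
apply: Ck_local => y y0.
have [U [g [oU Uy gk phig]]] := sphi _ (sphere_normalize y0).
(* The points whose normalization lies in the domain of the local extension; open by continuity of
   the retraction. *)
pose W := punctured `&` [set z | U ((enorm z)^-1 *: z)].
have oW : open W.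
  rewrite openE => z [z0 Uz]; apply: filterI; first exact: open_nbhs_nbhs.
  have cz : {for z, continuous (fun z : E4 => (enorm z)^-1 *: z)}.
    by apply: continuous_row => i; exact: (Ck_normalize 0 i).
  by apply: cz; exact: open_nbhs_nbhs.
exists W; split => //.
have := @Ck_comp R _ 4 k W U (fun z => (enorm z)^-1 *: z) (fun z => g z 0 j) oW.
move=> H; apply: Ck_ext (H _ _ _) => //.
- by move=> z [z0 Uz]; rewrite /= phig //; exact: sphere_normalize.
- by move=> z [].
- by move=> i; apply: Ck_sub (Ck_normalize k i) => z [].
- exact: Ck_row_coord (gk k).
Qed.

Definition sfun_lift n (phi : E4 -> 'rV[R]_n) (sphi : smooth_on (sphere 1) phi) j :=
  SFun (sfun_lift_subproof j sphi).

Lemma sfun_liftE n (phi : E4 -> 'rV[R]_n) (sphi : smooth_on (sphere 1) phi) j y :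
  sphere 1 y -> sfun_lift sphi j y = phi y 0 j.
Proof.
by move=> Sy; rewrite /= (negPf (sphere_neq0 Sy)) sphere_normalized.
Qed.

Lemma smooth_on_id : smooth_on (sphere 1) (id : E4 -> E4).
Proof.
move=> x _; exists setT, id; split => //; first exact: openT.
case=> [|k]; first by move=> y _.
split=> [y _|v]; first exact: ex_diff.
rewrite (_ : 'D_v id = cst v); first exact: Ck_cst.
by apply/funext => y; exact: derive_id.
Qed.

Definition sfun_coord (j : 'I_4) : sfun := sfun_lift smooth_on_id j.

Lemma sfun_coordE j y : sphere 1 y -> sfun_coord j y = y 0 j.
Proof. exact: sfun_liftE. Qed.

(** Off the origin [sfun_coord j] is y_j / |y|. Tangent directions do not change |y| to first order,
    so on the unit sphere the derivative is that of the linear coordinate y_j. *)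
Lemma frame_derive_coord i j y : sphere 1 y ->
  frame_derive i (sfun_coord j) y = S3_frame y i 0 j.
Proof.
move=> Sy; have y0 := sphere_neq0 Sy; set u := S3_frame y i.
have dn : differentiable (@enorm R 4) y by have [+ _] := Ck_enorm 1; apply.
have dc (l : 'I_4) : differentiable (fun z : E4 => z 0 l) y by exact: differentiable_coord.
(* Differentiating |y|^2, the sum of the squares of the coordinates, gives twice the product of [y]
   and [u], which is 0 by tangency. *)
have Dn : 'D_u (@enorm R 4) y = 0.
  have nn : 'D_u (@enorm R 4 * @enorm R 4) y = 0.
    have -> : @enorm R 4 * @enorm R 4 =
        \sum_(l < 4) ((fun z : E4 => z 0 l) * (fun z : E4 => z 0 l)).
      by apply/funext => z; rewrite fct_sumE -[LHS]expr2 enorm_sqr.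
    rewrite derive_sum; last by move=> l; apply: derivableM; exact: diff_derivable.
    transitivity (\sum_(l < 4) (y 0 l * u 0 l + y 0 l * u 0 l)).
      by apply: eq_bigr => l _; rewrite deriveM ?derive_coord//; exact: diff_derivable.
    have yu : \sum_(l < 4) y 0 l * u 0 l = 0 by exact: (S3_frame_tangent y i).
    by rewrite big_split /= yu addr0.
  move: nn; rewrite deriveM; try exact: diff_derivable.
  rewrite -mulr2n => /eqP; rewrite mulrn_eq0 /= mulf_eq0 enorm_eq0 (negPf y0) /=.
  by move=> /eqP.
have cE : 'D_u ((@enorm R 4) * (sfun_coord j : E4 -> R)) y = u 0 j.
  rewrite -(derive_coord u y); apply: near_eq_derive.
  apply: filterS (open_nbhs_nbhs (conj open_punctured y0)) => z /= z0.
  rewrite -[LHS]/(enorm z * sfun_coord j z) /= (negPf z0) mxE mulrA mulfV ?mul1r//.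
  by rewrite enorm_eq0.
move: cE; rewrite deriveM; [|exact: diff_derivable|exact: sfun_derivable].
by rewrite Dn scaler0 addr0 Sy scale1r.
Qed.

Lemma sfun_inv_subproof (f : sfun) : (forall y, sphere 1 y -> f y != 0) ->
  smooth_hom0 (fun y => (f y)^-1).
Proof.
move=> f1; have [f0 fl fk] := sfunP f.
split=> [|l y l0|k]; [by rewrite f0 invr0|by rewrite fl|].
apply: CkV => //; first exact: open_punctured.
move=> y y0; have := f1 _ (sphere_normalize y0).
by rewrite fl // invr_gt0 enorm_gt0.
Qed.

Lemma sfun_inv (f : sfun) : (forall y, sphere 1 y -> f y != 0) ->
  exists g : sfun, g * f = 1.
Proof.
move=> f1; exists (SFun (sfun_inv_subproof f1)).
by apply: sfun_ext => y Sy; rewrite sfunM sfun1 //= mulVf ?f1.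
Qed.

Lemma sfun_sqrt_subproof (f : sfun) : (forall y, sphere 1 y -> 0 < f y) ->
  smooth_hom0 (fun y => Num.sqrt (f y)).
Proof.
move=> f1; have [f0 fl fk] := sfunP f.
split=> [|l y l0|k]; [by rewrite f0 sqrtr0|by rewrite fl|].
apply: Ck_sqrt => //; first exact: open_punctured.
move=> y y0; have := f1 _ (sphere_normalize y0).
by rewrite fl // invr_gt0 enorm_gt0.
Qed.

Lemma sfun_sqrt (f : sfun) : (forall y, sphere 1 y -> 0 < f y) ->
  exists2 g : sfun, g * g = f & forall y, sphere 1 y -> 0 < g y.
Proof.
move=> f1; exists (SFun (sfun_sqrt_subproof f1)); last by move=> y /f1 /=; rewrite sqrtr_gt0.
by apply: sfun_ext => y Sy; rewrite sfunM /= -expr2 sqr_sqrtr// ltW ?f1.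
Qed.
End SphereFunctions.

(** * Frame calculus and helicity *)

Section VectorAlgebra.
Context {C : comNzRingType}.
Implicit Types f g h u v : 'I_3 -> C.

Definition dot3 f g : C := f 0 * g 0 + f 1 * g 1 + f 2 * g 2.
Definition det3 f g h : C :=
  f 0 * (g 1 * h 2 - g 2 * h 1) + f 1 * (g 2 * h 0 - g 0 * h 2)
  + f 2 * (g 0 * h 1 - g 1 * h 0).

(* On the unit sphere the cross product of two tangent vectors is normal. *)
Lemma det3_tangent f u u' g : dot3 f f = 1 -> dot3 f u = 0 -> dot3 f u' = 0 ->
  det3 g u u' = dot3 f g * det3 f u u'.
Proof.
move=> ff fu fu'; apply/eqP; rewrite -subr_eq0; apply/eqP.
(* Four vectors of 3-space satisfy g det(f,u,u') - f det(g,u,u') + u det(g,f,u') - u' det(g,f,u) =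
   0; the scalar product with [f] gives this identity. *)
transitivity ((1 - dot3 f f) * det3 g u u'
    - det3 g f u * dot3 f u' + det3 g f u' * dot3 f u); last by rewrite ff fu fu'; ring.
rewrite /dot3 /det3; ring.
Qed.

(** For [u], [u'] tangent at [f], the vector det(f,u,u') f is the cross product of [u] and [u']. The
    claim is then the Binet-Cauchy formula for (u x u') . (g x v). *)
Lemma det3_mul_tangent f g v u u' : dot3 f f = 1 -> dot3 f u = 0 -> dot3 f u' = 0 ->
  det3 f g v * det3 f u u' = dot3 g u * dot3 u' v - dot3 g u' * dot3 u v.
Proof.
move=> ff fu fu'.
have E (a : 'I_3) : f a * det3 f u u' = det3 (fun b => (b == a)%:R) u u'.
  rewrite (det3_tangent (fun b => (b == a)%:R) ff fu fu') /dot3; congr (_ * _).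
  by case: a => [[|[|[|//]]] ?]; rewrite /= ?mulr0 ?mulr1 ?addr0 ?add0r; congr f; exact: val_inj.
transitivity ((f 0 * det3 f u u') * (g 1 * v 2 - g 2 * v 1)
   + (f 1 * det3 f u u') * (g 2 * v 0 - g 0 * v 2)
   + (f 2 * det3 f u u') * (g 0 * v 1 - g 1 * v 0)); first by rewrite /det3; ring.
by rewrite !E /det3 /dot3 /=; ring.
Qed.

(* The three bidegree parts in (df, dg) of d(det(f, g, d(f+g)) / (1 + f.g)). *)
Lemma det3_part_ff f g u u' : dot3 f f = 1 -> dot3 g g = 1 ->
  dot3 f u = 0 -> dot3 f u' = 0 ->
  (1 + dot3 f g) * (det3 u g u' - det3 u' g u)
  - (dot3 g u * det3 f g u' - dot3 g u' * det3 f g u)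
  = - (1 + dot3 f g) ^+ 2 * det3 f u u'.
Proof.
move=> ff gg fu fu'; have := det3_tangent g ff fu fu'; have := gg.
have -> : dot3 g u * det3 f g u' - dot3 g u' * det3 f g u =
    det3 f u u' * dot3 g g - dot3 f g * det3 g u u' by rewrite /det3 /dot3; ring.
have -> : det3 u g u' - det3 u' g u = - (det3 g u u' + det3 g u u').
  by rewrite /det3; ring.
by move=> -> ->; move: (dot3 f g) => t; ring.
Qed.

Lemma det3_part_gg f g v v' : dot3 f f = 1 -> dot3 g g = 1 ->
  dot3 g v = 0 -> dot3 g v' = 0 ->
  (1 + dot3 f g) * (det3 f v v' - det3 f v' v)
  - (dot3 f v * det3 f g v' - dot3 f v' * det3 f g v)
  = (1 + dot3 f g) ^+ 2 * det3 g v v'.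
Proof.
move=> ff gg gv gv'; have := det3_tangent f gg gv gv'; have := ff.
have -> : dot3 g f = dot3 f g by rewrite /dot3; ring.
have -> : dot3 f v * det3 f g v' - dot3 f v' * det3 f g v =
    dot3 f g * det3 f v v' - dot3 f f * det3 g v v' by rewrite /det3 /dot3; ring.
have -> : det3 f v v' - det3 f v' v = det3 f v v' + det3 f v v'.
  by rewrite /det3; ring.
by move=> -> ->; move: (dot3 f g) => t; ring.
Qed.

Lemma det3_part_fg f g u v : dot3 f f = 1 -> dot3 g g = 1 ->
  dot3 f u = 0 -> dot3 g v = 0 ->
  (1 + dot3 f g) * (det3 u g v - det3 f v u)
  - (dot3 g u * det3 f g v - dot3 f v * det3 f g u) = 0.
Proof.
move=> ff gg fu gv.
transitivity (det3 f u v * (1 - dot3 g g) - det3 g u v * (1 - dot3 f f)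
   - dot3 g v * det3 f g u + dot3 f u * det3 f g v).
  by rewrite /det3 /dot3; ring.
by rewrite ff gg fu gv; ring.
Qed.
End VectorAlgebra.

(** * Vector calculus from the bracket relations *)

Section FrameCalculus.
Context {R : realType} {C : comNzRingType} (X : 'I_3 -> C -> C) (I : C -> R).
Context (XD : forall i f g, X i (f + g) = X i f + X i g)
  (XM : forall i f g, X i (f * g) = f * X i g + g * X i f)
  (X01 : forall f, X 0 (X 1 f) - X 1 (X 0 f) = - (X 2 f + X 2 f))
  (X12 : forall f, X 1 (X 2 f) - X 2 (X 1 f) = - (X 0 f + X 0 f))
  (X20 : forall f, X 2 (X 0 f) - X 0 (X 2 f) = - (X 1 f + X 1 f))
  (ID : forall f g, I (f + g) = I f + I g)
  (I_X : forall i f, I (X i f) = 0)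
  (C2 : forall f : C, f + f = 0 -> f = 0).
Implicit Types (a b f g : 'I_3 -> C) (p q : C).

Lemma frameX0 i : X i 0 = 0.
Proof. by have := XD i 0 0; rewrite addr0 -[LHS]addr0 => /addrI. Qed.

Lemma frameXN i p : X i (- p) = - X i p.
Proof. by apply/eqP; rewrite -addr_eq0 -XD addNr frameX0. Qed.

Lemma frameX1 i : X i 1 = 0.
Proof. by have := XM i 1 1; rewrite !mul1r -[LHS]addr0 => /addrI. Qed.

Lemma I0 : I 0 = 0.
Proof. by have := ID 0 0; rewrite addr0 -[LHS]addr0 => /addrI. Qed.

Lemma IN p : I (- p) = - I p.
Proof. by apply/eqP; rewrite -addr_eq0 -ID addNr I0. Qed.

Lemma IB p q : I (p - q) = I p - I q.
Proof. by rewrite ID IN. Qed.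

(** These three rules sort iterated derivatives, the larger index outermost. Once sorted, distinct
    second derivatives can be treated as independent symbols in polynomial identities. *)
Lemma X01E p : X 0 (X 1 p) = X 1 (X 0 p) - (X 2 p + X 2 p).
Proof. by rewrite -X01 addrC subrK. Qed.
Lemma X12E p : X 1 (X 2 p) = X 2 (X 1 p) - (X 0 p + X 0 p).
Proof. by rewrite -X12 addrC subrK. Qed.
Lemma X02E p : X 0 (X 2 p) = X 2 (X 0 p) + (X 1 p + X 1 p).
Proof. by rewrite -[X 1 p + _]opprK -X20 opprB addrC subrK. Qed.

(* [curl a i] is the value of da on the pair of frame fields complementary to
   the i-th one, for the 1-form a with coefficients [a j] in the dual coframe;
   the zero-order term comes from the brackets of the frame. *)
Definition curl a (i : 'I_3) : C :=
  [:: X 1 (a 2) - X 2 (a 1) + (a 0 + a 0);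
      X 2 (a 0) - X 0 (a 2) + (a 1 + a 1);
      X 0 (a 1) - X 1 (a 0) + (a 2 + a 2)]`_i.
Definition grad p (i : 'I_3) : C := X i p.
Definition divg a : C := X 0 (a 0) + X 1 (a 1) + X 2 (a 2).

Lemma dot3_ext a a' b b' : (forall i, a i = a' i) -> (forall i, b i = b' i) ->
  dot3 a b = dot3 a' b'.
Proof. by move=> aa bb; rewrite /dot3 !aa !bb. Qed.

(** a . curl b - b . curl a is the divergence of the cross product of [b] and [a]; the zero-order
    terms of the two curls cancel. *)
Lemma curl_selfadjoint a b : I (dot3 a (curl b)) = I (dot3 b (curl a)).
Proof.
apply/eqP; rewrite -subr_eq0 -IB; apply/eqP.
rewrite (_ : _ - _ = divg (fun i => [:: a 2 * b 1 - a 1 * b 2;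
   a 0 * b 2 - a 2 * b 0; a 1 * b 0 - a 0 * b 1]`_i)); last first.
  by rewrite /divg /dot3 /curl /= !(XD, frameXN, XM); ring.
by rewrite /divg !ID !I_X !addr0.
Qed.

(** This is d d = 0: the brackets turn the antisymmetrized second derivatives into the opposite of
    the zero-order term of [curl]. *)
Lemma curl_grad p i : curl (grad p) i = 0.
Proof.
case: i => [[|[|[|//]]] ?]; rewrite /curl /grad /= ?X01E ?X12E ?X02E; ring.
Qed.

Lemma I_grad_curl p a : I (dot3 (grad p) (curl a)) = 0.
Proof.
rewrite curl_selfadjoint -I0; congr I.
by rewrite /dot3 !curl_grad !mulr0 !addr0.
Qed.

Lemma curl_sub_grad a p i : curl (fun j => a j - grad p j) i = curl a i.
Proof.
rewrite -[RHS]subr0 -(curl_grad p i).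
by case: i => [[|[|[|//]]] ?]; rewrite /curl /= !(XD, frameXN); ring.
Qed.

Lemma curl_bochner a :
  I (dot3 (curl a) (curl a)) - I (dot3 a (curl a)) - I (dot3 a (curl a))
  + I (divg a * divg a) =
  I (dot3 (grad (a 0)) (grad (a 0)) + dot3 (grad (a 1)) (grad (a 1))
     + dot3 (grad (a 2)) (grad (a 2))).
Proof.
rewrite -!IB -ID; apply/eqP; rewrite -subr_eq0 -IB; apply/eqP.
(* The divergence of [W] is (div a)^2 - sum X_k a_j X_j a_k - sum a_j [X_k, X_j] a_k. The middle sum
   is what separates |X a|^2 from the square of the derivative part of [curl a], and the brackets in
   the last one produce the first-order terms left by |curl a|^2 - 2 a . curl a. *)
pose W (k : 'I_3) := a k * divg a - (a 0 * X 0 (a k) + a 1 * X 1 (a k) + a 2 * X 2 (a k)).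
rewrite (_ : _ - _ = divg W).
  by rewrite /divg !ID !I_X !addr0.
rewrite /W /divg /dot3 /curl /grad /= !(XD, frameXN, XM) !(X01E, X12E, X02E); ring.
Qed.

(* The first nonzero eigenvalue of curl on coclosed forms in the orientation
   of the frame is 2; an arbitrary form is made almost coclosed by
   subtracting a gradient. *)
Lemma helicity_le a
  (I_ge0 : forall p, 0 <= I (p * p))
  (poisson : forall p e, I p = 0 -> 0 < e ->
     exists q, I ((p - divg (grad q)) * (p - divg (grad q))) <= e) :
  I (dot3 a (curl a)) + I (dot3 a (curl a)) <= I (dot3 (curl a) (curl a)).
Proof.
apply/ler_addgt0Pr => e e0.
have [|q Hq] := poisson (divg a) e _ e0.
  by rewrite /divg !ID !I_X !addr0.
pose b i := a i - grad q i.
have cb i : curl b i = curl a i by exact: curl_sub_grad.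
have bc : I (dot3 b (curl b)) = I (dot3 a (curl a)).
  rewrite (@dot3_ext b b (curl b) (curl a))//.
  rewrite (_ : dot3 _ _ = dot3 a (curl a) - dot3 (grad q) (curl a)).
    by rewrite IB I_grad_curl subr0.
  by rewrite /dot3 /b; ring.
have := curl_bochner b; rewrite bc (dot3_ext cb cb).
have -> : divg b = divg a - divg (grad q).
  by rewrite /divg /b !(XD, frameXN); ring.
have sq i : 0 <= I (dot3 (grad (b i)) (grad (b i))) by rewrite !ID !addr_ge0.
have := sq 0; have := sq 1; have := sq 2; rewrite !ID.
move: Hq; move: (I _) (I _) (I _) => *; lra.
Qed.

(* The pullback by [f] of the area form of the unit sphere, with its components
   indexed as those of [curl a]. *)
Definition pull (f : 'I_3 -> C) (i : 'I_3) : C :=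
  [:: det3 f (fun l => X 1 (f l)) (fun l => X 2 (f l));
      det3 f (fun l => X 2 (f l)) (fun l => X 0 (f l));
      det3 f (fun l => X 0 (f l)) (fun l => X 1 (f l))]`_i.

(** A primitive and its helicity are kept together because both are transported from the Hopf map
    along the homotopy. *)
Definition helicity_primitive f (h : R) : Prop :=
  exists2 a, forall i, curl a i = pull f i & I (dot3 a (curl a)) = h.

(** Differentiating f . f = 1 gives twice the claim; [C2] removes the factor 2. *)
Lemma dot3_frameX f i : dot3 f f = 1 -> dot3 f (fun l => X i (f l)) = 0.
Proof.
move=> /(congr1 (X i)); rewrite frameX1 /dot3 !(XD, XM) => E.
by apply: C2; rewrite -E; ring.
Qed.

(** * Transgression between two maps to the unit sphere *)

Section Transgression.
Context (f g : 'I_3 -> C) (w : C).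
Context (ff : dot3 f f = 1) (gg : dot3 g g = 1) (wfg : w * (1 + dot3 f g) = 1).

Let u i l := X i (f l).
Let v i l := X i (g l).
Let t i := X i (dot3 f g).
(** With t the angle between [f] and [g], the minimizing arc is F_s = (sin((1-s)t) f + sin(st) g) /
    sin t. Integrating det(F, dF/ds, X F) over s in [0, 1] gives (1 - cos t) / (sin t)^2 times [B],
    that is [B] divided by 1 + f . g. This is [beta]. *)
Let B i := det3 f g (fun l => X i (f l + g l)).
Let beta i := w * B i.

Let fu i : dot3 f (u i) = 0. Proof. exact: dot3_frameX. Qed.
Let gv i : dot3 g (v i) = 0. Proof. exact: dot3_frameX. Qed.

Let tE i : t i = dot3 g (u i) + dot3 f (v i).
Proof. by rewrite /t /dot3 !(XD, XM) /u /v; ring. Qed.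

Let BE i : B i = det3 f g (u i) + det3 f g (v i).
Proof. by rewrite /B /det3 !XD /u /v; ring. Qed.

Let Xw i : X i w = - (w * w * t i).
Proof.
have := congr1 (X i) wfg; rewrite XM XD frameX1 add0r -/(t i) => E.
have {}E : w * (w * t i + (1 + dot3 f g) * X i w) = 0 by rewrite E mulr0.
apply/eqP; rewrite -addr_eq0; apply/eqP.
transitivity (w * (w * t i + (1 + dot3 f g) * X i w) +
    (1 - w * (1 + dot3 f g)) * X i w); first by ring.
by rewrite E wfg subrr mul0r addr0.
Qed.

(** The part of the (j, k) component of d beta that is quadratic in first derivatives. Factoring out
    [w * w] by means of w s = 1, with s = 1 + f . g, it splits by bidegree in (df, dg): the pure
    parts give the two area terms times s^2, and the mixed part vanishes for (j, k) and for (k,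
    j). *)
Let curl_beta_alg (j k : 'I_3) :
  w * (det3 (u j) g (u k) + det3 (u j) g (v k) + det3 f (v j) (u k) + det3 f (v j) (v k)
     - det3 (u k) g (u j) - det3 (u k) g (v j) - det3 f (v k) (u j) - det3 f (v k) (v j))
  - w * w * (t j * B k - t k * B j) = det3 g (v j) (v k) - det3 f (u j) (u k).
Proof.
have e1 := det3_part_ff ff gg (fu j) (fu k).
have e2 := det3_part_gg ff gg (gv j) (gv k).
have e3 := det3_part_fg ff gg (fu j) (gv k).
have e4 := det3_part_fg ff gg (fu k) (gv j).
move: e1 e2 e3 e4; rewrite !tE !BE; move: wfg; set s := 1 + dot3 f g => ws e1 e2 e3 e4.
transitivity (w * w * (s * (det3 (u j) g (u k) + det3 (u j) g (v k) + det3 f (v j) (u k) + det3 f (v j) (v k)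
     - det3 (u k) g (u j) - det3 (u k) g (v j) - det3 f (v k) (u j) - det3 f (v k) (v j))
    - ((dot3 g (u j) + dot3 f (v j)) * (det3 f g (u k) + det3 f g (v k))
       - (dot3 g (u k) + dot3 f (v k)) * (det3 f g (u j) + det3 f g (v j))))).
  rewrite -[X in X - _ = _]mul1r -ws; ring.
transitivity (w * w * ((- s ^+ 2 * det3 f (u j) (u k)) + s ^+ 2 * det3 g (v j) (v k) + 0 - 0)).
  by rewrite -e1 -e2 -{1}e3 -e4; congr (_ * _); ring.
transitivity ((w * s) ^+ 2 * (det3 g (v j) (v k) - det3 f (u j) (u k))); first by ring.
by rewrite ws expr1n mul1r.
Qed.

Let Xbeta i j : X i (beta j) = w * X i (B j) - w * w * t i * B j.
Proof. by rewrite /beta XM Xw; ring. Qed.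

(** Second derivatives of [f] and [g] occur only through brackets, whose contribution cancels the
    zero-order term of [curl]; what is left is [curl_beta_alg]. *)
Lemma curl_transgression i : curl beta i = pull g i - pull f i.
Proof.
case: i => [[|[|[|//]]] ?]; rewrite /curl /pull /= !Xbeta.
- rewrite -(curl_beta_alg 1 2) /beta /B /det3 !(XD, frameXN, XM) /u /v !X12E; ring.
- rewrite -(curl_beta_alg 2 0) /beta /B /det3 !(XD, frameXN, XM) /u /v !X02E; ring.
- rewrite -(curl_beta_alg 0 1) /beta /B /det3 !(XD, frameXN, XM) /u /v !X01E; ring.
Qed.

(** [rho] is d log(1 + f . g), hence closed. [zeta] is f . dg - g . df, whose exterior derivative is
    twice the scalar-valued wedge of df and dg. *)
Let rho i := w * t i.
Let zeta i := dot3 f (v i) - dot3 g (u i).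

Let curl_rho i : curl rho i = 0.
Proof.
rewrite /rho /t.
case: i => [[|[|[|//]]] ?]; rewrite /curl /= !XM !Xw ?X01E ?X12E ?X02E /t; ring.
Qed.

Let curl_zeta : [/\ curl zeta 0 = 2 * (dot3 (u 1) (v 2) - dot3 (u 2) (v 1)),
  curl zeta 1 = 2 * (dot3 (u 2) (v 0) - dot3 (u 0) (v 2)) &
  curl zeta 2 = 2 * (dot3 (u 0) (v 1) - dot3 (u 1) (v 0))].
Proof.
rewrite /zeta /curl /dot3 /u /v /=; split; rewrite !(XD, frameXN, XM).
- rewrite !X12E; ring.
- rewrite !X02E; ring.
- rewrite !X01E; ring.
Qed.

Let uv i l := u i l + v i l.

Let Bf i j k : det3 f g (uv i) * det3 f (u j) (u k) =
  dot3 g (u j) * (dot3 (u k) (u i) + dot3 (u k) (v i))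
  - dot3 g (u k) * (dot3 (u j) (u i) + dot3 (u j) (v i)).
Proof.
by rewrite (det3_mul_tangent g (uv i) ff (fu j) (fu k)) /dot3 /uv; ring.
Qed.

Let Bg i j k : det3 f g (uv i) * det3 g (v j) (v k) =
  dot3 f (v k) * (dot3 (v j) (u i) + dot3 (v j) (v i))
  - dot3 f (v j) * (dot3 (v k) (u i) + dot3 (v k) (v i)).
Proof.
transitivity (- (det3 g f (uv i) * det3 g (v j) (v k))).
  by rewrite /det3; ring.
by rewrite (det3_mul_tangent f (uv i) gg (gv j) (gv k)) /dot3 /uv; ring.
Qed.

(** Expanding products of determinants into scalar products turns twice the integrand into rho .
    curl zeta, the terms in (u_i . u_j) and (v_i . v_j) cancelling by symmetry. Since [rho] is
    closed, self-adjointness of [curl] makes the integral vanish. The doubling avoids a division in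
    the ring; the factor 2 is removed after integration. *)
Lemma I_transgression : I (dot3 beta (fun i => pull f i + pull g i)) = 0.
Proof.
have B' i : B i = det3 f g (uv i) by rewrite /B /det3 !XD.
have E : dot3 beta (fun i => pull f i + pull g i) + dot3 beta (fun i => pull f i + pull g i)
    = dot3 rho (curl zeta).
  have [z0 z1 z2] := curl_zeta.
  transitivity (2 * w * (B 0 * det3 f (u 1) (u 2) + B 0 * det3 g (v 1) (v 2)
      + B 1 * det3 f (u 2) (u 0) + B 1 * det3 g (v 2) (v 0)
      + B 2 * det3 f (u 0) (u 1) + B 2 * det3 g (v 0) (v 1))).
    by rewrite /dot3 /pull /= /beta -/(u 0) -/(u 1) -/(u 2) -/(v 0) -/(v 1) -/(v 2); ring.
  rewrite !B' !Bf !Bg [RHS]/dot3 z0 z1 z2 /rho !tE.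
  have dC a b : dot3 a b = dot3 b a by rewrite /dot3; ring.
  rewrite (dC (u 2) (u 0)) (dC (u 1) (u 0)) (dC (u 2) (u 1)).
  rewrite (dC (v 2) (v 0)) (dC (v 1) (v 0)) (dC (v 2) (v 1)).
  rewrite (dC (v 1) (u 0)) (dC (v 2) (u 0)) (dC (v 2) (u 1)) (dC (v 0) (u 1)) (dC (v 0) (u 2)) (dC (v 1) (u 2)).
  ring.
have : I (dot3 rho (curl zeta)) = 0.
  by rewrite curl_selfadjoint -I0; congr I; rewrite /dot3 !curl_rho !mulr0 !addr0.
by rewrite -E ID -mulr2n => /eqP; rewrite mulrn_eq0 => /eqP.
Qed.

(** Adding [beta] to a primitive for [f] yields one for [g]. Self-adjointness doubles the cross
    term, so the helicity changes by the integral of 2 beta . pull f + beta . (pull g - pull f),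
    which is that of beta . (pull f + pull g) and vanishes. *)
Lemma helicity_primitive_step h : helicity_primitive f h -> helicity_primitive g h.
Proof.
move=> [a ca Ia]; have cb := curl_transgression.
have cab i : curl (fun j => a j + beta j) i = pull g i.
  transitivity (curl a i + curl beta i); last by rewrite ca cb addrC subrK.
  by case: i => [[|[|[|//]]] ?]; rewrite /curl /= !XD; ring.
exists (fun j => a j + beta j) => //.
have Ig : I (dot3 beta (pull g)) = - I (dot3 beta (pull f)).
  apply/eqP; rewrite -addr_eq0 addrC -ID -I_transgression; apply/eqP.
  by congr I; rewrite /dot3; ring.
have If : I (dot3 a (curl beta)) = I (dot3 beta (pull f)).
  rewrite curl_selfadjoint; congr I; exact: dot3_ext.
have bb : I (dot3 beta (curl beta)) = - I (dot3 beta (pull f)) - I (dot3 beta (pull f)).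
  rewrite -{1}Ig -IB; congr I; rewrite (dot3_ext (fun=> erefl) cb) /dot3; ring.
rewrite -Ia (_ : dot3 _ _ = dot3 a (curl a) + dot3 beta (pull f) + dot3 a (curl beta)
    + dot3 beta (curl beta)).
  rewrite (ID _ (dot3 beta (curl beta))) (ID _ (dot3 a (curl beta))).
  by rewrite (ID _ (dot3 beta (pull f))) If bb; ring.
rewrite (@dot3_ext _ (fun j => a j + beta j) _ (fun i => pull f i + curl beta i))//; last first.
  by move=> i; rewrite cab cb addrC subrK.
by rewrite (dot3_ext (fun=> erefl) ca) /dot3; ring.
Qed.
End Transgression.

End FrameCalculus.

(** * Integration over boxes and over the sphere *)

Section ProductSigmaFinite.
Local Open Scope ereal_scope.
Context d1 d2 (T1 : measurableType d1) (T2 : measurableType d2) (R : realType).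
Context (m1 : {sigma_finite_measure set T1 -> \bar R})
  (m2 : {sigma_finite_measure set T2 -> \bar R}).

(** Rectangles built from two exhausting sequences exhaust the product. Fubini on a triple product
    needs this to treat the first two factors as one sigma-finite space. *)
Lemma product_measure1_sigma_finite : sigma_finite setT (m1 \x m2).
Proof.
have /sigma_finiteP[F [TF ndF Foo]] := sigma_finiteT m1.
have /sigma_finiteP[G [TG ndG Goo]] := sigma_finiteT m2.
exists (fun n => F n `*` G n).
  apply/seteqP; split => // -[x y] _.
  have [n _ Fx] : (\bigcup_n F n) x by rewrite -TF.
  have [k _ Gy] : (\bigcup_n G n) y by rewrite -TG.
  exists (maxn n k) => //; split.
    by move: x Fx; exact/subsetPset/ndF/leq_maxl.
  by move: y Gy; exact/subsetPset/ndG/leq_maxr.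
move=> k; have [mF Fk] := Foo k; have [mG Gk] := Goo k.
split; first exact: measurableX.
by rewrite product_measure1E// lte_mul_pinfty// ge0_fin_numE.
Qed.

Definition product_sigma_finite : {sigma_finite_measure set (T1 * T2)%type -> \bar R} :=
  HB.pack_for {sigma_finite_measure set (T1 * T2)%type -> \bar R} (m1 \x m2)
    (Measure_isSigmaFinite.Build _ _ _ (m1 \x m2) product_measure1_sigma_finite).

End ProductSigmaFinite.

Section IteratedIntegral.
Local Open Scope ereal_scope.
Context d1 d2 (T1 : measurableType d1) (T2 : measurableType d2) (R : realType).
Context (m1 : {sigma_finite_measure set T1 -> \bar R})
  (m2 : {sigma_finite_measure set T2 -> \bar R}).
Context (D1 : set T1) (D2 : set T2) (mD1 : measurable D1) (mD2 : measurable D2).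
Context (f : T1 * T2 -> \bar R) (intf : (m1 \x m2)%E.-integrable (D1 `*` D2) f).

Let intg : (m1 \x m2)%E.-integrable setT (f \_ (D1 `*` D2)).
Proof. by apply: (integrable_mkcond _ _).1 intf; exact: measurableX. Qed.

Lemma integral_prod_eq0l :
  (forall y, D2 y -> \int[m1]_(x in D1) f (x, y) = 0) ->
  \int[m1 \x m2]_(p in D1 `*` D2) f p = 0.
Proof.
move=> f0; rewrite integral_mkcond -integral21_prod_meas1//.
apply: integral0_eq => y _; rewrite /fubini_G.
have [yD|yD] := pselect (D2 y); last first.
  apply: integral0_eq => x _; rewrite patchE ifF//; apply/negbTE.
  by rewrite notin_setE => -[].
rewrite -(f0 _ yD) [RHS]integral_mkcond; apply: eq_integral => x _.
by rewrite !patchE in_setX (mem_set yD) andbT.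
Qed.

Lemma integral_prod_eq0r :
  (forall x, D1 x -> \int[m2]_(y in D2) f (x, y) = 0) ->
  \int[m1 \x m2]_(p in D1 `*` D2) f p = 0.
Proof.
move=> f0; rewrite integral_mkcond -integral12_prod_meas1//.
apply: integral0_eq => x _; rewrite /fubini_F.
have [xD|xD] := pselect (D1 x); last first.
  apply: integral0_eq => y _; rewrite patchE ifF//; apply/negbTE.
  by rewrite notin_setE => -[].
rewrite -(f0 _ xD) [RHS]integral_mkcond; apply: eq_integral => y _.
by rewrite !patchE in_setX (mem_set xD).
Qed.
End IteratedIntegral.

Lemma continuous_pair (T U V : topologicalType) (f : T -> U) (g : T -> V) (x : T) :
  {for x, continuous f} -> {for x, continuous g} ->
  {for x, continuous (fun x => (f x, g x))}.
Proof. by move=> cf cg; apply: (@cvg_pair _ _ _ (nbhs x) (nbhs (f x)) (nbhs (g x))). Qed.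

Section Box.
Context {R : realType}.
Local Notation mu := (@lebesgue_measure R).
Local Notation T3 := (measurableTypeR R * measurableTypeR R * measurableTypeR R)%type.

(** An open set is the countable union of the balls with rational centre and radius that it
    contains, and these balls are products of intervals. A radius below [e / 2] suffices: any such
    ball through [x] stays within distance [e] of [x]. *)
Lemma open_measurable3 (U : set (R * R * R)) : open U -> measurable (U : set T3).
Proof.
move=> oU.
pose c (q : rat * rat * rat) : R * R * R := (ratr q.1.1, ratr q.1.2, ratr q.2).
pose B (n : nat) : set (R * R * R) :=
  if unpickle n is Some (q, r) then
    if `[< ball (c q) (ratr r : R) `<=` U >] then ball (c q) (ratr r : R) else set0
  else set0.
have BK q r : ball (c q) (ratr r : R) `<=` U -> B (pickle (q, r)) = ball (c q) (ratr r : R).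
  by move=> qrU; rewrite /B pickleK; case: asboolP.
have -> : U = \bigcup_n B n.
  apply/seteqP; split => [x Ux|x [n _]]; last first.
    rewrite /B; case: unpickle => // -[q r]; case: ifPn => [/asboolP|_ []].
    exact.
  have /nbhs_ballP[e /= e0 eU] := open_nbhs_nbhs (conj oU Ux).
  have [r] : exists r : rat, ratr r \in `]0, (e / 2)[.
    by apply: rat_in_itvoo; rewrite divr_gt0.
  rewrite in_itv /= => /andP[r0 re].
  have near (t : R) : exists q : rat, ball (ratr q : R) (ratr r) t.
    have [q] : exists q : rat, ratr q \in `](t - ratr r), (t + ratr r)[.
      by apply: rat_in_itvoo; rewrite ltrD2l gtrN.
    by rewrite in_itv /= => /andP[q1 q2]; exists q; rewrite /ball /= ltr_norml; lra.
  have [q1 Hq1] := near x.1.1; have [q2 Hq2] := near x.1.2; have [q3 Hq3] := near x.2.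
  have xB : ball (c (q1, q2, q3)) (ratr r : R) x by split; [split|].
  exists (pickle ((q1, q2, q3), r)); first exact: I.
  rewrite BK// => y yB; apply: eU.
  apply: (@le_ball _ _ _ (ratr r + ratr r)); first by lra.
  by apply: ball_triangle yB; exact: ball_sym.
apply: bigcupT_measurable => n; rewrite /B.
case: unpickle => // -[q r]; case: ifPn => // _.
have -> : ball (c q) (ratr r : R) =
  (ball (ratr q.1.1 : R) (ratr r)) `*` (ball (ratr q.1.2 : R) (ratr r)) `*` (ball (ratr q.2 : R) (ratr r)) by [].
by apply: measurableX; [apply: measurableX|]; exact: measurable_ball.
Qed.

Lemma continuous_measurable3 (f : R * R * R -> R) : continuous f ->
  measurable_fun setT (f : T3 -> measurableTypeR R).
Proof.
move=> /continuousP cf; apply: (measurability _ (RGenOpens.measurableE R)).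
move=> _ [_ [a [b ->] <-]]; rewrite setTI; apply: open_measurable3.
exact/cf/interval_open.
Qed.

Definition box3 (a b c : R) : set (R * R * R) := `[0, a] `*` `[0, b] `*` `[0, c].

Lemma measurable_box3 a b c : measurable (box3 a b c : set T3).
Proof. by apply: measurableX; [apply: measurableX|]; exact: measurable_itv. Qed.

Lemma lebesgue_measure_itv_fin_num (d : R) : mu `[0%R, d] \is a fin_num.
Proof.
by rewrite ge0_fin_numE// lebesgue_measure_itv /=; case: ifP => _; rewrite -?EFinB ltry.
Qed.

Lemma continuous_box3_integrable (f : R * R * R -> R) a b c : continuous f ->
  (mu \x mu \x mu)%E.-integrable (box3 a b c : set T3) (EFin \o f).
Proof.
move=> cf; apply: measurable_bounded_integrable.
- exact: measurable_box3.
- suff : ((mu \x mu \x mu)%E (box3 a b c) < +oo)%E by [].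
  have -> : (mu \x mu \x mu)%E (box3 a b c) =
      (mu `[0%R, a] * mu `[0%R, b] * mu `[0%R, c])%E.
    rewrite -(product_measure1E mu mu) ?(product_measure1E (mu \x mu)%E mu)//.
    exact: measurableX.
  by rewrite -ge0_fin_numE ?mule_ge0 ?fin_numM ?lebesgue_measure_itv_fin_num.
- by apply: measurable_funS (continuous_measurable3 cf).
- have cA : compact (box3 a b c).
    by apply: compact_setX; [apply: compact_setX|]; exact: segment_compact.
  have cfA : {within box3 a b c, continuous f} by exact: continuous_subspaceT.
  have /compact_bounded[M [_ mrt]] := continuous_compact cfA cA.
  by exists M; split; rewrite ?num_real // => ? ? ? ?; exact: mrt.
Qed.

Lemma integral_derive_eq0 (F f : R -> R) (a : R) : 0 < a ->
  continuous f -> (forall x : R, is_derive x (1 : R) F (f x)) -> F 0 = F a ->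
  (\int[mu]_(x in `[0%R, a]) (f x)%:E = 0)%E.
Proof.
move=> a0 cf dF F0a.
have cF x : F @ x --> F x.
  by apply: differentiable_continuous; apply/derivable1_diffP; case: (dF x).
rewrite (@continuous_FTC2 _ f F)//.
- by rewrite F0a subee.
- exact: continuous_subspaceT.
- split; first by move=> x _; case: (dF x).
  + by apply: cvg_at_right_filter; exact: cF.
  + by apply: cvg_at_left_filter; exact: cF.
- by move=> x _; rewrite derive1E; have [_ ->] := dF x.
Qed.

Lemma continuous_slice_integrable (f : R * R * R -> R) a b t : continuous f ->
  (mu \x mu)%E.-integrable (`[0%R, a] `*` `[0%R, b]) (fun q => (f (q, t))%:E).
Proof.
move=> cf.
have cft : continuous (fun q : R * R => f (q, t)).
  move=> q; apply: (@continuous_comp _ _ _ (fun q => (q, t)) f); last exact: cf.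
  by apply: continuous_pair; [exact: cvg_id|exact: cvg_cst].
have mab : measurable (`[0%R, a] `*` `[0%R, b] : set (measurableTypeR R * measurableTypeR R)).
  by apply: measurableX; exact: measurable_itv.
apply: measurable_bounded_integrable => //.
- suff : ((mu \x mu)%E (`[0%R, a] `*` `[0%R, b]) < +oo)%E by [].
  rewrite (product_measure1E mu mu)//.
  by rewrite -ge0_fin_numE ?mule_ge0 ?fin_numM ?lebesgue_measure_itv_fin_num.
- apply: measurable_funS (measurableT) _ _ => //.
  exact: measurableT_comp (continuous_measurable3 cf) (pair2_measurable t).
- have cA : compact (`[0, a] `*` `[0, b] : set (R * R)).
    by apply: compact_setX; exact: segment_compact.
  have cfA : {within `[0, a] `*` `[0, b], continuous (fun q : R * R => f (q, t))}.
    exact: continuous_subspaceT.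
  have /compact_bounded[M [_ mrt]] := continuous_compact cfA cA.
  by exists M; split; rewrite ?num_real // => y My x xA; apply: (mrt y My); exists x.
Qed.

Local Notation mu2 := (product_sigma_finite mu mu).

Section Divergence.
Context (f F : R * R * R -> R) (a b c : R) (a0 : 0 < a) (b0 : 0 < b) (c0 : 0 < c).
Context (cf : continuous f).

Let intf := continuous_box3_integrable a b c cf.

Let m12 := measurableX (measurable_itv `[0, a]) (measurable_itv `[0, b]).

Lemma integral_divergence3 : (forall x y t : R, is_derive t (1 : R) (fun t => F (x, y, t)) (f (x, y, t))) ->
  (forall x y, F (x, y, 0) = F (x, y, c)) ->
  (\int[mu \x mu \x mu]_(p in box3 a b c) (f p)%:E = 0)%E.
Proof.
move=> dF F0; apply: (@integral_prod_eq0r _ _ _ _ R mu2 mu _ _ m12 (measurable_itv `[0, c]) (EFin \o f) intf).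
move=> [x y] _; apply: (@integral_derive_eq0 (fun t => F (x, y, t))) => //.
by move=> t; apply: (@continuous_comp _ _ _ (fun t => (x, y, t)) f); [apply: continuous_pair; [exact: cvg_cst|exact: cvg_id]|exact: cf].
Qed.

Lemma integral_divergence1 : (forall x y t : R, is_derive x (1 : R) (fun x => F (x, y, t)) (f (x, y, t))) ->
  (forall y t, F (0, y, t) = F (a, y, t)) ->
  (\int[mu \x mu \x mu]_(p in box3 a b c) (f p)%:E = 0)%E.
Proof.
move=> dF F0; apply: (@integral_prod_eq0l _ _ _ _ R mu2 mu _ _ m12 (measurable_itv `[0, c]) (EFin \o f) intf).
move=> t _; apply: (@integral_prod_eq0l _ _ _ _ R mu mu _ _ (measurable_itv `[0, a]) (measurable_itv `[0, b])
  (fun q => (f (q, t))%:E) (continuous_slice_integrable a b t cf)).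
move=> y _; apply: (@integral_derive_eq0 (fun x => F (x, y, t))) => //.
move=> x; apply: (@continuous_comp _ _ _ (fun x => (x, y, t)) f); last exact: cf.
by apply: continuous_pair; [apply: continuous_pair|]; by [exact: cvg_id|exact: cvg_cst].
Qed.

Lemma integral_divergence2 : (forall x y t : R, is_derive y (1 : R) (fun y => F (x, y, t)) (f (x, y, t))) ->
  (forall x t, F (x, 0, t) = F (x, b, t)) ->
  (\int[mu \x mu \x mu]_(p in box3 a b c) (f p)%:E = 0)%E.
Proof.
move=> dF F0; apply: (@integral_prod_eq0l _ _ _ _ R mu2 mu _ _ m12 (measurable_itv `[0, c]) (EFin \o f) intf).
move=> t _; apply: (@integral_prod_eq0r _ _ _ _ R mu mu _ _ (measurable_itv `[0, a]) (measurable_itv `[0, b])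
  (fun q => (f (q, t))%:E) (continuous_slice_integrable a b t cf)).
move=> x _; apply: (@integral_derive_eq0 (fun y => F (x, y, t))) => //.
move=> y; apply: (@continuous_comp _ _ _ (fun y => (x, y, t)) f); last exact: cf.
by apply: continuous_pair; [apply: continuous_pair|]; by [exact: cvg_id|exact: cvg_cst].
Qed.
End Divergence.

End Box.
Section SphereIntegral.
Context {R : realType}.
Local Notation E4 := 'rV[R]_4.
Local Notation mu := (@lebesgue_measure R).

Lemma is_derive_path (f : E4 -> R) (g : R -> E4) (t : R) (v : E4) :
  differentiable f (g t) ->
  (forall j, is_derive t (1 : R) (fun s => g s 0 j) (v 0 j)) ->
  is_derive t (1 : R) (fun s => f (g s)) ('D_v f (g t)).
Proof.
move=> df dg.
have dgt : derivable g t 1.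
  by apply/derivable_mxP => i j; rewrite (ord1 i); case: (dg j).
have Dg : 'D_1 g t = v.
  rewrite derive_mx//; apply/rowP => j; rewrite mxE; by have [_ ->] := dg j.
have dg' : differentiable g t by apply/derivable1_diffP.
have dfg : differentiable (f \o g) t by apply: differentiable_comp.
apply: DeriveDef; first exact/derivable1_diffP.
have E := congr1 (fun h : R -> R => h 1) (diff_comp dg' df).
by rewrite [LHS](deriveE _ dfg) (deriveE _ df) [LHS]E /= -(deriveE _ dg') Dg.
Qed.

Definition S3_param_eta (p : R * R * R) : E4 :=
  let: (eta, a, b) := p in
  row4 (- sin eta * cos a) (- sin eta * sin a) (cos eta * cos b) (cos eta * sin b).
Definition S3_param_a (p : R * R * R) : E4 :=
  let: (eta, a, b) := p in row4 (- (cos eta * sin a)) (cos eta * cos a) 0 0.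
Definition S3_param_b (p : R * R * R) : E4 :=
  let: (eta, a, b) := p in row4 0 0 (- (sin eta * sin b)) (sin eta * cos b).

Lemma is_derive_S3_param_eta (eta a b : R) j :
  is_derive eta (1 : R) (fun t => S3_param (t, a, b) 0 j) (S3_param_eta (eta, a, b) 0 j).
Proof.
case: j => [[|[|[|[|//]]]] ?] /=; rewrite !mxE /=;
  under eq_fun do rewrite !mxE /=; apply: is_derive_eq; rewrite /GRing.scale /=; ring.
Qed.

Lemma is_derive_S3_param_a (eta a b : R) j :
  is_derive a (1 : R) (fun t => S3_param (eta, t, b) 0 j) (S3_param_a (eta, a, b) 0 j).
Proof.
case: j => [[|[|[|[|//]]]] ?] /=; rewrite !mxE /=;
  under eq_fun do rewrite !mxE /=; apply: is_derive_eq; rewrite /GRing.scale /=; ring.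
Qed.

Lemma is_derive_S3_param_b (eta a b : R) j :
  is_derive b (1 : R) (fun t => S3_param (eta, a, t) 0 j) (S3_param_b (eta, a, b) 0 j).
Proof.
case: j => [[|[|[|[|//]]]] ?] /=; rewrite !mxE /=;
  under eq_fun do rewrite !mxE /=; apply: is_derive_eq; rewrite /GRing.scale /=; ring.
Qed.

Lemma S3_param_sphere (p : R * R * R) : sphere 1 (S3_param p).
Proof.
case: p => [[eta a] b]; apply/sphere1P; rewrite dot4E !mxE /=.
transitivity (cos eta ^+ 2 * (cos a ^+ 2 + sin a ^+ 2) + sin eta ^+ 2 * (cos b ^+ 2 + sin b ^+ 2)).
  ring.
by rewrite !cos2Dsin2 !mulr1 cos2Dsin2.
Qed.

Lemma derive_line_coord (W : normedModType R) (F : R * R * R -> W) (p v : R * R * R) (g : R -> W) (t : R) :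
  (forall h : R, F (h *: v + p) = g (h + t)) -> 'D_v F p = 'D_1 g t.
Proof.
move=> Fg; have Fp : F p = g t by rewrite -[p]add0r -(scale0r v) Fg add0r.
have E : (fun h : R => h^-1 *: (F (h *: v + p) - F p)) =
    (fun h : R => h^-1 *: (g (h *: (1 : R) + t) - g t)).
  by apply/funext => h; rewrite Fg Fp /GRing.scale /= mulr1.
exact: (congr1 (fun k : R -> W => lim (k h @[h --> 0^'])) E).
Qed.

Lemma derive_row (g : R -> E4) (t : R) (v : E4) :
  (forall j, is_derive t (1 : R) (fun s => g s 0 j) (v 0 j)) -> 'D_1 g t = v.
Proof.
move=> dg; have dgt : derivable g t 1.
  by apply/derivable_mxP => i j; rewrite (ord1 i); case: (dg j).
by rewrite derive_mx//; apply/rowP => j; rewrite mxE; have [_ ->] := dg j.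
Qed.

Lemma derive_S3_param0 (p : R * R * R) : 'D_(coord_dir 0) S3_param p = S3_param_eta p.
Proof.
case: p => [[eta a] b].
rewrite (@derive_line_coord _ _ _ _ (fun t => S3_param (t, a, b)) eta).
  by apply: derive_row => j; exact: is_derive_S3_param_eta.
by move=> h; congr (S3_param (_, _, _)); rewrite /= /GRing.scale /= ?mulr1 ?mulr0 ?add0r.
Qed.

Lemma derive_S3_param1 (p : R * R * R) : 'D_(coord_dir 1) S3_param p = S3_param_a p.
Proof.
case: p => [[eta a] b].
rewrite (@derive_line_coord _ _ _ _ (fun t => S3_param (eta, t, b)) a).
  by apply: derive_row => j; exact: is_derive_S3_param_a.
by move=> h; congr (S3_param (_, _, _)); rewrite /= /GRing.scale /= ?mulr1 ?mulr0 ?add0r.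
Qed.

Lemma derive_S3_param2 (p : R * R * R) : 'D_(coord_dir 2) S3_param p = S3_param_b p.
Proof.
case: p => [[eta a] b].
rewrite (@derive_line_coord _ _ _ _ (fun t => S3_param (eta, a, t)) b).
  by apply: derive_row => j; exact: is_derive_S3_param_b.
by move=> h; congr (S3_param (_, _, _)); rewrite /= /GRing.scale /= ?mulr1 ?mulr0 ?add0r.
Qed.

Lemma S3_densityE (eta a b : R) : S3_density (eta, a, b) = `|cos eta * sin eta|.
Proof.
have Ca := cos2Dsin2 a; have Cb := cos2Dsin2 b; have Ce := cos2Dsin2 eta.
rewrite -sqrtr_sqr /S3_density; congr Num.sqrt.
rewrite (_ : \matrix_(i, j) _ = diag_mx (row3 1 (cos eta ^+ 2) (sin eta ^+ 2))).
  rewrite det_diag !big_ord_recl big_ord0 !mxE /=; ring.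
have dS (i : 'I_3) : 'D_(coord_dir i) S3_param (eta, a, b) =
    [:: S3_param_eta (eta, a, b); S3_param_a (eta, a, b); S3_param_b (eta, a, b)]`_i.
  case: i => [[|[|[|//]]] ?].
  - exact: derive_S3_param0.
  - exact: derive_S3_param1.
  - exact: derive_S3_param2.
apply/matrixP => i j; rewrite !mxE !dS dot4E.
case: i => [[|[|[|//]]] ?]; case: j => [[|[|[|//]]] ?];
  rewrite /= !mxE /= -?val_eqE /= ?mulr1n ?mulr0n.
- transitivity (sin eta ^+ 2 * (cos a ^+ 2 + sin a ^+ 2) + cos eta ^+ 2 * (cos b ^+ 2 + sin b ^+ 2)).
    by ring.
  by rewrite Ca Cb !mulr1 addrC.
- by ring.
- by ring.
- by ring.
- transitivity (cos eta ^+ 2 * (cos a ^+ 2 + sin a ^+ 2)); first by ring.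
  by rewrite Ca mulr1.
- by ring.
- by ring.
- by ring.
- transitivity (sin eta ^+ 2 * (cos b ^+ 2 + sin b ^+ 2)); first by ring.
  by rewrite Cb mulr1.
Qed.

Lemma continuous_proj1 : continuous (fun p : R * R * R => p.1.1).
Proof. by move=> p; apply: (@continuous_comp _ _ _ fst fst); exact: cvg_fst. Qed.

Lemma continuous_proj2 : continuous (fun p : R * R * R => p.1.2).
Proof. by move=> p; apply: (@continuous_comp _ _ _ fst snd); [exact: cvg_fst|exact: cvg_snd]. Qed.

Lemma continuous_proj3 : continuous (fun p : R * R * R => p.2).
Proof. by move=> p; exact: cvg_snd. Qed.

Lemma continuous_cos_eta (p : R * R * R) : {for p, continuous (fun p : R * R * R => cos p.1.1)}.
Proof. by apply: continuous_comp; [exact: continuous_proj1|exact: continuous_cos]. Qed.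
Lemma continuous_sin_eta (p : R * R * R) : {for p, continuous (fun p : R * R * R => sin p.1.1)}.
Proof. by apply: continuous_comp; [exact: continuous_proj1|exact: continuous_sin]. Qed.
Let c2 p : {for p, continuous (fun p : R * R * R => cos p.1.2)}.
Proof. by apply: continuous_comp; [exact: continuous_proj2|exact: continuous_cos]. Qed.
Let s2 p : {for p, continuous (fun p : R * R * R => sin p.1.2)}.
Proof. by apply: continuous_comp; [exact: continuous_proj2|exact: continuous_sin]. Qed.
Let c3 p : {for p, continuous (fun p : R * R * R => cos p.2)}.
Proof. by apply: continuous_comp; [exact: continuous_proj3|exact: continuous_cos]. Qed.
Let s3 p : {for p, continuous (fun p : R * R * R => sin p.2)}.
Proof. by apply: continuous_comp; [exact: continuous_proj3|exact: continuous_sin]. Qed.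

Let continuous_row4 (f0 f1 f2 f3 : R * R * R -> R) :
  continuous f0 -> continuous f1 -> continuous f2 -> continuous f3 ->
  continuous (fun p => row4 (f0 p) (f1 p) (f2 p) (f3 p)).
Proof.
move=> cf0 cf1 cf2 cf3 p; apply: continuous_row => j.
have H (g : R * R * R -> R) : continuous g ->
    (forall y, row4 (f0 y) (f1 y) (f2 y) (f3 y) 0 j = g y) ->
    {for p, continuous (fun y => row4 (f0 y) (f1 y) (f2 y) (f3 y) 0 j)}.
  move=> cg E; have -> : (fun y => row4 (f0 y) (f1 y) (f2 y) (f3 y) 0 j) = g by exact/funext.
  exact: cg.
case: j H => [[|[|[|[|//]]]] ?] H.
- by apply: (H f0) => // y; rewrite mxE.
- by apply: (H f1) => // y; rewrite mxE.
- by apply: (H f2) => // y; rewrite mxE.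
- by apply: (H f3) => // y; rewrite mxE.
Qed.

Lemma continuous_S3_param : continuous (@S3_param R).
Proof.
have -> : @S3_param R = fun p => row4 (cos p.1.1 * cos p.1.2) (cos p.1.1 * sin p.1.2)
    (sin p.1.1 * cos p.2) (sin p.1.1 * sin p.2) by apply/funext => -[[]].
apply: continuous_row4 => p; apply: cvgM;
  first [exact: continuous_cos_eta|exact: continuous_sin_eta|exact: c2|exact: s2|exact: c3|exact: s3].
Qed.

Lemma continuous_S3_param_eta : continuous S3_param_eta.
Proof.
have -> : S3_param_eta = fun p => row4 (- sin p.1.1 * cos p.1.2) (- sin p.1.1 * sin p.1.2)
    (cos p.1.1 * cos p.2) (cos p.1.1 * sin p.2) by apply/funext => -[[]].
apply: continuous_row4 => p; apply: cvgM;
  try apply: cvgN; first [exact: continuous_cos_eta|exact: continuous_sin_eta|exact: c2|exact: s2|exact: c3|exact: s3].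
Qed.

Lemma continuous_S3_param_a : continuous S3_param_a.
Proof.
have -> : S3_param_a = fun p => row4 (- (cos p.1.1 * sin p.1.2)) (cos p.1.1 * cos p.1.2) 0 0
  by apply/funext => -[[]].
apply: continuous_row4 => p; try exact: cvg_cst; try apply: cvgN; apply: cvgM;
  first [exact: continuous_cos_eta|exact: continuous_sin_eta|exact: c2|exact: s2|exact: c3|exact: s3].
Qed.

Lemma continuous_S3_param_b : continuous S3_param_b.
Proof.
have -> : S3_param_b = fun p => row4 0 0 (- (sin p.1.1 * sin p.2)) (sin p.1.1 * cos p.2)
  by apply/funext => -[[]].
apply: continuous_row4 => p; try exact: cvg_cst; try apply: cvgN; apply: cvgM;
  first [exact: continuous_cos_eta|exact: continuous_sin_eta|exact: c2|exact: s2|exact: c3|exact: s3].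
Qed.

Lemma continuous_sfun_S3_param (f : sfun) : continuous (fun p => f (@S3_param R p)).
Proof.
move=> p; apply: (@continuous_comp _ _ _ (@S3_param R) f).
  exact: continuous_S3_param.
exact/differentiable_continuous/sfun_differentiable/S3_param_sphere.
Qed.

Lemma continuous_derive_S3_param (f : sfun) (w : R * R * R -> E4) : continuous w ->
  continuous (fun p => 'D_(w p) f (S3_param p)).
Proof.
move=> cw.
have -> : (fun p => 'D_(w p) f (S3_param p)) =
    fun p => \sum_(l < 4) w p 0 l * 'D_(delta_mx 0 l) f (S3_param p).
  by apply/funext => p; apply: derive_row_sum; exact/sfun_differentiable/S3_param_sphere.
move=> p; apply: cvg_sumr => l; apply: cvgM.
  by apply: (@continuous_comp _ _ _ w (fun v : E4 => v 0 l)); [exact: cw|exact: coord_continuous].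
apply: (@continuous_comp _ _ _ (@S3_param R) ('D_(delta_mx 0 l) f)).
  exact: continuous_S3_param.
have [_ _ /(_ 1)[_ /(_ (delta_mx 0 l))]] := sfunP f; apply.
exact/sphere_neq0/S3_param_sphere.
Qed.

(** The volume density without its absolute value. The two agree on the box, where sine and cosine
    are nonnegative, and this version is differentiable everywhere. *)
Definition S3_weight (p : R * R * R) : R := cos p.1.1 * sin p.1.1.

Lemma continuous_S3_weight : continuous S3_weight. Proof. by move=> p; apply: cvgM; [exact: continuous_cos_eta|exact: continuous_sin_eta]. Qed.

Let S3_boxE : @S3_box R = box3 (pi / 2) (2 * pi) (2 * pi). Proof. by []. Qed.

Lemma S3_density_box (p : R * R * R) : S3_box p -> S3_density p = S3_weight p.
Proof.
case: p => [[eta a] b] [[/= + _] _]; rewrite in_itv /= => /andP[e0 e1].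
rewrite S3_densityE ger0_norm// mulr_ge0//.
  by apply: cos_ge0_pihalf; rewrite e1 andbT (le_trans _ e0)// oppr_le0 divr_ge0 ?pi_ge0.
apply: sin_ge0_pi; rewrite e0 (le_trans e1)// ler_pdivrMr// ler_peMr ?pi_ge0//.
by rewrite ler1n.
Qed.

Lemma S3_integralE (f : E4 -> R) : S3_integral f =
  (\int[mu \x mu \x mu]_(p in box3 (pi / 2) (2 * pi) (2 * pi)) (f (S3_param p) * S3_weight p)%:E)%E.
Proof.
rewrite /S3_integral S3_boxE; apply: eq_integral => p.
by rewrite inE => Bp; rewrite S3_density_box.
Qed.

Let sfun_integrable (f : sfun) :
  (mu \x mu \x mu)%E.-integrable (box3 (pi / 2) (2 * pi) (2 * pi))
    (EFin \o (fun p => f (S3_param p) * S3_weight p)).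
Proof.
apply: continuous_box3_integrable => p; apply: cvgM; last exact: continuous_S3_weight.
exact: continuous_sfun_S3_param.
Qed.

(** Not normalized: this is the integral as a real number, and [S3_mean 1] is the volume of the
    sphere. *)
Definition S3_mean (f : sfun) : R := fine (S3_integral f).

Lemma S3_integral_fin (f : sfun) : S3_integral f = (S3_mean f)%:E.
Proof.
rewrite /S3_mean fineK// S3_integralE.
by apply: (integrable_fin_num _ (sfun_integrable f)); exact: measurable_box3.
Qed.

Lemma S3_meanD (f g : sfun) : S3_mean (f + g) = S3_mean f + S3_mean g.
Proof.
apply: EFin_inj; rewrite EFinD -!S3_integral_fin !S3_integralE.
rewrite -(integralD (measurable_box3 _ _ _) (sfun_integrable f) (sfun_integrable g)).
by apply: eq_integral => p _; rewrite sfunD mulrDl EFinD.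
Qed.

Lemma S3_mean_le (f g : sfun) : (forall y, sphere 1 y -> f y <= g y) ->
  S3_mean f <= S3_mean g.
Proof.
move=> fg; rewrite -lee_fin -!S3_integral_fin !S3_integralE.
apply: (le_integral (measurable_box3 _ _ _) (sfun_integrable f) (sfun_integrable g)).
move=> p; rewrite inE => Bp; rewrite lee_fin ler_wpM2r ?fg//; last exact: S3_param_sphere.
by rewrite -S3_density_box// sqrtr_ge0.
Qed.

Lemma S3_meanZ (c : R) (f : sfun) : S3_mean (sfun_cst c * f) = c * S3_mean f.
Proof.
apply: EFin_inj; rewrite EFinM -!S3_integral_fin !S3_integralE.
rewrite -(integralZl (measurable_box3 _ _ _) (sfun_integrable f)).
apply: eq_integral => p _; rewrite -EFinM; congr (_%:E).
by rewrite sfunM sfun_cstE ?mulrA//; exact: S3_param_sphere.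
Qed.
End SphereIntegral.

(** * The integral of a frame derivative vanishes *)

Section SphereDivergence.
Context {R : realType}.
Local Notation E4 := 'rV[R]_4.
Local Notation mu := (@lebesgue_measure R).
Local Notation weight := (@S3_weight R).
Section FrameDivergence.
Context (f : @sfun R).
Let F p := f (S3_param p).
Let Fe p := 'D_(S3_param_eta p) f (S3_param p).
Let Fa p := 'D_(S3_param_a p) f (S3_param p).
Let Fb p := 'D_(S3_param_b p) f (S3_param p).

Let df p : differentiable f (S3_param p).
Proof. exact/sfun_differentiable/S3_param_sphere. Qed.

Let dFe (x y t : R) : is_derive x (1 : R) (fun x => F (x, y, t)) (Fe (x, y, t)).
Proof. by apply: is_derive_path => // j; exact: is_derive_S3_param_eta. Qed.
Let dFa (x y t : R) : is_derive y (1 : R) (fun y => F (x, y, t)) (Fa (x, y, t)).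
Proof. by apply: is_derive_path => // j; exact: is_derive_S3_param_a. Qed.
Let dFb (x y t : R) : is_derive t (1 : R) (fun t => F (x, y, t)) (Fb (x, y, t)).
Proof. by apply: is_derive_path => // j; exact: is_derive_S3_param_b. Qed.

Let cF : continuous F. Proof. exact: continuous_sfun_S3_param. Qed.
Let cFe : continuous Fe.
Proof. by apply: continuous_derive_S3_param; exact: continuous_S3_param_eta. Qed.
Let cFa : continuous Fa.
Proof. by apply: continuous_derive_S3_param; exact: continuous_S3_param_a. Qed.
Let cFb : continuous Fb.
Proof. by apply: continuous_derive_S3_param; exact: continuous_S3_param_b. Qed.

Let J (h : R * R * R -> R) :=
  (\int[mu \x mu \x mu]_(p in box3 (pi / 2) (2 * pi) (2 * pi)) (h p)%:E)%E.

Let S3_mean_split (i : 'I_3) (g1 g2 g3 : R * R * R -> R) :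
  continuous g1 -> continuous g2 -> continuous g3 ->
  J g1 = 0%E -> J g2 = 0%E -> J g3 = 0%E ->
  (forall p, 'D_(S3_frame (S3_param p) i) f (S3_param p) * weight p = g1 p + g2 p + g3 p) ->
  S3_mean (frame_derive i f) = 0.
Proof.
move=> cg1 cg2 cg3 g10 g20 g30 E; apply: EFin_inj.
rewrite -S3_integral_fin S3_integralE.
have i1 := continuous_box3_integrable (pi / 2) (2 * pi) (2 * pi) cg1.
have i2 := continuous_box3_integrable (pi / 2) (2 * pi) (2 * pi) cg2.
have i3 := continuous_box3_integrable (pi / 2) (2 * pi) (2 * pi) cg3.
have mB := measurable_box3 (pi / 2 : R) (2 * pi) (2 * pi).
transitivity (J g1 + J g2 + J g3)%E; last by rewrite g10 g20 g30 !adde0.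
rewrite /J -(integralD mB i1 i2) -(integralD mB (integrableD mB i1 i2) i3).
by apply: eq_integral => p _; rewrite -!EFinD; congr (_%:E); exact: E.
Qed.

Let pi2_gt0 : 0 < pi / 2 :> R. Proof. by rewrite divr_gt0 ?pi_gt0. Qed.
Let twopi_gt0 : 0 < 2 * pi :> R. Proof. by rewrite mulr_gt0 ?pi_gt0. Qed.

Let cosD2pi (x : R) : cos (x + 2 * pi) = cos x.
Proof. by rewrite mulrC mulr_natr cosD2pi. Qed.
Let sinD2pi (x : R) : sin (x + 2 * pi) = sin x.
Proof. by rewrite mulrC mulr_natr sinD2pi. Qed.

Let F_per2 x t : F (x, 0, t) = F (x, 2 * pi, t).
Proof. by rewrite /F -[2 * pi]add0r /S3_param cosD2pi sinD2pi. Qed.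
Let F_per3 x y : F (x, y, 0) = F (x, y, 2 * pi).
Proof. by rewrite /F -[2 * pi]add0r /S3_param cosD2pi sinD2pi. Qed.

Section Twisted.
Context (i : 'I_3) (k dk : R -> R).
Context (dkk : forall x : R, is_derive x (1 : R) k (dk x))
  (ddk : forall x : R, is_derive x (1 : R) dk (- k x))
  (dkper : forall x, dk (x + 2 * pi) = dk x).
Context (frameE : forall p : R * R * R, weight p *: S3_frame (S3_param p) i =
  (weight p * k (p.1.2 + p.2)) *: S3_param_eta p
  + (- (sin p.1.1 ^+ 2 * dk (p.1.2 + p.2))) *: S3_param_a p
  + (cos p.1.1 ^+ 2 * dk (p.1.2 + p.2)) *: S3_param_b p).

Let shift_derive (h dh : R -> R) (y t : R) : is_derive (y + t) (1 : R) h (dh (y + t)) ->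
  is_derive t (1 : R) (fun t => h (y + t)) (dh (y + t)).
Proof.
move=> dhy; have d1 : is_derive t (1 : R) (fun t => y + t) 1.
  rewrite (_ : (fun t => y + t) = shift y); first exact: is_derive_shift.
  by apply/funext => z /=; rewrite addrC.
have := @is_derive1_comp _ h (fun t => y + t) t _ _ dhy d1.
by rewrite mulr1.
Qed.

Let theta (p : R * R * R) := p.1.2 + p.2.
Let ctheta : continuous theta.
Proof. by move=> p; apply: cvgD; [exact: continuous_proj2|exact: continuous_proj3]. Qed.
Let ck : continuous (k \o theta).
Proof.
move=> p; apply: continuous_comp; first exact: ctheta.
by apply: differentiable_continuous; apply/derivable1_diffP; case: (dkk (theta p)).
Qed.

Let cdk : continuous (dk \o theta).
Proof.
move=> p; apply: continuous_comp; first exact: ctheta.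
by apply: differentiable_continuous; apply/derivable1_diffP; case: (ddk (theta p)).
Qed.

Let cc : continuous (fun p : R * R * R => cos p.1.1 ^+ 2).
Proof. by move=> p; apply: cvgM; exact: continuous_cos_eta. Qed.
Let ss : continuous (fun p : R * R * R => sin p.1.1 ^+ 2).
Proof. by move=> p; apply: cvgM; exact: continuous_sin_eta. Qed.

Let g1 p := (cos p.1.1 ^+ 2 - sin p.1.1 ^+ 2) * k (theta p) * F p + weight p * k (theta p) * Fe p.
Let g2 p := sin p.1.1 ^+ 2 * k (theta p) * F p - sin p.1.1 ^+ 2 * dk (theta p) * Fa p.
Let g3 p := - (cos p.1.1 ^+ 2 * k (theta p) * F p) + cos p.1.1 ^+ 2 * dk (theta p) * Fb p.

(** Multiplying by the weight removes the singular coefficients of the field in the coordinates.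
    Then [g1], [g2], [g3] are the derivatives in eta, a, b of weight k F, - sin^2 dk F and cos^2 dk
    F, with zero-order terms adding up to 0. In eta the boundary values vanish with the weight; in a
    and b they agree by periodicity. *)
Lemma S3_mean_twisted : S3_mean (frame_derive i f) = 0.
Proof.
have cg1 : continuous g1.
  move=> p; apply: cvgD; apply: cvgM.
  - apply: cvgM; last exact: ck.
    by apply: cvgB; [exact: cc|exact: ss].
  - exact: cF.
  - by apply: cvgM; [exact: continuous_S3_weight|exact: ck].
  - exact: cFe.
have cg2 : continuous g2.
  move=> p; apply: cvgB; apply: cvgM.
  - by apply: cvgM; [exact: ss|exact: ck].
  - exact: cF.
  - by apply: cvgM; [exact: ss|exact: cdk].
  - exact: cFa.
have cg3 : continuous g3.
  move=> p; apply: cvgD; first apply: cvgN; apply: cvgM.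
  - by apply: cvgM; [exact: cc|exact: ck].
  - exact: cF.
  - by apply: cvgM; [exact: cc|exact: cdk].
  - exact: cFb.
apply: (S3_mean_split cg1 cg2 cg3).
- apply: (@integral_divergence1 R g1 (fun p => weight p * k (theta p) * F p) _ _ _ pi2_gt0 cg1).
    move=> x y t; have dF := dFe x y t; rewrite /g1 /S3_weight /theta /=.
    apply: is_derive_eq; rewrite /GRing.scale /=; ring.
  by move=> y t; rewrite /S3_weight /= sin0 cos_pihalf mulr0 !mul0r.
- apply: (@integral_divergence2 R g2 (fun p => - (sin p.1.1 ^+ 2 * dk (theta p) * F p)) _ _ _ twopi_gt0 cg2).
    move=> x y t; have dF := dFa x y t; rewrite /g2 /theta /=.
    have dk' : is_derive y (1 : R) (fun y => dk (y + t)) (- k (y + t)).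
      under eq_fun do rewrite addrC; rewrite [y + t]addrC.
      exact: (@shift_derive dk (fun x => - k x)).
    apply: is_derive_eq; rewrite /GRing.scale /=; ring.
  move=> x t; rewrite F_per2 /theta /=; congr (- (_ * _ * _)).
  by rewrite add0r addrC dkper.
- apply: (@integral_divergence3 R g3 (fun p => cos p.1.1 ^+ 2 * dk (theta p) * F p) _ _ _ twopi_gt0 cg3).
    move=> x y t; have dF := dFb x y t; rewrite /g3 /theta /=.
    have dk' := @shift_derive dk (fun x => - k x) y t (ddk (y + t)).
    apply: is_derive_eq; rewrite /GRing.scale /=; ring.
  by move=> x y; rewrite F_per3 /theta /= dkper addr0.
move=> p.
have E : weight p * 'd f (S3_param p) (S3_frame (S3_param p) i) =
    (weight p * k (theta p)) * 'd f (S3_param p) (S3_param_eta p)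
    + (- (sin p.1.1 ^+ 2 * dk (theta p))) * 'd f (S3_param p) (S3_param_a p)
    + (cos p.1.1 ^+ 2 * dk (theta p)) * 'd f (S3_param p) (S3_param_b p).
  have := congr1 ('d f (S3_param p)) (frameE p).
  by rewrite !linearD !linearZ.
rewrite (deriveE _ (df p)) /g1 /g2 /g3 /Fe /Fa /Fb !(deriveE _ (df p)).
rewrite mulrC E; move: ('d f _ _) ('d f _ _) ('d f _ _) => d1 d2 d3; ring.
Qed.
End Twisted.

(** In the coordinates X_0 is the sum of the derivatives in a and b, and the weight depends on eta
    only, so both terms integrate to 0 by periodicity. *)
Lemma S3_mean_frame_derive0 : S3_mean (frame_derive 0 f) = 0.
Proof.
have cg0 : continuous (fun _ : R * R * R => 0 : R) by move=> p; exact: cvg_cst.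
have cg2 : continuous (fun p => weight p * Fa p).
  by move=> p; apply: cvgM; [exact: continuous_S3_weight|exact: cFa].
have cg3 : continuous (fun p => weight p * Fb p).
  by move=> p; apply: cvgM; [exact: continuous_S3_weight|exact: cFb].
apply: (S3_mean_split cg0 cg2 cg3).
- by apply: integral0_eq.
- apply: (@integral_divergence2 R _ (fun p => weight p * F p) _ _ _ twopi_gt0 cg2).
    move=> x y t; have dF := dFa x y t; rewrite /S3_weight /=.
    apply: is_derive_eq; rewrite /GRing.scale /=; ring.
  by move=> x t; rewrite F_per2.
- apply: (@integral_divergence3 R _ (fun p => weight p * F p) _ _ _ twopi_gt0 cg3).
    move=> x y t; have dF := dFb x y t; rewrite /S3_weight /=.
    apply: is_derive_eq; rewrite /GRing.scale /=; ring.
  by move=> x t; rewrite F_per3.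
move=> p; rewrite add0r -mulrDr mulrC; congr (_ * _).
rewrite /Fa /Fb !(deriveE _ (df p)) -linearD; congr ('d f _ _).
case: p => [[x y] t]; apply/rowP => l.
by case: l => [[|[|[|[|//]]]] ?]; rewrite /S3_frame /= !mxE /= ?addr0 ?add0r.
Qed.

Lemma S3_mean_frame_derive1 : S3_mean (frame_derive 1 f) = 0.
Proof.
have dsin (x : R) : is_derive x (1 : R) (fun x => - sin x) (- cos x).
  by apply: is_derive_eq.
have persin (x : R) : - sin (x + 2 * pi) = - sin x by rewrite sinD2pi.
apply: (@S3_mean_twisted 1 cos (fun x => - sin x) _ dsin persin).
move=> -[[x y] t]; have Cy := cos2Dsin2 y; have Ct := cos2Dsin2 t.
rewrite /= cosD sinD; apply/rowP => l.
case: l => [[|[|[|[|//]]]] ?]; rewrite /S3_frame /= !mxE /= /S3_weight /=.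
- transitivity (- (cos x * sin x ^+ 2 * cos t * (cos y ^+ 2 + sin y ^+ 2))); last by ring.
  by rewrite Cy; ring.
- transitivity (cos x * sin x ^+ 2 * sin t * (cos y ^+ 2 + sin y ^+ 2)); last by ring.
  by rewrite Cy; ring.
- transitivity (cos x ^+ 2 * sin x * cos y * (cos t ^+ 2 + sin t ^+ 2)); last by ring.
  by rewrite Ct; ring.
- transitivity (- (cos x ^+ 2 * sin x * sin y * (cos t ^+ 2 + sin t ^+ 2))); last by ring.
  by rewrite Ct; ring.
Qed.

Lemma S3_mean_frame_derive2 : S3_mean (frame_derive 2 f) = 0.
Proof.
apply: (@S3_mean_twisted 2 sin cos _ _ cosD2pi).
move=> -[[x y] t]; have Cy := cos2Dsin2 y; have Ct := cos2Dsin2 t.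
rewrite /= cosD sinD; apply/rowP => l.
case: l => [[|[|[|[|//]]]] ?]; rewrite /S3_frame /= !mxE /= /S3_weight /=.
- transitivity (- (cos x * sin x ^+ 2 * sin t * (cos y ^+ 2 + sin y ^+ 2))); last by ring.
  by rewrite Cy; ring.
- transitivity (- (cos x * sin x ^+ 2 * cos t * (cos y ^+ 2 + sin y ^+ 2))); last by ring.
  by rewrite Cy; ring.
- transitivity (cos x ^+ 2 * sin x * sin y * (cos t ^+ 2 + sin t ^+ 2)); last by ring.
  by rewrite Ct; ring.
- transitivity (cos x ^+ 2 * sin x * cos y * (cos t ^+ 2 + sin t ^+ 2)); last by ring.
  by rewrite Ct; ring.
Qed.
End FrameDivergence.

Lemma S3_mean_frame_derive (i : 'I_3) (f : @sfun R) : S3_mean (frame_derive i f) = 0.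
Proof.
case: i => [[|[|[|//]]] lti].
- rewrite (_ : Ordinal lti = 0); last exact: val_inj.
  exact: S3_mean_frame_derive0.
- rewrite (_ : Ordinal lti = 1); last exact: val_inj.
  exact: S3_mean_frame_derive1.
- rewrite (_ : Ordinal lti = 2); last exact: val_inj.
  exact: S3_mean_frame_derive2.
Qed.
End SphereDivergence.

(** * Spherical polynomials *)

Section SphericalPolynomials.
Context {R : realType}.
Local Notation E4 := 'rV[R]_4.
Local Notation sfun := (@sfun R).
Local Notation X := (@frame_derive R).
Local Notation cst := (@sfun_cst R).
Local Notation xi := (@sfun_coord R).

Lemma sfun_cstD (a b : R) : cst (a + b) = cst a + cst b.
Proof. by apply: sfun_ext => y Sy; rewrite sfunD !sfun_cstE. Qed.
Lemma sfun_cstM (a b : R) : cst (a * b) = cst a * cst b.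
Proof. by apply: sfun_ext => y Sy; rewrite sfunM !sfun_cstE. Qed.
Lemma sfun_cst0 : cst 0 = 0. Proof. by []. Qed.
Lemma sfun_cst1 : cst 1 = 1. Proof. by []. Qed.

Lemma frame_derive_cstM i (c : R) (f : sfun) : X i (cst c * f) = cst c * X i f.
Proof. by rewrite frame_deriveM frame_derive_cst mulr0 addr0. Qed.

Variant ord4_spec : 'I_4 -> Prop :=
  | Ord40 : ord4_spec 0 | Ord41 : ord4_spec 1 | Ord42 : ord4_spec 2 | Ord43 : ord4_spec 3.

Lemma ord4P (k : 'I_4) : ord4_spec k.
Proof.
by case: k => [[|[|[|[|//]]]] ltk];
  [rewrite (_ : Ordinal ltk = 0)|rewrite (_ : Ordinal ltk = 1)
  |rewrite (_ : Ordinal ltk = 2)|rewrite (_ : Ordinal ltk = 3)];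
  by [constructor|exact: val_inj].
Qed.

(** At a point y of the sphere the frame together with y is an orthonormal basis of 4-space; this is
    the completeness relation of that basis. *)
Lemma sum_frame_coord (k j : 'I_4) :
  X 0 (xi k) * X 0 (xi j) + X 1 (xi k) * X 1 (xi j) + X 2 (xi k) * X 2 (xi j)
  = cst (k == j)%:R - xi k * xi j.
Proof.
apply: sfun_ext => y Sy; rewrite !sfunD !sfunM !frame_derive_coord// sfunN sfunM.
rewrite sfun_cstE// !sfun_coordE//.
have /sphere1P := Sy; rewrite dot4E => y1.
by case: (ord4P k); case: (ord4P j); rewrite /S3_frame !mxE /= -?y1; ring.
Qed.

Definition laplacian (f : sfun) : sfun := divg X (grad X f).

Lemma laplacianE f : laplacian f = X 0 (X 0 f) + X 1 (X 1 f) + X 2 (X 2 f).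
Proof. by []. Qed.

Lemma laplacianD (f g : sfun) : laplacian (f + g) = laplacian f + laplacian g.
Proof. by rewrite !laplacianE !frame_deriveD; ring. Qed.

Lemma laplacianZ (c : R) (f : sfun) : laplacian (cst c * f) = cst c * laplacian f.
Proof. by rewrite !laplacianE !frame_derive_cstM; ring. Qed.

(** Multiplication by a quaternion unit squares to -1, so each X_i X_i contributes [- xi k]. *)
Lemma laplacian_coord k : laplacian (xi k) = - (cst 3 * xi k).
Proof.
have H i : X i (X i (xi k)) = - xi k.
  have [s [m E]] := frame_coord (R := R) i k.
  have -> : X i (xi k) = cst s * xi m.
    apply: sfun_ext => y Sy.
    by rewrite frame_derive_coord// sfunM sfun_cstE// sfun_coordE// E.
  apply: sfun_ext => y Sy; rewrite frame_derive_cstM sfunM sfun_cstE//.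
  rewrite frame_derive_coord// -E sfunN sfun_coordE//.
  by case: i E => [[|[|[|//]]] ?] _; case: (ord4P k); rewrite /S3_frame /= !mxE /= ?mxE /=; ring.
have -> : cst 3 = 1 + 1 + 1.
  by rewrite -!sfun_cst1 -!sfun_cstD; congr cst; ring.
by rewrite laplacianE !H; ring.
Qed.

Definition mon (s : seq 'I_4) : sfun := \prod_(j <- s) xi j.

Lemma mon_cons k s : mon (k :: s) = xi k * mon s.
Proof. by rewrite /mon big_cons. Qed.

(** Functions having some expression as a polynomial of degree below [d] in the coordinates. The
    expression is not unique because the coordinates satisfy the equation of the sphere. The strict
    bound makes 0 the only member for [d = 0]. *)
Inductive polylt (d : nat) : sfun -> Prop :=
  | polylt0 : polylt d 0
  | polyltS (c : R) (s : seq 'I_4) (f : sfun) : (size s < d)%N -> polylt d f ->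
      polylt d (cst c * mon s + f).

Lemma polylt_mon d s : (size s < d)%N -> polylt d (mon s).
Proof.
by move=> sd; rewrite -[mon s]mul1r -[1 * _]addr0; apply: polyltS => //; exact: polylt0.
Qed.

Lemma polyltD d f g : polylt d f -> polylt d g -> polylt d (f + g).
Proof.
move=> pf pg; elim: pf => [|c s h sd ph IH]; first by rewrite add0r.
by rewrite -addrA; exact: polyltS.
Qed.

Lemma polyltZ d (c : R) f : polylt d f -> polylt d (cst c * f).
Proof.
elim=> [|b s h sd ph IH]; first by rewrite mulr0; exact: polylt0.
by rewrite mulrDr mulrA -sfun_cstM; exact: polyltS.
Qed.

Lemma polyltN d f : polylt d f -> polylt d (- f).
Proof.
move=> /(polyltZ (-1)); congr polylt.
by apply: sfun_ext => y Sy; rewrite sfunM sfun_cstE// sfunN mulN1r.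
Qed.

Lemma polylt_le d e f : (d <= e)%N -> polylt d f -> polylt e f.
Proof.
move=> de; elim=> [|b s h sd ph IH]; first exact: polylt0.
by apply: polyltS => //; exact: leq_trans de.
Qed.

Lemma polylt_coord d k f : polylt d f -> polylt d.+1 (xi k * f).
Proof.
elim=> [|b s h sd ph IH]; first by rewrite mulr0; exact: polylt0.
by rewrite mulrDr mulrCA -mon_cons; exact: polyltS.
Qed.

Lemma polylt_mulmon d s f : polylt d f -> polylt (size s + d) (mon s * f).
Proof.
move=> pf; elim: s => [|k s IH]; first by rewrite /mon big_nil mul1r.
by rewrite mon_cons -mulrA; exact: polylt_coord.
Qed.

Lemma polyltM d e f g : polylt d f -> polylt e g -> polylt (d + e) (f * g).
Proof.
move=> pf pg; elim: pf => [|c s h sd ph IH]; first by rewrite mul0r; exact: polylt0.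
rewrite mulrDl; apply: polyltD => //; rewrite -mulrA; apply: polyltZ.
by apply: polylt_le (polylt_mulmon s pg); rewrite leq_add2r ltnW.
Qed.

(** The spherical gradient is the Euclidean one minus its radial part. The Euclidean product has
    lower degree, and by Euler's identity the radial parts contribute minus the degree times the
    product. The induction is by the Leibniz rule and [sum_frame_coord]. *)
Lemma frame_gradient_mon s j :
  polylt (size s)
    (X 0 (mon s) * X 0 (xi j) + X 1 (mon s) * X 1 (xi j) + X 2 (mon s) * X 2 (xi j)
     + cst (size s)%:R * (xi j * mon s)).
Proof.
elim: s => [|k s IH] /=.
  rewrite /mon big_nil -sfun_cst1 !frame_derive_cst !mul0r !addr0 ?mulr0n ?sfun_cst0 ?mul0r ?addr0.
  exact: polylt0.
rewrite mon_cons !frame_deriveM.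
rewrite (_ : _ + _ = xi k * (X 0 (mon s) * X 0 (xi j) + X 1 (mon s) * X 1 (xi j)
      + X 2 (mon s) * X 2 (xi j) + cst (size s)%:R * (xi j * mon s))
    + cst (k == j)%:R * mon s).
  by apply: polyltD; [exact: polylt_coord|apply: polyltZ; exact: polylt_mon].
have -> : cst (size s).+1%:R = cst (size s)%:R + 1 by rewrite -sfun_cst1 -sfun_cstD natr1.
have := sum_frame_coord k j.
move: (X 0 (xi k)) (X 1 (xi k)) (X 2 (xi k)) (cst (k == j)%:R) => x0 x1 x2 c E.
rewrite -[c](subrK (xi k * xi j)) -E; ring.
Qed.

(** Modulo lower degree, degree n has eigenvalue - n (n + 2). Multiplication by a coordinate adds -
    3 from the Laplacian of the coordinate and - 2 n from the cross term, and n (n + 2) + 2 n + 3 =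
    (n + 1) (n + 3). *)
Lemma laplacian_mon s : polylt (size s)
  (laplacian (mon s) + cst (size s * (size s + 2))%:R * mon s).
Proof.
elim: s => [|k s IH] /=.
  rewrite /mon big_nil mulr1 -sfun_cst1 laplacianE !frame_derive_cst.
  by rewrite !add0r mul0n; exact: polylt0.
have pG := frame_gradient_mon s k.
rewrite mon_cons.
rewrite (_ : _ + _ = xi k * (laplacian (mon s) + cst (size s * (size s + 2))%:R * mon s)
  + cst 2 * (X 0 (mon s) * X 0 (xi k) + X 1 (mon s) * X 1 (xi k) + X 2 (mon s) * X 2 (xi k)
     + cst (size s)%:R * (xi k * mon s))).
  apply: polyltD; first exact: polylt_coord.
  by apply: polyltZ; exact: polylt_le pG.
have -> : ((size s).+1 * ((size s).+1 + 2))%:R = (size s * (size s + 2))%:R + (2 * (size s)%:R + 3) :> R.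
  by rewrite -[(size s).+1]addn1 !natrM !natrD; ring.
have c2 : cst 2 = 1 + 1 by rewrite -!sfun_cst1 -!sfun_cstD; congr cst; ring.
have c3 : cst 3 = 1 + 1 + 1 by rewrite -!sfun_cst1 -!sfun_cstD; congr cst; ring.
rewrite (sfun_cstD _ (2 * _ + 3)) (sfun_cstD (2 * _) 3) (sfun_cstM 2) c2 c3.
have -> : laplacian (xi k * mon s) = xi k * laplacian (mon s) + mon s * laplacian (xi k)
  + (1 + 1) * (X 0 (mon s) * X 0 (xi k) + X 1 (mon s) * X 1 (xi k) + X 2 (mon s) * X 2 (xi k)).
  by rewrite !laplacianE !frame_deriveM !frame_deriveD !frame_deriveM; ring.
by rewrite laplacian_coord c3; ring.
Qed.

(** For a monomial m of degree n > 0 and l = n (n + 2), l m is (laplacian m + l m) minus laplacian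
    m. The first term has smaller degree, so the induction hypothesis solves for it, and l is
    invertible. Degree 0 goes into the constant. *)
Lemma polylt_poisson d f : polylt d f ->
  exists r c, f = laplacian r + cst c.
Proof.
have [n] := ubnP d; elim: n d f => // n IHn d f /ltnSE dn.
elim=> [|c s h sd ph [r [b ->]]].
  by exists 0, 0; rewrite laplacianE !(frameX0 (@frame_deriveD R)) !addr0.
suff [r' [b' E]] : exists r' b', mon s = laplacian r' + cst b'.
  exists (cst c * r' + r), (c * b' + b).
  by rewrite laplacianD laplacianZ E sfun_cstD sfun_cstM; ring.
have [s0|s0] := posnP (size s).
  exists 0, 1; rewrite laplacianE !(frameX0 (@frame_deriveD R)) !add0r.
  by rewrite (size0nil s0) /mon big_nil.
have [r' [b' E]] := IHn (size s) _ (leq_trans sd dn) (laplacian_mon s).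
pose l : R := (size s * (size s + 2))%:R.
have l0 : l != 0 by rewrite pnatr_eq0 muln_eq0 addn_eq0 andbF orbF -lt0n.
have cl : cst l^-1 * cst l = 1 by rewrite -sfun_cstM mulVf.
exists (cst l^-1 * (r' - mon s)), (l^-1 * b').
rewrite laplacianZ sfun_cstM -mulrDr.
have -> : laplacian (r' - mon s) = laplacian r' - laplacian (mon s).
  by rewrite !laplacianE !frame_deriveD !(frameXN (@frame_deriveD R)); ring.
transitivity (cst l^-1 * (laplacian (mon s) + cst l * mon s - laplacian (mon s))).
  by rewrite addrAC subrr add0r mulrA cl mul1r.
by rewrite E; congr (_ * _); ring.
Qed.
End SphericalPolynomials.

(** If [P K] failed, the sets [W] such that [P] holds for [K] minus [W] would form a proper filter
    containing [K]. A cluster point of it in [K] contradicts the local hypothesis. *)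
Lemma compact_induction (T : topologicalType) (K : set T) (P : set T -> Prop) :
  compact K -> P set0 -> (forall A B, A `<=` B -> P B -> P A) ->
  (forall A B, P A -> P B -> P (A `|` B)) ->
  (forall x, K x -> exists2 U, nbhs x U & P U) -> P K.
Proof.
move=> cK P0 Ps PU loc; apply: contrapT => nPK.
pose F : set_system T := [set W | P (K `&` ~` W)].
have FF : ProperFilter F.
  split; first by rewrite /F /= setC0 setIT.
  split.
  - by rewrite /F /= setCT setI0.
  - by move=> A B FA FB; rewrite /F /= setCI setIUr; exact: PU.
  - by move=> A B AB FA; apply: Ps FA => x [Kx nBx]; split => // /AB.
have FK : F K by rewrite /F /= setICr.
have [x [Kx clx]] := cK F FF FK.
have [U nU PU'] := loc x Kx.
have FnU : F (~` U) by rewrite /F /= setCK; apply: Ps PU' => y [].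
by have [y [nUy Uy]] := clx _ _ FnU nU.
Qed.

(** * Uniform approximation by spherical polynomials *)

Section SpherePolynomials.
Context {R : realType}.
Local Notation E4 := 'rV[R]_4.
Local Notation sfun := (@sfun R).
Local Notation cst := (@sfun_cst R).
Local Notation xi := (@sfun_coord R).
Local Notation S := (@sphere R 4 1).

Lemma continuous_enorm : continuous (@enorm R 4).
Proof.
move=> x; apply: (@continuous_comp _ _ _ (fun y : E4 => dot y y) Num.sqrt).
  by have := Ck_dot 0 (@openT E4); apply.
exact: sqrt_continuous.
Qed.

Lemma coord_le_enorm (x : E4) j : `|x 0 j| <= enorm x.
Proof.
rewrite -sqrtr_sqr ler_wsqrtr// /dot (bigD1 j)//= -expr2 lerDl.
by apply: sumr_ge0 => i _; rewrite -expr2 sqr_ge0.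
Qed.

Lemma norm_le_enorm (x : E4) : `|x| <= enorm x.
Proof.
rewrite /Num.Def.normr /= mx_normrE; apply: bigmax_le; first exact: sqrtr_ge0.
by move=> -[i j] _ /=; rewrite (ord1 i); exact: coord_le_enorm.
Qed.

Lemma compact_sphere : compact S.
Proof.
apply: bounded_closed_compact.
  exists 1; split; rewrite ?num_real// => M M1 x Sx.
  by apply: le_trans (norm_le_enorm x) _; rewrite Sx ltW.
have -> : S = (@enorm R 4) @^-1` [set 1] by [].
apply: closed_comp; first by move=> x _; exact: continuous_enorm.
by apply: accessible_closed_set1; apply: hausdorff_accessible; exact: norm_hausdorff.
Qed.

Definition sphere_poly (f : sfun) := exists d, polylt d f.

Lemma sphere_poly_cst c : sphere_poly (cst c).
Proof.
exists 1%N; have -> : cst c = cst c * mon [::] + 0 by rewrite addr0 /mon big_nil mulr1.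
by apply: polyltS => //; exact: polylt0.
Qed.

Lemma sphere_poly_coord j : sphere_poly (xi j).
Proof.
exists 2%N; have -> : xi j = mon [:: j] by rewrite /mon big_seq1.
exact: polylt_mon.
Qed.

Lemma sphere_polyD f g : sphere_poly f -> sphere_poly g -> sphere_poly (f + g).
Proof.
move=> [d pf] [e pg]; exists (maxn d e); apply: polyltD.
  by apply: polylt_le pf; exact: leq_maxl.
by apply: polylt_le pg; exact: leq_maxr.
Qed.

Lemma sphere_polyM f g : sphere_poly f -> sphere_poly g -> sphere_poly (f * g).
Proof. by move=> [d pf] [e pg]; exists (d + e)%N; exact: polyltM. Qed.

Lemma sphere_polyN f : sphere_poly f -> sphere_poly (- f).
Proof. by move=> [d pf]; exists d; exact: polyltN. Qed.

Definition poly_approx (h : E4 -> R) :=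
  forall e, 0 < e -> exists2 f, sphere_poly f & forall y, S y -> `|h y - f y| <= e.

Lemma poly_approx_poly f : sphere_poly f -> poly_approx f.
Proof. by move=> pf e e0; exists f => // y _; rewrite subrr normr0 ltW. Qed.

Lemma poly_approxD h k : poly_approx h -> poly_approx k ->
  poly_approx (fun y => h y + k y).
Proof.
move=> ah ak e e0; have e20 : 0 < e / 2 by rewrite divr_gt0.
have [f pf hf] := ah _ e20; have [g pg kg] := ak _ e20.
exists (f + g) => [|y Sy]; first exact: sphere_polyD.
rewrite sfunD opprD addrACA (le_trans (ler_normD _ _))// (splitr e).
by apply: lerD; [exact: hf|exact: kg].
Qed.

Lemma poly_approxZ c h : poly_approx h -> poly_approx (fun y => c * h y).
Proof.
move=> ah e e0; have c0 : 0 < `|c| + 1 by rewrite ltr_wpDl.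
have [f pf hf] := ah _ (divr_gt0 e0 c0).
exists (cst c * f) => [|y Sy]; first by apply: sphere_polyM => //; exact: sphere_poly_cst.
rewrite sfunM sfun_cstE// -mulrBr normrM.
apply: (@le_trans _ _ ((`|c| + 1) * `|h y - f y|)).
  by rewrite ler_wpM2r// lerDl.
by rewrite mulrC -ler_pdivlMr//; exact: hf.
Qed.

Lemma poly_approx_lim h :
  (forall e, 0 < e -> exists2 k, poly_approx k & forall y, S y -> `|h y - k y| <= e) ->
  poly_approx h.
Proof.
move=> H e e0; have e20 : 0 < e / 2 by rewrite divr_gt0.
have [k /(_ _ e20) [f pf kf] hk] := H _ e20.
exists f => // y Sy; apply: le_trans (ler_distD (k y) _ _) _.
by rewrite (splitr e); apply: lerD; [exact: hk|exact: kf].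
Qed.

(* The iteration u <- u + (t^2 - u^2) / 2 increases to |t|. *)
Let abs_iter (f : sfun) (n : nat) : sfun :=
  iter n (fun u => u + cst 2^-1 * (f * f - u * u)) 0.

Let abs_iter_poly f n : sphere_poly f -> sphere_poly (abs_iter f n).
Proof.
move=> pf; elim: n => [|n IH] /=; first exact: sphere_poly_cst.
apply: sphere_polyD => //; apply: sphere_polyM; first exact: sphere_poly_cst.
by apply: sphere_polyD; [|apply: sphere_polyN]; exact: sphere_polyM.
Qed.

(** With t = |f y|, one step multiplies the error by 1 - (t + u) / 2, which is at most 1 - t / 2.
    Since (1 - t/2) (1 + (m+1) t/2) falls short of 1 + m t/2 by (m+1) t^2/4, the weighted error
    never increases; the error itself is thus at most 2 / n, uniformly in t. *)
Let abs_iter_bound (f : sfun) n y : S y -> `|f y| <= 1 ->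
  0 <= abs_iter f n y <= `|f y| /\
  (`|f y| - abs_iter f n y) * (1 + n%:R * (`|f y| / 2)) <= `|f y|.
Proof.
move=> Sy f1; set t := `|f y|; have t0 : 0 <= t by exact: normr_ge0.
elim: n => [|n [/andP[u0 ut] IH]] /=.
  by rewrite if_same subr0 mulr0n mul0r addr0 mulr1 !lexx t0.
rewrite -/(abs_iter f n); set u := abs_iter f n y in u0 ut IH *.
have -> : (if y == 0 then 0 else 2^-1) = 2^-1 :> R.
  by rewrite (negPf (sphere_neq0 Sy)).
have -> : f y * f y - u * u = t ^+ 2 - u ^+ 2 by rewrite -expr2 -(real_normK (num_real (f y))).
have t1 : t <= 1 by [].
split; first by apply/andP; split; nra.
rewrite -[n.+1%:R]natr1; move: IH; set m := n%:R : R => IH; have m0 : 0 <= m by rewrite ler0n.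
have E : t - (u + 2^-1 * (t ^+ 2 - u ^+ 2)) = (t - u) * (1 - (t + u) / 2) by field.
rewrite E; set d := t - u in IH E *; have d0 : 0 <= d by rewrite subr_ge0.
apply: le_trans IH; rewrite -mulrA ler_wpM2l//.
have : (1 - (t + u) / 2) * (1 + (m + 1) * (t / 2)) <= (1 - t / 2) * (1 + (m + 1) * (t / 2)).
  by rewrite ler_wpM2r//; nra.
move/le_trans; apply.
have mt : 0 <= (m + 1) * t ^+ 2 by rewrite mulr_ge0// ?addr_ge0// sqr_ge0.
rewrite -subr_ge0 (_ : _ - _ = (m + 1) * t ^+ 2 / 4); last by field.
by rewrite divr_ge0.
Qed.

Lemma poly_approx_abs h M : 0 < M -> (forall y, S y -> `|h y| <= M) ->
  poly_approx h -> poly_approx (fun y => `|h y|).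
Proof.
move=> M0 hM ah.
suff main f : sphere_poly f -> (forall y, S y -> `|f y| <= 1) -> poly_approx (fun y => `|f y|).
  apply: poly_approx_lim => e e0.
  have [f pf hf] := ah _ e0.
  (* A function within [e] of one bounded by [M] is bounded by [M + e]; dividing by this bound
     brings it into the range where the iteration converges. *)
  exists (fun y => (M + e) * `|(cst (M + e)^-1 * f) y|); last first.
    move=> y Sy; have Me : 0 < M + e by rewrite addr_gt0.
    rewrite sfunM sfun_cstE// normrM gtr0_norm ?invr_gt0// mulrA mulfV ?gt_eqF// mul1r.
    by apply: le_trans (ler_dist_dist _ _) _; exact: hf.
  apply: poly_approxZ; apply: main.
    by apply: sphere_polyM => //; exact: sphere_poly_cst.
  move=> y Sy; have Me : 0 < M + e by rewrite addr_gt0.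
  rewrite sfunM sfun_cstE// normrM gtr0_norm ?invr_gt0// ler_pdivrMl// mulr1.
  have -> : f y = h y - (h y - f y) by rewrite opprB addrC subrK.
  by apply: le_trans (ler_normB _ _) _; apply: lerD; [exact: hM|exact: hf].
move=> pf f1 e e0.
(* The error after [n] iterations is at most 2 / n. *)
pose n := (Num.truncn (2 / e)).+1.
have ne : 2 / e < n%:R by exact: truncnS_gt.
exists (abs_iter f n) => [|y Sy]; first exact: abs_iter_poly.
have [/andP[u0 ut] B] := abs_iter_bound n Sy (f1 _ Sy).
rewrite ger0_norm ?subr_ge0//.
move: B ut u0 (normr_ge0 (f y)) (f1 _ Sy); set t := `|f y|; set u := abs_iter f n y.
move=> B ut u0 t0 t1.
have [->|tn0] := eqVneq t 0; first by rewrite (le_trans _ (ltW e0))// subr_le0.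
have tp : 0 < t by rewrite lt_def tn0.
have d0 : 0 <= t - u by rewrite subr_ge0.
have : (t - u) * (n%:R * (t / 2)) <= t.
  apply: le_trans B; rewrite ler_wpM2l// lerDr//.
rewrite (_ : _ * _ = (t - u) * n%:R / 2 * t); last by field.
rewrite -[leRHS]mul1r ler_pM2r// ler_pdivrMr// mul1r => H.
have n0 : 0 < n%:R :> R by rewrite ltr0n.
rewrite -(ler_pM2r n0) (le_trans H)//.
by move: ne; rewrite ltr_pdivrMr// mulrC => /ltW.
Qed.
End SpherePolynomials.

Section SphereWeierstrass.
Context {R : realType}.
Local Notation E4 := 'rV[R]_4.
Local Notation sfun := (@sfun R).
Local Notation cst := (@sfun_cst R).
Local Notation xi := (@sfun_coord R).
Local Notation S := (@sphere R 4 1).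
Implicit Types (h k : E4 -> R).

Definition continuous_on_sphere (h : E4 -> R) := forall x, S x -> forall e, 0 < e ->
  \forall y \near x, S y -> `|h x - h y| <= e.

Lemma poly_approx_bounded h : poly_approx h ->
  exists2 M, 0 < M & forall y, S y -> `|h y| <= M.
Proof.
move=> /(_ 1 ltr01)[f [d pf] hf].
suff [M M0 fM] : exists2 M, 0 < M & forall y, S y -> `|f y| <= M.
  exists (1 + M) => [|y Sy]; first by rewrite addr_gt0.
  rewrite -[h y](subrK (f y)) (le_trans (ler_normD _ _))// lerD//; [exact: hf|exact: fM].
elim: pf => {hf} [|c s g sd pg [M M0 gM]].
  by exists 1 => // y Sy; rewrite sfun0 normr0.
have mon1 y : S y -> `|mon s y| <= 1.
  move=> Sy; elim: s {sd} => [|j s IH].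
    by rewrite /mon big_nil sfun1// normr1.
  rewrite mon_cons sfunM sfun_coordE// normrM mulr_ile1//.
  by rewrite -[leRHS]Sy; exact: coord_le_enorm.
exists (`|c| + M) => [|y Sy]; first by rewrite ltr_wpDl.
rewrite sfunD sfunM sfun_cstE// (le_trans (ler_normD _ _))// lerD//; last exact: gM.
by rewrite normrM ler_piMr// mon1.
Qed.

Lemma poly_approx_min h k : poly_approx h -> poly_approx k ->
  poly_approx (fun y => Num.min (h y) (k y)).
Proof.
move=> ah ak.
have ahk : poly_approx (fun y => h y + -1 * k y) by apply: poly_approxD => //; exact: poly_approxZ.
have [M M0 hkM] := poly_approx_bounded ahk.
have := poly_approxZ 2^-1 (poly_approxD (poly_approxD ah ak)
  (poly_approxZ (-1) (poly_approx_abs M0 hkM ahk))).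
congr poly_approx; apply/funext => y; rewrite !mulN1r.
have [hk|kh] := leP (h y) (k y).
  by rewrite ler0_norm ?subr_le0//; field.
by rewrite gtr0_norm ?subr_gt0//; field.
Qed.

Lemma dot_sub_sphere (x y : E4) : S x -> S y -> dot (y - x) (y - x) = 2 - 2 * dot x y.
Proof.
move=> /sphere1P xx /sphere1P yy.
rewrite dotDl -[- x]scaleN1r dotZl !(dot_sym _ (y + _)) !dotDl !dotZl xx yy (dot_sym y x).
by ring.
Qed.

Lemma near_dot_sub (x : E4) (e : R) : 0 < e -> \forall y \near x, dot (y - x) (y - x) < e.
Proof.
move=> e0; have c : {for x, continuous (fun y : E4 => dot (y - x) (y - x))}.
  apply: (@continuous_comp _ _ _ (fun y : E4 => y - x) (fun z : E4 => dot z z)).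
    apply: differentiable_continuous.
    by apply: (@differentiableB _ _ _ id (fun=> x)).
  by have := Ck_dot 0 (@openT E4); apply.
have x0 : dot (x - x) (x - x) = 0 by apply/eqP; rewrite dot_eq0 subrr.
by apply: (cvgr_lt _ c); rewrite x0.
Qed.

Lemma sphere_poly_dot (x : E4) : exists2 f, sphere_poly f & forall y, S y -> f y = dot x y.
Proof.
pose t j := cst (x 0 j) * xi j.
have pt j : sphere_poly (t j).
  by apply: sphere_polyM; [exact: sphere_poly_cst|exact: sphere_poly_coord].
exists (t 0 + t 1 + t 2 + t 3); first by do !apply: sphere_polyD => //.
by move=> y Sy; rewrite !sfunD !sfunM !sfun_cstE// !sfun_coordE// dot4E.
Qed.

(** Around each [x] the function h(x) + e/3 + M |y - x|^2 lies above [h] on the whole sphere and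
    within [e] of it near [x]. On the sphere |y - x|^2 = 2 - 2 x . y, so it is a polynomial. By
    compactness a minimum of finitely many of them stays above [h] and below [h + e] everywhere. *)
Lemma sphere_weierstrass h : continuous_on_sphere h -> poly_approx h.
Proof.
move=> ch.
have [B B0 hB] : exists2 B, 0 < B & forall y, S y -> `|h y| <= B.
  suff [B [B0 hB]] : exists B, 0 < B /\ forall y, S y -> S y -> `|h y| <= B.
    by exists B => // y Sy; exact: hB.
  apply: (compact_induction (P := fun A => exists B, 0 < B /\ forall y, A y -> S y -> `|h y| <= B)
    compact_sphere).
  - by exists 1.
  - by move=> A A' AA' [B [B0 hB]]; exists B; split => // y /AA'; exact: hB.
  - move=> A A' [B [B0 hB]] [B' [B'0 hB']]; exists (B + B'); split; first by rewrite addr_gt0.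
    move=> y [Ay|Ay] Sy.
      by rewrite (le_trans (hB _ Ay Sy))// lerDl ltW.
    by rewrite (le_trans (hB' _ Ay Sy))// lerDr ltW.
  - move=> x Sx; exists [set y | S y -> `|h x - h y| <= 1]; first exact: ch.
    exists (1 + `|h x|); split=> [|y hy Sy]; first by rewrite ltr_pwDl.
    rewrite -[h y](subrK (h x)) (le_trans (ler_normD _ _))// lerD2r distrC.
    exact: hy.
apply: poly_approx_lim => e e0.
suff [b ab [hb bh]] : exists2 b, poly_approx b & (forall y, S y -> h y <= b y) /\
    (forall y, S y -> S y -> b y <= h y + e).
  exists b => // y Sy; rewrite ler0_norm ?subr_le0 ?hb// opprB lerBlDl.
  exact: bh.
pose P A := exists2 b, poly_approx b & (forall y, S y -> h y <= b y) /\
  (forall y, A y -> S y -> b y <= h y + e).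
apply: (compact_induction (P := P) compact_sphere).
- exists (cst B); first exact/poly_approx_poly/sphere_poly_cst.
  split=> // y Sy; rewrite sfun_cstE//.
  by apply: le_trans (hB _ Sy); exact: ler_norm.
- by move=> A A' AA' [b ab [hb bA]]; exists b => //; split => // y /AA'; exact: bA.
- move=> A A' [b ab [hb bA]] [b' ab' [hb' bA']].
  exists (fun y => Num.min (b y) (b' y)); first exact: poly_approx_min.
  split=> [y Sy|y [Ay|Ay] Sy]; first by rewrite le_min hb// hb'.
    by rewrite ge_min bA.
  by rewrite ge_min bA'// orbT.
move=> x Sx; have e30 : 0 < e / 3 by rewrite divr_gt0.
have /nbhs_ballP[d /= d0 hd] := ch x Sx _ e30.
(* At distance at least [d] from [x] the quadratic term exceeds [2 * B], the largest possible
   oscillation of [h]. *)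
pose M := 2 * B / d ^+ 2.
have M0 : 0 < M by rewrite divr_gt0 ?mulr_gt0// exprn_gt0.
pose q y := h x + e / 3 + M * dot (y - x) (y - x).
have [f pf fE] := sphere_poly_dot x.
pose g : sfun := cst (h x + e / 3) + cst M * (cst 2 + cst (-2) * f).
have pg : sphere_poly g.
  by do !(apply: sphere_polyD || apply: sphere_polyM || exact: sphere_poly_cst || exact: pf).
have gE y : S y -> g y = q y.
  move=> Sy; rewrite /g /q !(sfunD, sfunM) !sfun_cstE// fE// dot_sub_sphere//.
  by rewrite mulNr.
exists [set y | (S y -> `|h x - h y| <= e / 3) /\ M * dot (y - x) (y - x) < e / 3].
  apply: filterI; first exact: ch.
  have := near_dot_sub x (divr_gt0 e30 M0).
  by apply: filterS => y; rewrite ltr_pdivlMr// mulrC.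
exists g; first exact: poly_approx_poly.
split=> [y Sy|y [hSy My] Sy]; last first.
  rewrite gE// /q; have := hSy Sy; rewrite ler_norml => /andP[_ hy].
  by move: hy My; move: (M * _) => z; lra.
rewrite gE// /q.
have [xy|xy] := ltP `|x - y| d.
  have := hd y; rewrite -ball_normE /= => /(_ xy Sy); rewrite ler_norml => /andP[hy _].
  have : 0 <= M * dot (y - x) (y - x) by rewrite mulr_ge0 ?dot_ge0// ltW.
  by move: hy; move: (M * _) => z; lra.
have : 2 * B <= M * dot (y - x) (y - x).
  rewrite /M -mulrA; apply: ler_peMr; first by rewrite mulr_ge0// ltW.
  rewrite ler_pdivlMl ?exprn_gt0// mulr1.
  have dx : d <= enorm (y - x) by apply: le_trans (norm_le_enorm _); rewrite distrC.
  by rewrite -enorm_sqr; apply: lerXn2r dx; rewrite nnegrE ?sqrtr_ge0// ltW.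
have := hB _ Sx; have := hB _ Sy; rewrite !ler_norml => /andP[_ hy] /andP[hx _].
by move: hx hy; move: (M * _) => z; lra.
Qed.

End SphereWeierstrass.

(** * Density of Laplacians *)

Section Poisson.
Context {R : realType}.
Local Notation E4 := 'rV[R]_4.
Local Notation sfun := (@sfun R).
Local Notation cst := (@sfun_cst R).
Local Notation S := (@sphere R 4 1).

Lemma sfun_continuous_on_sphere (f : sfun) : continuous_on_sphere f.
Proof.
move=> x Sx e e0; have cf : {for x, continuous f}.
  exact/differentiable_continuous/sfun_differentiable.
by move/cvgrPdist_le: cf => /(_ e e0); apply: filterS.
Qed.

Lemma S3_mean_cst (c : R) : S3_mean (cst c) = c * S3_mean (1 : sfun).
Proof. by rewrite -S3_meanZ mulr1. Qed.

Lemma S3_mean_ge0 (f : sfun) : (forall y, S y -> 0 <= f y) -> 0 <= S3_mean f.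
Proof.
move=> f0; have <- : S3_mean (0 : sfun) = 0 by rewrite -(mulr0 (cst 0)) S3_meanZ mul0r.
by apply: S3_mean_le => y Sy; rewrite sfun0 f0.
Qed.

Lemma S3_mean_sqr_ge0 (f : sfun) : 0 <= S3_mean (f * f).
Proof. by apply: S3_mean_ge0 => y Sy; rewrite sfunM -expr2 sqr_ge0. Qed.

Lemma S3_mean_sqr_le (f : sfun) (b : R) : (forall y, S y -> `|f y| <= b) ->
  S3_mean (f * f) <= b ^+ 2 * S3_mean (1 : sfun).
Proof.
move=> fb; rewrite -S3_mean_cst; apply: S3_mean_le => y Sy.
rewrite sfunM sfun_cstE// -expr2 -real_normK ?num_real// lerXn2r ?nnegrE ?fb//.
exact: le_trans (fb _ Sy).
Qed.

Lemma sfun_addself_eq0 (f : sfun) : f + f = 0 -> f = 0.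
Proof.
move=> ff; apply: sfun_ext => y Sy.
have : f y + f y = 0 by rewrite -sfunD ff sfun0.
by rewrite sfun0 -mulr2n => /eqP; rewrite mulrn_eq0 => /eqP.
Qed.

(** Approximate [p] within [eta] by a polynomial, which equals laplacian r + c. As [p] and laplacian
    r both integrate to 0, the integral of the error is c V, whence |c| <= eta. So laplacian r is
    within 2 eta of [p], and [eta] is chosen with (2 eta)^2 V = e. *)
Lemma laplacian_dense (p : sfun) (e : R) : S3_mean p = 0 -> 0 < e ->
  exists q, S3_mean ((p - laplacian q) * (p - laplacian q)) <= e.
Proof.
move=> p0 e0; set V := S3_mean (1 : sfun).
have V0 : 0 <= V by apply: S3_mean_ge0 => y Sy; rewrite sfun1.
(* The bound on [c] divides by [V]. When [V = 0], every bounded square integrates to 0 and any [q]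
   serves. *)
have [Vz|Vn] := eqVneq V 0.
  exists 0; have [B B0 pB] := poly_approx_bounded (sphere_weierstrass (sfun_continuous_on_sphere (p - laplacian 0))).
  by apply: le_trans (S3_mean_sqr_le pB) _; rewrite -/V Vz mulr0 ltW.
have Vp : 0 < V by rewrite lt_def Vn.
have [eta eta0 etaE] : exists2 eta, 0 < eta & (2 * eta) ^+ 2 * V = e.
  exists (Num.sqrt (e / (4 * V))); first by rewrite sqrtr_gt0 divr_gt0// mulr_gt0.
  by rewrite exprMn sqr_sqrtr; [field|rewrite divr_ge0// ?mulr_ge0// ltW].
have [f [d pf] fp] := sphere_weierstrass (sfun_continuous_on_sphere p) eta0.
have [r [c fE]] := polylt_poisson pf.
have mr : S3_mean (laplacian r) = 0.
  by rewrite laplacianE !S3_meanD !S3_mean_frame_derive !addr0.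
have mf : S3_mean (f - p) = c * V.
  have -> : f - p = laplacian r + (cst c + cst (-1) * p).
    by rewrite fE -addrA; congr (_ + (_ + _)); apply: sfun_ext => y Sy; rewrite sfunM sfun_cstE// sfunN mulN1r.
  by rewrite (S3_meanD (laplacian r)) mr S3_meanD S3_meanZ p0 S3_mean_cst mulr0 addr0 add0r.
have cE : `|c| <= eta.
  have hi : c * V <= eta * V.
    rewrite -mf -S3_mean_cst; apply: S3_mean_le => y Sy; rewrite sfun_cstE// sfunD sfunN.
    by have := fp _ Sy; rewrite ler_norml => /andP[]; lra.
  have lo : (- eta) * V <= c * V.
    rewrite -mf -S3_mean_cst; apply: S3_mean_le => y Sy; rewrite sfun_cstE// sfunD sfunN.
    by have := fp _ Sy; rewrite ler_norml => /andP[]; lra.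
  by move: lo hi; rewrite !(ler_pM2r Vp) ler_norml => -> ->.
exists r; rewrite -[leRHS]etaE; apply: S3_mean_sqr_le => y Sy.
have -> : (p - laplacian r) y = (p y - f y) + c.
  rewrite (sfunD p) sfunN fE (sfunD (laplacian r)) sfun_cstE//.
  by move: (p y) (laplacian r y) => u v; ring.
by apply: le_trans (ler_normD _ _) _; rewrite mulr2n mulrDl mul1r; apply: lerD => //; exact: fp.
Qed.
End Poisson.

(** * Maps to the 2-sphere *)

Section SphereMaps.
Context {R : realType}.
Local Notation E4 := 'rV[R]_4.
Local Notation sfun := (@sfun R).
Local Notation X := (@frame_derive R).
Local Notation I := (@S3_mean R).
Local Notation cst := (@sfun_cst R).
Local Notation xi := (@sfun_coord R).
Local Notation S := (@sphere R 4 1).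

Lemma dot3_sfun (f g : 'I_3 -> sfun) y :
  dot3 f g y = dot3 (fun j => f j y) (fun j => g j y).
Proof. by rewrite /dot3 !(sfunD, sfunM). Qed.

Lemma det3_sfun (f u v : 'I_3 -> sfun) y :
  det3 f u v y = det3 (fun j => f j y) (fun j => u j y) (fun j => v j y).
Proof. by rewrite /det3 !(sfunD, sfunM, sfunN). Qed.

Lemma S3_helicity_le (a : 'I_3 -> sfun) :
  I (dot3 a (curl X a)) + I (dot3 a (curl X a)) <= I (dot3 (curl X a) (curl X a)).
Proof.
exact: (helicity_le (@frame_deriveD R) (@frame_deriveM R) (@frame_bracket01 R)
  (@frame_bracket12 R) (@frame_bracket20 R) (@S3_meanD R) (@S3_mean_frame_derive R)
  a (@S3_mean_sqr_ge0 R) (@laplacian_dense R)).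
Qed.

Lemma S3_helicity_step (f g : 'I_3 -> sfun) (h : R) :
  dot3 f f = 1 -> dot3 g g = 1 -> (forall y, S y -> (1 + dot3 f g) y != 0) ->
  helicity_primitive X I f h -> helicity_primitive X I g h.
Proof.
move=> ff gg /sfun_inv[w wfg].
exact: (helicity_primitive_step (@frame_deriveD R) (@frame_deriveM R) (@frame_bracket01 R)
  (@frame_bracket12 R) (@frame_bracket20 R) (@S3_meanD R) (@S3_mean_frame_derive R)
  (@sfun_addself_eq0 R) ff gg wfg).
Qed.

Local Ltac nth_compute := lazy beta iota delta [nth nat_of_ord].

Definition hopf_sfun (j : 'I_3) : sfun :=
  [:: cst 2 * (xi 0 * xi 2 + xi 1 * xi 3);
      cst 2 * (xi 1 * xi 2 - xi 0 * xi 3);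
      xi 0 * xi 0 + xi 1 * xi 1 - (xi 2 * xi 2 + xi 3 * xi 3)]`_j.

Lemma hopf_sfunE j y : S y -> hopf_sfun j y = 2 * hopf y 0 j.
Proof.
move=> Sy; case: j => [[|[|[|//]]] ?]; rewrite !mxE /hopf_sfun; nth_compute;
  rewrite !(sfunD, sfunN, sfunM) ?sfun_cstE// !sfun_coordE//.
by field.
Qed.

Lemma frame_derive_hopf i j y : S y -> X i (hopf_sfun j) y =
  let u := S3_frame y i in
  [:: 2 * (y 0 0 * u 0 2 + y 0 2 * u 0 0 + (y 0 1 * u 0 3 + y 0 3 * u 0 1));
      2 * (y 0 1 * u 0 2 + y 0 2 * u 0 1 - (y 0 0 * u 0 3 + y 0 3 * u 0 0));
      2 * (y 0 0 * u 0 0 + y 0 1 * u 0 1 - (y 0 2 * u 0 2 + y 0 3 * u 0 3))]`_j.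
Proof.
move=> Sy; case: j => [[|[|[|//]]] ?]; rewrite /hopf_sfun; nth_compute;
  rewrite ?frame_derive_cstM !(frame_deriveD, frameXN (@frame_deriveD R), frame_deriveM);
  rewrite !(sfunD, sfunN, sfunM) ?sfun_cstE// !sfun_coordE// !frame_derive_coord//; ring.
Qed.

(** X_0 is tangent to the Hopf fibres, so only the component on (X_1, X_2) survives. Twice the Hopf
    map doubles horizontal lengths, hence the area factor 4; the sign comes from the
    orientations. *)
Lemma pull_hopf i : pull X hopf_sfun i = if i == 0 then cst (- 4) else 0.
Proof.
apply: sfun_ext => y Sy; have /sphere1P := Sy; rewrite dot4E => y1.
case: i => [[|[|[|//]]] ?]; rewrite /pull; nth_compute;
  rewrite ?sfun_cstE// det3_sfun /det3 !frame_derive_hopf// !hopf_sfunE// /S3_frame !mxE /= ?(negPf (sphere_neq0 Sy)).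
- transitivity (- 4 * (y 0 0 * y 0 0 + y 0 1 * y 0 1 + y 0 2 * y 0 2 + y 0 3 * y 0 3) ^+ 3).
    by field.
  by rewrite y1 expr1n mulr1.
- by field.
- by field.
Qed.

(** On constant coefficients [curl] is multiplication by 2, so the primitive is half of the
    pullback: its coefficient is -2, and the helicity density is (-2) (-4) = 8. *)
Lemma helicity_hopf : helicity_primitive X I hopf_sfun (8 * I 1).
Proof.
pose a (i : 'I_3) : sfun := if i == 0 then cst (- 2) else 0.
have ca i : curl X a i = pull X hopf_sfun i.
  have c4 : cst (- 4) = cst (- 2) + cst (- 2) by rewrite -sfun_cstD; congr cst; ring.
  rewrite pull_hopf c4; case: i => [[|[|[|//]]] ?];
    rewrite /curl /a /= ?(frameX0 (@frame_deriveD R)) ?frame_derive_cst; ring.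
exists a => //; rewrite -S3_mean_cst; congr I.
rewrite (dot3_ext (fun=> erefl) (fun i => etrans (ca i) (pull_hopf i))) /dot3 /a /=.
have -> : cst 8 = cst (- 2) * cst (- 4) by rewrite -sfun_cstM; congr cst; ring.
by ring.
Qed.

Lemma S3_mean_pull_hopf : I (dot3 (pull X hopf_sfun) (pull X hopf_sfun)) = 16 * I 1.
Proof.
rewrite (dot3_ext pull_hopf pull_hopf) -S3_mean_cst /dot3 /=; congr I.
have -> : cst 16 = cst (- 4) * cst (- 4) by rewrite -sfun_cstM; congr cst; ring.
by ring.
Qed.

(** Near [y] the homogeneous extension coincides with the composition of [phi] and the retraction,
    which is exactly what [dsphere] differentiates. *)
Lemma dsphere_frame n (phi : E4 -> 'rV[R]_n.+1) (f : 'I_n.+1 -> sfun) i j y :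
  (forall j z, S z -> f j z = phi z 0 j) -> S y ->
  dsphere phi y (S3_frame y i) 0 j = X i (f j) y.
Proof.
move=> fE Sy; have y0 := sphere_neq0 Sy.
have E l : \forall z \near y, f l z = phi ((enorm z)^-1 *: z) 0 l.
  apply: filterS (open_nbhs_nbhs (conj open_punctured y0)) => z z0.
  rewrite -fE; last exact: sphere_normalize.
  by have [_ fl _] := sfunP (f l); rewrite fl// invr_gt0 enorm_gt0.
rewrite /dsphere derive_mx ?mxE; last first.
  apply/derivable_mxP => i' l; rewrite (ord1 i').
  by apply: near_eq_derivable (E l) _; exact: sfun_derivable.
by symmetry; apply: near_eq_derive; exact: E.
Qed.

Lemma det_mx_of_rows (a b c : 'rV[R]_3) :
  \det (mx_of_rows a b c) = det3 (fun j => a 0 j) (fun j => b 0 j) (fun j => c 0 j).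
Proof.
rewrite (expand_det_row _ 0) !big_ord_recl big_ord0 /cofactor.
rewrite !(expand_det_row _ 0) !big_ord_recl !big_ord0 /cofactor !det_mx11 !mxE /=.
(* The nested cofactor expansions produce indices that are equal only as numbers; reading
   coordinates through natural numbers identifies them. *)
have [F FE] : exists F : 'rV[R]_3 -> nat -> R, forall (u : 'rV[R]_3) k, u 0 k = F u (val k).
  by exists (fun u n => u 0 (inord n)) => u k; rewrite inord_val.
by rewrite /det3 !FE /= /bump /=; ring.
Qed.

Lemma det3ZZ (C : comNzRingType) (c : C) (f u v : 'I_3 -> C) :
  det3 f (fun l => c * u l) (fun l => c * v l) = c * c * det3 f u v.
Proof. by rewrite /det3; ring. Qed.

Lemma det3C (C : comNzRingType) (f u v : 'I_3 -> C) : det3 f u v = - det3 f v u.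
Proof. by rewrite /det3; ring. Qed.

Lemma sum_lt_ord3 (G : 'I_3 -> 'I_3 -> R) :
  \sum_(i < 3) \sum_(j < 3 | (i < j)%N) G i j = G 0 1 + G 0 2 + G 1 2.
Proof.
under eq_bigr do rewrite big_mkcond.
rewrite !big_ord_recl !big_ord0 /= !addr0 !add0r.
by congr (G _ _ + G _ _ + G _ _); exact: val_inj.
Qed.

Lemma S3_integral_eq (g h : E4 -> R) : (forall y, S y -> g y = h y) ->
  S3_integral g = S3_integral h.
Proof.
move=> gh; rewrite !S3_integralE; apply: eq_integral => p _.
by rewrite gh//; exact: S3_param_sphere.
Qed.

(** On the sphere of radius 1/2 the unit normal at phi is 2 phi = f, and d phi is half of df. The
    pulled-back area form is therefore 1/4 of [pull X f]; squaring gives 1/16, and the half in the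
    energy gives 1/32. *)
Lemma energyF_pull (phi : E4 -> 'rV[R]_3) (f : 'I_3 -> sfun) :
  (forall y, S y -> sphere 2^-1 (phi y)) ->
  (forall j y, S y -> f j y = 2 * phi y 0 j) ->
  energyF phi = (32^-1 * I (dot3 (pull X f) (pull X f)))%:E.
Proof.
move=> Sphi fE.
pose P i j y := det3 (fun l => f l y) (fun l => X i (f l) y) (fun l => X j (f l) y).
have areaE i j y : S y ->
    pullback_area phi y (S3_frame y i) (S3_frame y j) = 4^-1 * P i j y.
  move=> Sy; rewrite /pullback_area /area_form (Sphi y Sy) invrK det_mx_of_rows.
  have D k l : dsphere phi y (S3_frame y k) 0 l = 2^-1 * X k (f l) y.
    rewrite (@dsphere_frame _ phi (fun l => cst 2^-1 * f l))// => [|m z Sz].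
      by rewrite frame_derive_cstM sfunM sfun_cstE.
    by rewrite sfunM sfun_cstE// fE// mulrA mulVf// mul1r.
  have F l : (2 *: phi y) 0 l = f l y by rewrite mxE fE.
  have -> : 4^-1 = 2^-1 * 2^-1 :> R by rewrite -invfM; congr (_^-1); ring.
  rewrite -det3ZZ; congr det3; apply/funext => l; [exact: F|exact: D|exact: D].
have pullE y : dot3 (pull X f) (pull X f) y = P 0 1 y ^+ 2 + P 0 2 y ^+ 2 + P 1 2 y ^+ 2.
  transitivity (P 1 2 y * P 1 2 y + P 2 0 y * P 2 0 y + P 0 1 y * P 0 1 y).
    by rewrite dot3_sfun /dot3 /pull; nth_compute; rewrite !det3_sfun.
  have -> : P 2 0 y = - P 0 2 y by exact: det3C.
  by move: (P _ _ _) (P _ _ _) (P _ _ _) => p12 p02 p01; ring.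
rewrite /energyF (@S3_integral_eq _ (cst 16^-1 * dot3 (pull X f) (pull X f) : sfun)); last first.
  move=> y Sy; rewrite sfunM sfun_cstE// pullE /S3_norm2.
  rewrite (sum_lt_ord3 (fun i j => pullback_area phi y (S3_frame y i) (S3_frame y j) ^+ 2)).
  rewrite !areaE//.
  by move: (P _ _ _) (P _ _ _) (P _ _ _) => *; field.
rewrite (S3_integral_fin (cst 16^-1 * _)) S3_meanZ -EFinM mulrA; congr (_ * _)%:E.
by rewrite -invfM; congr (_^-1); ring.
Qed.

(* Strictly within 60 degrees of [u], as [u] has norm 1/2. *)
Definition close_to (f : 'I_3 -> sfun) (u : E4 -> 'rV[R]_3) :=
  dot3 f f = 1 /\ forall y, S y -> 4^-1 < dot3 (fun j => f j y) (fun j => u y 0 j).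

Lemma dot3_sphere (u : 'rV[R]_3) r : sphere r u -> dot3 (u 0) (u 0) = r ^+ 2.
Proof.
rewrite /sphere /= => <-; rewrite enorm_sqr /dot !big_ord_recl big_ord0 addr0 addrA /dot3.
by congr (_ + _ * _ + _ * _); congr (u _ _); exact: val_inj.
Qed.

(** If b = - a, adding a . u > 1/4 and - a . v > 1/4 gives a . (u - v) > 1/2. But the coordinates of
    [a] are at most 1 in absolute value and those of [u - v] at most 1/6, so the three terms add up
    to at most 1/2. *)
Lemma close_not_antipodal (a b u v : 'I_3 -> R) : dot3 a a = 1 -> dot3 b b = 1 ->
  4^-1 < dot3 a u -> 4^-1 < dot3 b v -> (forall j, `|u j - v j| <= 6^-1) ->
  1 + dot3 a b != 0.
Proof.
move=> aa bb au bv uv; apply/eqP => ab.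
(* |a + b|^2 = 2 (1 + a . b). *)
have s0 : (a 0 + b 0) ^+ 2 + (a 1 + b 1) ^+ 2 + (a 2 + b 2) ^+ 2 = 0.
  transitivity (dot3 a a + dot3 b b + 2 * dot3 a b); first by rewrite /dot3; ring.
  rewrite aa bb; move: (dot3 a b) ab => t; lra.
have bE j : b j = - a j.
  apply/eqP; rewrite -addr_eq0 addrC -(sqrf_eq0 (a j + b j)).
  move: s0 => /eqP; rewrite paddr_eq0 ?addr_ge0 ?sqr_ge0// paddr_eq0 ?sqr_ge0//.
  by case: j => [[|[|[|//]]] ?] /andP[/andP[h0 h1] h2]; [apply: etrans h0|apply: etrans h1|apply: etrans h2];
    congr (_ ^+ 2 == 0); congr (a _ + b _); exact: val_inj.
have a1 j : `|a j| <= 1.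
  rewrite -[leRHS]sqrtr1 -sqrtr_sqr ler_wsqrtr// -aa /dot3.
  have := sqr_ge0 (a 0); have := sqr_ge0 (a 1); have := sqr_ge0 (a 2).
  case: j => [[|[|[|//]]] lj].
  - by rewrite (_ : Ordinal lj = 0); [nra|exact: val_inj].
  - by rewrite (_ : Ordinal lj = 1); [nra|exact: val_inj].
  - by rewrite (_ : Ordinal lj = 2); [nra|exact: val_inj].
have t j : a j * (u j - v j) <= 6^-1.
  apply: le_trans (ler_norm _) _; rewrite normrM -[leRHS]mul1r ler_pM//.
move: au bv (t 0) (t 1) (t 2); rewrite /dot3 !bE => au bv t0 t1 t2.
move: (a 0) (a 1) (a 2) (u 0) (u 1) (u 2) (v 0) (v 1) (v 2) au bv t0 t1 t2.
move=> a0 a1' a2 u0 u1 u2 v0 v1 v2 au bv t0 t1 t2.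
nra.
Qed.

Lemma helicity_primitive_close (f g : 'I_3 -> sfun) u v h : close_to f u -> close_to g v ->
  (forall y, S y -> forall j, `|u y 0 j - v y 0 j| <= 6^-1) ->
  helicity_primitive X I f h -> helicity_primitive X I g h.
Proof.
move=> [ff fu] [gg gv] uv; apply: S3_helicity_step => // y Sy.
have one (k : 'I_3 -> sfun) : dot3 k k = 1 -> dot3 (fun j => k j y) (fun j => k j y) = 1.
  by move=> /(congr1 (fun p : sfun => p y)); rewrite dot3_sfun sfun1.
rewrite sfunD sfun1// dot3_sfun.
exact: (close_not_antipodal (one _ ff) (one _ gg) (fu y Sy) (gv y Sy) (uv y Sy)).
Qed.

(** Each coordinate of [2 u] is approximated within 1/12 by a polynomial, and the resulting vector
    [p] is divided by its norm. The margin 1/12 makes p . u large compared with |p| / 4, which is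
    closeness after normalization. *)
Lemma close_to_exists (u : E4 -> 'rV[R]_3) : (forall y, S y -> sphere 2^-1 (u y)) ->
  (forall j, continuous_on_sphere (fun y => u y 0 j)) -> exists f, close_to f u.
Proof.
move=> Su cu.
have e0 : 0 < 12^-1 :> R by [].
have /choice[p pE] : forall j, exists p : sfun, forall y, S y -> `|2 * u y 0 j - p y| <= 12^-1.
  by move=> j; have [p _ pE] := poly_approxZ 2 (sphere_weierstrass (cu j)) e0; exists p.
have pu y : S y -> [/\ 0 < dot3 (fun j => p j y) (u y 0),
    0 < dot3 (fun j => p j y) (fun j => p j y) &
    dot3 (fun j => p j y) (fun j => p j y) < (4 * dot3 (fun j => p j y) (u y 0)) ^+ 2].
  move=> Sy; have := dot3_sphere (Su y Sy); have := pE 0 y Sy; have := pE 1 y Sy; have := pE 2 y Sy.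
  rewrite /dot3 -!expr2.
  move: (p 0 y) (p 1 y) (p 2 y) (u y 0 0) (u y 0 1) (u y 0 2) => p0 p1 p2 u0 u1 u2 d2 d1 d0 uu.
  have u_le (w : R) : w ^+ 2 <= 2^-1 ^+ 2 -> `|w| <= 2^-1.
    by move=> ww; rewrite -(ler_pXn2r (ltn0Sn 1)) ?nnegrE// real_normK ?num_real.
  have du (w q : R) : w ^+ 2 <= 2^-1 ^+ 2 -> `|2 * w - q| <= 12^-1 -> `|(2 * w - q) * w| <= 24^-1.
    move=> /u_le w2 dw; rewrite normrM (_ : 24^-1 = 12^-1 * 2^-1); last by field.
    by rewrite ler_pM.
  have dd (w q : R) : `|2 * w - q| <= 12^-1 -> (2 * w - q) ^+ 2 <= 144^-1.
    move=> dw; rewrite -real_normK ?num_real// (_ : 144^-1 = 12^-1 ^+ 2); last by field.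
    by rewrite ler_pXn2r ?nnegrE.
  have := sqr_ge0 u0; have := sqr_ge0 u1; have := sqr_ge0 u2 => s2 s1 s0.
  have h0 : u0 ^+ 2 <= 2^-1 ^+ 2 by lra.
  have h1 : u1 ^+ 2 <= 2^-1 ^+ 2 by lra.
  have h2 : u2 ^+ 2 <= 2^-1 ^+ 2 by lra.
  have := du _ _ h0 d0; have := du _ _ h1 d1; have := du _ _ h2 d2.
  have := dd _ _ d0; have := dd _ _ d1; have := dd _ _ d2.
  have := sqr_ge0 (2 * u0 - p0); have := sqr_ge0 (2 * u1 - p1); have := sqr_ge0 (2 * u2 - p2).
  have pp : p0 ^+ 2 + p1 ^+ 2 + p2 ^+ 2 = 4 * (u0 ^+ 2 + u1 ^+ 2 + u2 ^+ 2)
    - 4 * ((2 * u0 - p0) * u0 + (2 * u1 - p1) * u1 + (2 * u2 - p2) * u2)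
    + ((2 * u0 - p0) ^+ 2 + (2 * u1 - p1) ^+ 2 + (2 * u2 - p2) ^+ 2) by ring.
  have puE : p0 * u0 + p1 * u1 + p2 * u2 = 2 * (u0 ^+ 2 + u1 ^+ 2 + u2 ^+ 2)
    - ((2 * u0 - p0) * u0 + (2 * u1 - p1) * u1 + (2 * u2 - p2) * u2) by ring.
  rewrite pp puE uu !ler_norml.
  move: ((2 * u0 - p0) * u0) ((2 * u1 - p1) * u1) ((2 * u2 - p2) * u2) => x0 x1 x2.
  move: ((2 * u0 - p0) ^+ 2) ((2 * u1 - p1) ^+ 2) ((2 * u2 - p2) ^+ 2) => z0 z1 z2.
  move=> a2 a1 a0 b2 b1 b0 /andP[c2 c2'] /andP[c1 c1'] /andP[c0 c0'].
  (* Each error term (2 u_j - p_j) u_j is at most 1/24, so p . u >= 1/2 - 1/8 = 3/8. On the other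
     side |p|^2 <= 1 + 1/2 + 3/144, which is below (3/2)^2. *)
  set t := 2 * _ - _; have tE : 3 / 8 <= t by rewrite /t; lra.
  have tt : (3 / 2) ^+ 2 <= (4 * t) ^+ 2 by rewrite ler_pXn2r ?nnegrE//; lra.
  by split; lra.
have pp y : S y -> 0 < dot3 p p y by move=> Sy; rewrite dot3_sfun; have [] := pu y Sy.
have [n nn n0] := sfun_sqrt pp.
have [m mn] : exists m, m * n = 1 by apply: sfun_inv => y Sy; rewrite gt_eqF// n0.
exists (fun j => m * p j); split=> [|y Sy].
  transitivity (m * n * (m * n)); last by rewrite mn mulr1.
  transitivity (m * m * dot3 p p); first by rewrite /dot3; ring.
  by rewrite -nn; ring.
have [pu0 _ pu1] := pu y Sy; have ny := n0 y Sy.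
have mny : m y * n y = 1 by rewrite -sfunM mn sfun1.
have nny : n y * n y = dot3 (fun j => p j y) (fun j => p j y) by rewrite -sfunM nn dot3_sfun.
have -> : dot3 (fun j => (m * p j) y) (u y 0) = m y * dot3 (fun j => p j y) (u y 0).
  by rewrite /dot3 !sfunM; ring.
have n4 : n y < 4 * dot3 (fun j => p j y) (u y 0).
  by rewrite -(ltr_pXn2r (ltn0Sn 1)) ?nnegrE ?mulr_ge0 ?ltW// expr2 nny.
rewrite -(ltr_pM2r ny) mulrAC mny mul1r mulrC.
by rewrite ltr_pdivrMr// mulrC.
Qed.

(** * Subdivision of a homotopy *)

Section Homotopy.
Context (H : R * E4 -> 'rV[R]_3) (cH : {within (`[0, 1] : set R) `*` S, continuous H}).

Lemma near_homotopy s x e : 0 <= s <= 1 -> S x -> 0 < e ->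
  exists2 d, 0 < d & exists2 V, nbhs x V & forall t y, 0 <= t <= 1 -> S y ->
    `|s - t| < d -> V y -> `|H (s, x) - H (t, y)| <= e.
Proof.
move=> s01 Sx e0; have K : ((`[0, 1] : set R) `*` S) (s, x) by split; rewrite //= in_itv.
have /cvgrPdist_le/(_ e e0) := (subspace_continuousP _ _).1 cH _ K.
rewrite /prop_near1 /within /= => -[[A V] [/= /nbhs_ballP[d /= d0 dA] nV] AV].
exists d => //; exists V => // t y t01 Sy st Vy; apply: (AV (t, y)).
  by split => //; apply: dA.
by split; rewrite //= in_itv.
Qed.

(** Uniform continuity in time by compactness. In the predicate only the first time and point are
    confined to the piece [A], so pieces combine by taking the smaller [d]. *)
Lemma homotopy_uniform e : 0 < e -> exists2 d, 0 < d & forall s t x,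
  0 <= s <= 1 -> 0 <= t <= 1 -> S x -> `|s - t| < d -> `|H (s, x) - H (t, x)| <= e.
Proof.
move=> e0; have e20 : 0 < e / 2 by rewrite divr_gt0.
pose P (A : set (R * E4)) := exists2 d : R, 0 < d & forall (s t : R) (x : E4), A (s, x) ->
  0 <= s <= 1 -> 0 <= t <= 1 -> S x -> `|s - t| < d -> `|H (s, x) - H (t, x)| <= e.
suff [d d0 Hd] : P ((`[0, 1] : set R) `*` S).
  exists d => // s t x s01 t01 Sx; apply: Hd => //.
have cK : compact ((`[0, 1] : set R) `*` (S : set E4)).
  by apply: compact_setX; [exact: segment_compact|exact: compact_sphere].
apply: (@compact_induction _ _ P cK).
- by exists 1.
- by move=> A B AB [d d0 Hd]; exists d => // s t x /AB; exact: Hd.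
- move=> A B [d d0 Hd] [d' d'0 Hd']; exists (Num.min d d'); first by rewrite lt_min d0.
  by move=> s t x [|] ? ? ? ?; rewrite lt_min => /andP[? ?]; [exact: Hd|exact: Hd'].
move=> -[s x] [/= + Sx]; rewrite in_itv /= => s01.
have [d d0 [V nV Hd]] := near_homotopy s01 Sx e20.
have d20 : 0 < d / 2 by rewrite divr_gt0.
exists (ball s (d / 2) `*` V).
  by exists (ball s (d / 2), V) => //; split => //; exact: nbhsx_ballx.
exists (d / 2) => // r t y [/= sr Vy] r01 t01 Sy rt.
have st : `|s - t| < d.
  by rewrite (le_lt_trans (ler_distD r _ _))// (splitr d) ltrD.
rewrite (le_trans (ler_distD (H (s, x)) _ _))// (splitr e) lerD//; last exact: Hd.
rewrite distrC; apply: Hd => //; apply: lt_trans sr _.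
by rewrite ltr_pdivrMr// ltr_pMr// ltr1n.
Qed.

Lemma coord_le_norm (u v : 'rV[R]_3) (j : 'I_3) : `|u 0 j - v 0 j| <= `|u - v|.
Proof.
have -> : u 0 j - v 0 j = (u - v) 0 j by rewrite !mxE.
rewrite [leRHS]/Num.Def.normr /= mx_normrE.
exact: (le_bigmax _ (fun ij : 'I_1 * 'I_3 => `|(u - v) ij.1 ij.2|) (0, j)).
Qed.

Lemma homotopy_slice_continuous t j : 0 <= t <= 1 ->
  continuous_on_sphere (fun y => H (t, y) 0 j).
Proof.
move=> t01 x Sx e e0; have [d d0 [V nV Hd]] := near_homotopy t01 Sx e0.
apply: filterS nV => y Vy Sy; apply: le_trans (coord_le_norm _ _ _) _.
by apply: Hd => //; rewrite subrr normr0.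
Qed.

Context (HS : forall t x, 0 <= t <= 1 -> S x -> sphere 2^-1 (H (t, x))).

Lemma helicity_primitive_homotopy (f g : 'I_3 -> sfun) h :
  close_to f (fun y => H (0, y)) -> close_to g (fun y => H (1, y)) ->
  helicity_primitive X I f h -> helicity_primitive X I g h.
Proof.
move=> f0 g1 pf; have e0 : 0 < 6^-1 :> R by [].
have [d d0 Hd] := homotopy_uniform e0.
pose n := (Num.truncn d^-1).+1; have dn : d^-1 < n%:R by exact: truncnS_gt.
have n0 : 0 < n%:R :> R by rewrite ltr0n.
have kn k : (k <= n)%N -> 0 <= (k%:R / n%:R : R) <= 1.
  by move=> kn; rewrite divr_ge0//= ler_pdivrMr// mul1r ler_nat.
(* The claim quantifies over every smooth map close to the slice: a step may then start from any
   approximation of the previous slice, and the base case passes from [f] to another map close to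
   the same slice. *)
suff chain k : (k <= n)%N -> forall g, close_to g (fun y => H (k%:R / n%:R, y)) ->
    helicity_primitive X I g h.
  by apply: (chain n) => //; rewrite divff// gt_eqF.
elim: k {g g1} => [_ g|k IH ltkn g gk].
  rewrite mul0r => g0; apply: helicity_primitive_close f0 g0 _ pf => y Sy j.
  by rewrite subrr normr0 ltW.
have [q qk] := close_to_exists (fun y Sy => HS (kn k (ltnW ltkn)) Sy)
  (fun j => homotopy_slice_continuous j (kn k (ltnW ltkn))).
apply: helicity_primitive_close qk gk _ (IH (ltnW ltkn) q qk) => y Sy j.
apply: le_trans (coord_le_norm _ _ _) _; apply: Hd => //; [exact: kn (ltnW ltkn)|exact: kn|].
(* Consecutive times are 1/n apart, and n was chosen with 1/n < d. *)
rewrite distrC -mulrBl -natrB// subSnn mul1r ger0_norm ?invr_ge0 ?ltW//.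
by rewrite -[d]invrK ltf_pV2 ?posrE ?invr_gt0.
Qed.
End Homotopy.

Lemma close_to_double (f : 'I_3 -> sfun) (u : E4 -> 'rV[R]_3) :
  (forall y, S y -> sphere 2^-1 (u y)) -> (forall j y, S y -> f j y = 2 * u y 0 j) ->
  close_to f u.
Proof.
move=> Su fE; split=> [|y Sy].
  apply: sfun_ext => y Sy; rewrite dot3_sfun sfun1//.
  transitivity (2 * 2 * dot3 (u y 0) (u y 0)).
    by rewrite /dot3 !fE//; ring.
  by rewrite (dot3_sphere (Su y Sy)); field.
have -> : dot3 (fun j => f j y) (u y 0) = 2 * dot3 (u y 0) (u y 0).
  by rewrite /dot3 !fE//; ring.
by rewrite (dot3_sphere (Su y Sy)); lra.
Qed.
End SphereMaps.

Theorem theorem2p1 (R : realType) (phi : 'rV[R]_4 -> 'rV[R]_3)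
    (phi_maps : forall x : 'rV[R]_4, sphere 1 x -> sphere 2^-1 (phi x))
    (phi_smooth : smooth_on (sphere 1) phi)
    (phi_htpy : homotopic (R := R) (sphere 1) (sphere 2^-1) hopf phi) :
  (energyF (@hopf R) <= energyF phi)%E.
Proof.
have [H [cH HS H0 H1]] := phi_htpy.
pose f j : @sfun R := sfun_cst 2 * sfun_lift phi_smooth j.
have fE j y : sphere 1 y -> f j y = 2 * phi y 0 j.
  by move=> Sy; rewrite sfunM sfun_cstE// sfun_liftE.
have hH0 : close_to (@hopf_sfun R) (fun y => H (0, y)).
  apply: close_to_double => [y Sy|j y Sy]; first by rewrite H0//; exact: hopf_sphere.
  by rewrite hopf_sfunE// H0.
have fH1 : close_to f (fun y => H (1, y)).
  apply: close_to_double => [y Sy|j y Sy]; first by rewrite H1//; exact: phi_maps.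
  by rewrite fE// H1.
have [a ca Ia] := helicity_primitive_homotopy cH HS hH0 fH1 (@helicity_hopf R).
rewrite (energyF_pull (@hopf_sphere R) (@hopf_sfunE R)) (energyF_pull phi_maps fE) lee_fin.
pose O := pull (@frame_derive R) f.
(* The bound is twice the helicity 8 V inherited from the Hopf map, and 16 V is exactly the value
   that the Hopf map attains. *)
have : 16 * S3_mean (1 : @sfun R) <= S3_mean (dot3 O O).
  rewrite -(dot3_ext ca ca); apply: le_trans (S3_helicity_le a); rewrite Ia.
  by move: (S3_mean 1) => V; lra.
rewrite -S3_mean_pull_hopf; move: (S3_mean _) (S3_mean _) => V W VW.
by apply: ler_wpM2l => //; rewrite invr_ge0.
Qed.
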